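(* Fix $(m_1,m_2,m_3)\in\mathscr E$, let $f$ be its Bowen-Series function and let $\Gamma$ be the group from which $f$ is constructed. Let $\alpha\in\mathscr O=\mathscr O_1\cup\mathscr O_2\cup\mathscr O_3\cup\mathscr O_4$. Then $f_\alpha$ is Markov with respect to $\mathcal P_\alpha$ if and only if $\alpha$ is a hyperbolic fixed point of $\Gamma$ (that is, $\alpha$ is fixed by some hyperbolic element of $\Gamma$).
   Context: Indices $i\in\{1,2,3,4\}$ are read modulo 4. $\mathscr E$ is the set of $(m_1,m_2,m_3)\in\mathbb N^3$ with $1/m_1+1/m_2+1/m_3<1$, with $m_1,m_2$ even, and such that $2\in\{m_1,m_2,m_3\}$ implies $m_3=2$. Bowen-Series domain: $\mathscr F\subset\mathbb D$ is the hyperbolic quadrilateral with vertices $v_1,v_2,v_3,v_4$ in counterclockwise order, obtained by gluing a hyperbolic triangle with angles $\pi/m_1,\pi/m_2,\pi/m_3$ to its mirror image along the side joining the vertices of angles $\pi/m_1$ and $\pi/m_2$; its angles are $\pi/m_3$ at $v_1,v_3$, $2\pi/m_2$ at $v_2$, $2\pi/m_1$ at $v_4$, and $v_2,v_4$ lie on the vertical diameter of $\mathbb D$. Let $r_i$ be the side joining $v_i$ to $v_{i+1}$ and $\ell_i$ the side joining $v_{i-1}$ to $v_i$ (so $\ell_{i+1}=r_i$). $T_1$ is the hyperbolic rotation about $v_2$ mapping $r_1$ onto $r_2$ (with $T_1v_1=v_3$), $T_2=T_1^{-1}$; $T_3$ is the rotation about $v_4$ mapping $r_3$ onto $r_4$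 (with $T_3v_3=v_1$), $T_4=T_3^{-1}$. $\Gamma$ is the Fuchsian triangle group generated by the $T_i$, with fundamental domain $\mathscr F$. Let $N_i$ be the set of geodesics through $v_i$ containing the image of some side of $\mathscr F$ under some element of $\Gamma$, and $n_i=\#N_i$; then $(n_1,n_2,n_3,n_4)=(m_3,m_2/2,m_3,m_1/2)$. The $2n_i$ endpoints on $\mathbb S^1$ of the geodesics in $N_i$ are labelled $a_i^1,\dots,a_i^{2n_i}$ in counterclockwise order, $a_i^1$ being the endpoint of the geodesic containing $\ell_i$ that lies on the same side of $v_i$ as $v_{i-1}$. One has $a_i^{n_i}=a_{i+1}^1$ and $a_i^{2n_i}=a_{i+1}^{n_{i+1}+1}$. Intervals $[x,y)$ are counterclockwise arcs; the intervals $[a_i^1,a_i^{n_i})$, $1\le i\le 4$, partition $\mathbb S^1$. The Bowen-Series function $f:\mathbb S^1\to\mathbb S^1$ is $f(x)=T_{i-1}(x)$ for $x\in[a_i^1,a_i^{n_i})$. Let $W$ be the set of all $a_i^k$. Deformations: $\mathscr O_i=[a_i^{n_i},a_i^{n_i+1})$ (on which $f=T_i$). For $\alpha\in\mathscr O_i$, $f_\alpha(x)=T_{i-1}(x)$ if $x\in[a_i^{n_i},\alpha)$ and $f_\alpha(x)=f(x)$ otherwise. Put $W_\alpha=W\cup\{f_\alpha^k(\alpha)\}_{k\ge0}\cup\{f_\alpha^k(T_{i-1}\alpha)\}_{k\ge0}$; $\mathcal P_\alpha$ is the partition of $\mathbb S^1$ into left-closed, right-open intervals whose endpoints are the elements of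 $W_\alpha$. A function $g$ is Markov with respect to a partition if the partition is finite and, for any partition elements $I,J$, $g(I)\cap J\ne\emptyset$ implies $g(I)\supset J$. (In particular, $f_\alpha$ Markov with respect to $\mathcal P_\alpha$ requires $W_\alpha$ finite.) *)

(* Defs.v *)
From HB Require Import structures.
From mathcomp Require Import all_boot all_order all_algebra.
From mathcomp Require Import complex.
From mathcomp Require Import all_classical all_reals all_analysis.

Set Implicit Arguments.
Unset Strict Implicit.
Unset Printing Implicit Defensive.

Import Order.TTheory GRing.Theory Num.Theory.

Local Open Scope classical_set_scope.
Local Open Scope card_scope.
Local Open Scope ring_scope.

(* Indices are elements of 'Z_4; the index 4 is therefore the same as 0. *)

(* Positivity of the m's is explicit because 0^-1 = 0 in MathComp. *)
Definition admissible (m1 m2 m3 : nat) : bool :=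
  [&& [&& (0 < m1)%N, (0 < m2)%N & (0 < m3)%N],
      m1%:R^-1 + m2%:R^-1 + m3%:R^-1 < 1 :> rat,
      ~~ odd m1, ~~ odd m2 &
      (2%N \in [:: m1; m2; m3]) ==> (m3 == 2%N)].

Section HyperbolicDisk.
Variable R : realType.
Local Notation C := R[i].
Implicit Types (p q r x y z : C) (g : 'M[C]_2).

Definition disk : set C := [set z | `|z| < 1].
Definition circle : set C := [set z | `|z| = 1].
Definition closed_disk : set C := [set z | `|z| <= 1].

(* The isometry of the disk sending p to 0 with positive derivative at p. It
   maps geodesics through p to diameters and preserves angles at p, so
   disk_chart p q is a positive multiple of the initial direction at p of the
   geodesic from p to q. *)
Definition disk_chart p z : C := (z - p) / (1 - p^* * z).

Definition geodesic_segment p q : set C :=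
  [set z | disk z /\
     exists t : R, 0 <= t <= 1 /\ disk_chart p z = t%:C%C * disk_chart p q].

(* Rays and complete geodesics are taken with their endpoints on the circle. *)
Definition geodesic_ray p q : set C :=
  [set z | closed_disk z /\
     exists t : R, 0 <= t /\ disk_chart p z = t%:C%C * disk_chart p q].

Definition geodesic_line p q : set C :=
  [set z | closed_disk z /\
     exists t : R, disk_chart p z = t%:C%C * disk_chart p q].

Definition is_geodesic (G : set C) : Prop :=
  exists p q, [/\ disk p, disk q, p <> q & G = geodesic_line p q].

(* The angle in [0, pi] at p between the geodesic segments to q and to r. *)
Definition hyperbolic_angle p q r : R :=
  let u := disk_chart p q in let w := disk_chart p r in
  acos (complex.Re (u^* * w) / (Normc.normc u * Normc.normc w)).

(* r lies strictly to the left of the oriented geodesic from p to q. *)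
Definition left_of p q r : Prop :=
  0 < complex.Im ((disk_chart p q)^* * disk_chart p r).

(* x, y, z are three distinct points of the circle in counterclockwise order:
   the triangle x y z has positive signed area. *)
Definition ccw x y z : Prop :=
  [/\ circle x, circle y, circle z & 0 < complex.Im ((y - x)^* * (z - x))].

(* The counterclockwise arc [x, y); empty when x = y. *)
Definition circle_arc x y : set C :=
  [set z | [/\ circle x, circle y & z = x /\ x <> y \/ ccw x z y]].

(* The group SU(1,1), acting on the closed disk by orientation-preserving
   isometries; a matrix and its opposite define the same map. *)
Definition SU11 g : Prop :=
  [/\ g 1 0 = (g 0 1)^*, g 1 1 = (g 0 0)^* & \det g = 1].

Definition mobius g z : C := (g 0 0 * z + g 0 1) / (g 1 0 * z + g 1 1).

Definition hyperbolic g : Prop := SU11 g /\ 2 < `|\tr g|.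

Inductive generated_group (T : 'Z_4 -> 'M[C]_2) : 'M[C]_2 -> Prop :=
| generated_gen i : generated_group T (T i)
| generated_1 : generated_group T 1
| generated_M g h : generated_group T g -> generated_group T h ->
    generated_group T (g * h)
| generated_V g : generated_group T g -> generated_group T g^-1.

(* The triangle v4 v2 v1, with angles pi/m1, pi/m2, pi/m3, is glued along the
   side on the vertical diameter to its mirror image, whose third vertex
   is v3. Strict convexity with v1, ..., v4 in counterclockwise order is
   expressed at each vertex. *)
Definition bowen_series_domain (m1 m2 m3 : nat) (v : 'Z_4 -> C) : Prop :=
  [/\ (forall i, disk (v i)),
      [/\ complex.Re (v 2) = 0, complex.Re (v 4) = 0 & v 3 = - (v 1)^*],
      (forall i, left_of (v i) (v (i + 1)) (v (i + 2))) &
      [/\ hyperbolic_angle (v 4) (v 1) (v 2) = pi / m1%:R,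
          hyperbolic_angle (v 2) (v 1) (v 4) = pi / m2%:R &
          hyperbolic_angle (v 1) (v 2) (v 4) = pi / m3%:R]].

(* An orientation-preserving isometry fixing v2 and mapping v1 to v3 is the
   rotation about v2 that maps the side r1 onto r2; similarly for T3. *)
Definition side_rotations (v : 'Z_4 -> C) (T : 'Z_4 -> 'M[C]_2) : Prop :=
  [/\ (forall i, SU11 (T i)),
      mobius (T 1) (v 2) = v 2 /\ mobius (T 1) (v 1) = v 3,
      T 2 = (T 1)^-1,
      mobius (T 3) (v 4) = v 4 /\ mobius (T 3) (v 3) = v 1 &
      T 4 = (T 3)^-1].

Definition side (v : 'Z_4 -> C) (i : 'Z_4) : set C :=
  geodesic_segment (v i) (v (i + 1)).

Definition vertex_geodesics (v : 'Z_4 -> C) (T : 'Z_4 -> 'M[C]_2) (i : 'Z_4) :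
    set (set C) :=
  [set G | [/\ is_geodesic G, G (v i) &
     exists g j, generated_group T g /\ mobius g @` side v j `<=` G]].

(* The endpoints of the n i geodesics through v i are labelled a i k, with
   1 <= k <= 2 * n i, counterclockwise from the endpoint of the ray from v i
   through v (i - 1). *)
Definition vertex_labels (v : 'Z_4 -> C) (T : 'Z_4 -> 'M[C]_2)
    (n : 'Z_4 -> nat) (a : 'Z_4 -> nat -> C) : Prop :=
  forall i : 'Z_4,
  [/\ vertex_geodesics v T i #= `I_(n i),
      [set x | exists2 k, (1 <= k <= 2 * n i)%N & x = a i k] =
        [set x | circle x /\ exists2 G, vertex_geodesics v T i G & G x],
      (forall j k l : nat, (1 <= j)%N -> (j < k)%N -> (k < l)%N ->
         (l <= 2 * n i)%N -> ccw (a i j) (a i k) (a i l)) &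
      geodesic_ray (v i) (v (i - 1)) (a i 1%N)].

Section Maps.
Variables (T : 'Z_4 -> 'M[C]_2) (n : 'Z_4 -> nat) (a : 'Z_4 -> nat -> C).

(* The value off the circle is irrelevant; on the circle exactly one i is
   picked, as the arcs partition the circle. *)
Definition bowen_series (x : C) : C :=
  if [pick i : 'Z_4 | x \in circle_arc (a i 1%N) (a i (n i))] is Some i
  then mobius (T (i - 1)) x else x.

Definition deformation_arc (i : 'Z_4) : set C :=
  circle_arc (a i (n i)) (a i (n i).+1).

(* Meant for alpha in deformation_arc i. *)
Definition deformed_map (i : 'Z_4) (alpha x : C) : C :=
  if x \in circle_arc (a i (n i)) alpha then mobius (T (i - 1)) x
  else bowen_series x.

Definition label_set : set C :=
  [set x | exists i k, (1 <= k <= 2 * n i)%N /\ x = a i k].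

Definition deformed_label_set (i : 'Z_4) (alpha : C) : set C :=
  label_set
  `|` [set iter k (deformed_map i alpha) alpha | k in [set: nat]]
  `|` [set iter k (deformed_map i alpha) (mobius (T (i - 1)) alpha)
         | k in [set: nat]].

End Maps.

(* The arcs [x, y) between consecutive points of W. They partition the circle
   if W is finite with at least two points, and fail to do so if W is
   infinite. *)
Definition arcs_of (W : set C) : set (set C) :=
  [set I | exists x y, [/\ W x, W y, x <> y, I = circle_arc x y &
     forall w, W w -> circle_arc x y w -> w = x]].

Definition is_markov (g : C -> C) (P : set (set C)) : Prop :=
  [/\ finite_set P, partition P id circle &
      forall I J, P I -> P J -> g @` I `&` J !=set0 -> J `<=` g @` I].

Definition hyperbolic_fixed_point (T : 'Z_4 -> 'M[C]_2) (x : C) : Prop :=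
  exists g, [/\ generated_group T g, hyperbolic g & mobius g x = x].

End HyperbolicDisk.

(* Main.v *)
(* In the hyperboloid model, the side pairing [T i] is the reflection in the side [i] followed
   by the reflection in the vertical axis. Hence the group preserves the net of mirrors of the
   reflection group of the quadrilateral, and by Tits' theorem on the signs of roots no mirror
   meets the interior of the quadrilateral; in particular the group is discrete and no label
   other than the ends of the sides enters the sectors where the branch changes.

   Every branch is non-contracting for the visual metric seen from the center, and two
   consecutive branches expand strictly. If the map is Markov then the orbit of alpha is
   eventually periodic, and the word read along a period fixes a point with derivative
   greater than 1, so it is hyperbolic; a conjugate of it fixes alpha.

   Conversely let g be hyperbolic with fixed points alpha and y, and let h be the word read
   along an initial piece of the orbit of alpha. The geodesic from h y to h alpha stays at a
   bounded distance from the center, because two consecutive steps cannot push a far geodesic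
   further away. So the conjugates of g by the words h are bounded, hence finite in number by
   discreteness, and the orbit of alpha is finite. The resulting finite set of endpoints is
   invariant, which gives the Markov property. *)
Require Import Defs.
From HB Require Import structures.
From mathcomp Require Import all_boot all_order all_algebra.
From mathcomp Require Import complex.
From mathcomp Require Import all_classical all_reals all_analysis.
From mathcomp Require Import ring lra zify.

Set Implicit Arguments.
Unset Strict Implicit.
Unset Printing Implicit Defensive.

Import Order.TTheory GRing.Theory Num.Theory.
Local Open Scope classical_set_scope.
Local Open Scope ring_scope.

(** * Root signs in a reflection group *)

(** Evenness of [m1] and [m2] makes every angle of the quadrilateral equal to pi divided by an
    integer at least 2, as Tits' argument requires. Four normals in a space of dimension three are
    linearly dependent, so the sign of a root is not visible in its coordinates; it is read off its
    values on the interior of the quadrilateral.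

    Strict expansion fails exactly at the points [sE k], the ends of side lines where a branch
    begins: the derivative there is 1. Along the orbit of alpha this is harmless, because the image
    of [sE k] is some [tE l], around which the next branch expands. In the converse it is the main
    obstacle. The companion point [y] is moved by the words chosen for alpha and need not lie beyond
    the side being crossed, so a geodesic can recede from the center in one step. For close points
    this occurs only near [sE k], and the definite gain near [tE l] repays the loss.

    On a deformation arc a point lies beyond both sides at the vertex, so neither of the two
    competing rotations contracts, and one set of estimates serves every alpha. *)

Section ReflectionGroup.
Variables (R : realType) (V : lmodType R) (I : eqType) (B : V -> V -> R).
Hypothesis BC : forall u w, B u w = B w u.
Hypothesis BD : forall u w x, B (u + w) x = B u x + B w x.
Hypothesis BZ : forall c u w, B (c *: u) w = c * B u w.
Variable e : I -> V.
Hypothesis e1 : forall i, B (e i) (e i) = 1.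

Definition refl i u : V := u - (2 * B (e i) u) *: e i.
Definition act (w : seq I) u : V := foldr refl u w.

Let BDr u w x : B x (u + w) = B x u + B x w.
Proof. by rewrite BC BD !(BC _ x). Qed.
Let BZr c u w : B w (c *: u) = c * B w u.
Proof. by rewrite BC BZ BC. Qed.

Let BNr u w : B w (- u) = - B w u.
Proof. by rewrite -scaleN1r BZr mulN1r. Qed.

Lemma reflD i u w : refl i (u + w) = refl i u + refl i w.
Proof. by rewrite /refl BDr mulrDr scalerDl opprD addrACA. Qed.
Lemma reflZ i c u : refl i (c *: u) = c *: refl i u.
Proof. by rewrite /refl BZr scalerBr scalerA mulrCA. Qed.
Lemma reflE i u : refl i u = u + (- 2 * B (e i) u) *: e i.
Proof. by rewrite /refl mulNr scaleNr. Qed.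
Lemma reflK i : involutive (refl i).
Proof.
move=> u; rewrite !reflE BDr BZr e1 -addrA -scalerDl.
by rewrite [X in X *: _](_ : _ = 0) ?scale0r ?addr0 //; ring.
Qed.
Lemma refl_e i : refl i (e i) = - e i.
Proof.
by rewrite /refl e1 mulr1 -[X in X - _]scale1r -scalerBl -scaleN1r; congr (_ *: _); ring.
Qed.

Lemma actD w u x : act w (u + x) = act w u + act w x.
Proof. by elim: w => //= i w ->; rewrite reflD. Qed.
Lemma actZ w c u : act w (c *: u) = c *: act w u.
Proof. by elim: w => //= i w ->; rewrite reflZ. Qed.
Lemma actN w u : act w (- u) = - act w u.
Proof. by rewrite -scaleN1r actZ scaleN1r. Qed.
Lemma act_cat w x u : act (w ++ x) u = act w (act x u).
Proof. by rewrite /act foldr_cat. Qed.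
Lemma act_rcons w i u : act (rcons w i) u = act w (refl i u).
Proof. by rewrite -cats1 act_cat. Qed.

Lemma act_rev w u : act (rev w) (act w u) = u.
Proof. by elim: w u => //= i w IH u; rewrite rev_cons act_rcons reflK IH. Qed.

(** Words are compared through the operators they define on [V]: the length is that of an element of
    the linear group, not of an abstract Coxeter group. *)
Definition reduced w := forall x, act x =1 act w -> (size w <= size x)%N.

Lemma reduced_exists w : exists2 x, reduced x & act x =1 act w.
Proof.
have [n] := ubnP (size w); elim: n w => // n IH w wn.
have [wred|/existsNP[x /not_implyP[xw /negP]]] := EM (reduced w); first by exists w.
rewrite -ltnNge => xlt.
have [|y yr yx] := IH x; first exact: (leq_trans xlt).
by exists y => // u; rewrite yx xw.
Qed.

Fixpoint alt (a b : I) k := if k is k'.+1 then a :: alt b a k' else [::].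

Lemma size_alt a b k : size (alt a b k) = k.
Proof. by elim: k a b => //= k IH a b; rewrite IH. Qed.

Lemma alt_cat a b k l :
  alt a b (k + l) = alt a b k ++ (if odd k then alt b a l else alt a b l).
Proof.
elim: k a b => //= k IH a b; rewrite IH /=.
by case: (odd k).
Qed.

Lemma alt_rcons a b k : alt a b k.+1 = rcons (alt a b k) (if odd k then b else a).
Proof. by rewrite -addn1 alt_cat -cats1; case: odd. Qed.

(** Consecutive Chebyshev polynomials of the second kind, [U_(k-1)] and [U_k], evaluated at [c],
    starting from [U_(-1) = 0]. *)
Fixpoint cheb (c : R) k : R * R :=
  if k is k'.+1 then let: (x, y) := cheb c k' in (y, 2 * c * y - x) else (0, 1).

(** The roots of the dihedral group of [a] and [b]; the index of the root is the letter that would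
    continue the alternating word. Signs in rank two thus become signs of Chebyshev values. *)
Lemma act_alt c a b k : B (e a) (e b) = - c ->
  act (alt a b k) (e (if odd k then b else a)) =
  (cheb c k).2 *: e a + (cheb c k).1 *: e b.
Proof.
elim: k a b => [|k IH] a b ab /=; first by rewrite scale1r scale0r addr0.
have := IH b a; rewrite BC => /(_ ab).
rewrite (_ : (if odd k then a else b) = (if ~~ odd k then b else a)); last by case: odd.
move=> ->; case: (cheb c k) => x y /=.
rewrite reflE BDr !BZr ab e1 [y *: _ + _]addrC -addrA [y *: _ + _]addrC addrA.
by rewrite -scalerDl; congr (_ *: _ + _); ring.
Qed.

Lemma cheb_sin t k : sin t * (cheb (cos t) k).1 = sin (t *+ k) /\
  sin t * (cheb (cos t) k).2 = sin (t *+ k.+1).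
Proof.
elim: k => [|k]; first by rewrite /cheb mulr0n mulr1n sin0 mulr0 mulr1.
rewrite /=; case: (cheb _ k) => x y /= [xE yE]; split => //.
rewrite mulrBr xE mulrCA mulrC yE [in sin (t *+ _.+2)]mulrS.
rewrite (_ : t *+ k = t *+ k.+1 - t); last by rewrite mulrSr addrK.
by rewrite !sinD sinN cosN; ring.
Qed.

Lemma cheb_ge1 c k : 1 <= c -> 0 <= (cheb c k).1 <= (cheb c k).2.
Proof.
move=> c1; elim: k => [|k] /=; first by rewrite lexx ler01.
case: (cheb c k) => x y /= /andP[x0 xy]; rewrite (le_trans x0 xy) /=.
by have : 0 <= (c - 1) * y; [apply: mulr_ge0; lra | lra].
Qed.

Section Finite.
Variables (n : nat) (n2 : (2 <= n)%N).
Let t : R := pi / n%:R.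
Let n0 : 0 < n%:R :> R. Proof. by rewrite ltr0n; lia. Qed.
Let nt : t *+ n = pi. Proof. by rewrite /t -(mulr_natr (pi / _)) divfK // gt_eqF. Qed.
Let st : 0 < sin t.
Proof.
apply: sin_gt0_pi; rewrite /t divr_gt0 ?pi_gt0 //=.
by rewrite ltr_pdivrMr // ltr_pMr ?pi_gt0 // ltr1n; lia.
Qed.

Lemma cheb_ge0 k : (k < n)%N -> 0 <= (cheb (cos t) k).1 /\ 0 <= (cheb (cos t) k).2.
Proof.
have t0 : 0 <= t by rewrite /t divr_ge0 ?pi_ge0 // ltW.
have S m : (m <= n)%N -> 0 <= sin (t *+ m).
  move=> mn; apply: sin_ge0_pi; rewrite mulrn_wge0 //= -nt.
  by rewrite -(mulr_natr t m) -(mulr_natr t n); apply: ler_wpM2l => //; rewrite ler_nat.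
move=> kn; have := cheb_sin t k; case: (cheb _ k) => x y [xE yE].
have := S k (ltnW kn); have := S _ kn; rewrite -xE -yE.
by rewrite !pmulr_rge0.
Qed.

Lemma cheb_n : cheb (cos t) n = (0, -1).
Proof.
have := cheb_sin t n; case: (cheb _ n) => x y [].
rewrite nt mulrS nt sinDpi sinpi /= => /eqP.
rewrite mulf_eq0 gt_eqF //= => /eqP -> yE; congr (_, _).
by apply: (mulfI (lt0r_neq0 st)); rewrite mulrN1.
Qed.

Lemma cheb_n1 : cheb (cos t) n.-1 = (1, 0).
Proof.
have : cheb (cos t) n.-1.+1 = (0, -1) by rewrite prednK ?cheb_n //; lia.
have -> : n.-1 = n.-2.+1 by lia.
by rewrite /=; case: (cheb _ n.-2) => x y /= [-> yE]; congr (_, _); lra.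
Qed.

(** Both sides fix the vectors orthogonal to [e a] and [e b], and they agree on these two roots
    because [cheb] takes the values (1, 0) and (0, -1) at [n - 1] and [n]. As [cos t ^+ 2 != 1], the
    plane and its orthogonal complement span [V]. *)
Lemma braid a b : B (e a) (e b) = - cos t -> act (alt a b n) =1 act (alt b a n).
Proof.
move=> ab; have ba : B (e b) (e a) = - cos t by rewrite BC.
have nE : n.-1.+1 = n by lia.
have P x y : B (e x) (e y) = - cos t ->
    act (alt x y n) (e (if odd n then y else x)) =
    act (alt y x n) (e (if odd n then y else x)).
  move=> xy; rewrite (act_alt n xy) cheb_n /= scale0r addr0 scaleN1r.
  rewrite -nE alt_rcons /= act_rcons.
  rewrite (_ : (if ~~ odd n.-1 then y else x) = (if odd n.-1 then x else y)); last by case: odd.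
  rewrite refl_e -scaleN1r -[RHS]/(act _ (- _)) -scaleN1r actZ (act_alt (c := cos t)) 1?BC //.
  by rewrite cheb_n1 /= scale0r add0r scale1r.
have fixed x y k u : B (e x) u = 0 -> B (e y) u = 0 -> act (alt x y k) u = u.
  move=> xu yu; elim: k x y xu yu => //= k IH x y xu yu.
  by rewrite IH // /refl xu mulr0 scale0r subr0.
move=> u; pose c := cos t.
have c1 : 1 - c ^+ 2 != 0 by rewrite /c -sin2cos2 expf_neq0 // gt_eqF.
(* Coordinates of the projection of [u] to the plane, from the Gram matrix with off-diagonal entry
   [- c] and determinant [1 - c ^+ 2]. *)
pose p := (B (e a) u + c * B (e b) u) / (1 - c ^+ 2).
pose q := (B (e b) u + c * B (e a) u) / (1 - c ^+ 2).
pose u' := u - p *: e a - q *: e b.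
have ua : B (e a) u' = 0.
  by rewrite /u' !(BDr, BNr, BZr) e1 ab /p /q -/c; field.
have ub : B (e b) u' = 0.
  by rewrite /u' !(BDr, BNr, BZr) e1 ba /p /q -/c; field.
have uE : u = u' + (p *: e a + q *: e b).
  by rewrite /u' -[X in X + (_ + _)]addrA -opprD addrNK.
rewrite uE !(actD _ u') (fixed _ _ _ _ ua ub) (fixed _ _ _ _ ub ua).
congr (_ + _); rewrite !actD !actZ.
by have := P _ _ ab; have := P _ _ ba; case: odd => -> ->.
Qed.

End Finite.

(** The positive cone. It is a parameter because the simple roots may be dependent, and coordinates
    then do not define signs. *)
Variable C : V -> Prop.
Hypothesis Ce : forall i, C (e i).
Hypothesis CC : forall p q u w, 0 <= p -> 0 <= q -> 0 < p + q ->
  C u -> C w -> C (p *: u + q *: w).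
Hypothesis angles : forall i j, i != j -> B (e i) (e j) <= -1 \/
  exists2 n, (2 <= n)%N & B (e i) (e j) = - cos (pi / n%:R).

(** Reflections are involutions, so a reduced word never repeats a letter at once; with two letters
    available it alternates. *)
Lemma reduced_alt s t u : s != t -> all (mem [:: s; t]) u -> reduced u ->
  exists a b k, [/\ u = alt a b k, a != b & (a, b) = (s, t) \/ (a, b) = (t, s)].
Proof.
move=> st; elim: u => [_ _|i u IH /= /andP[ist ust] ured].
  by exists s, t, 0%N; split => //; left.
have ured' : reduced u.
  by move=> x xu; have := ured (i :: x); apply => v /=; rewrite xu.
have [a [b [k [uE ab abst]]]] := IH ust ured'.
have [iE|ia] := eqVneq i b.
  exists b, a, k.+1; split; first by rewrite /= iE uE.
    by rewrite eq_sym.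
  by case: abst => [[-> ->]|[-> ->]]; [right|left].
have ia' : i = a.
  by move: ist ia; rewrite !inE; case: abst => [[-> ->]|[-> ->]] /orP[]/eqP -> //; rewrite eqxx.
case: k uE => [|k] uE.
  exists a, b, 1%N; split => //; by rewrite uE ia'.
exfalso; have /(_ (alt b a k)) := ured.
rewrite uE ia' /= !size_alt ltnNge leqnSn /= => H; apply: notF; apply: H => v /=.
by rewrite reflK.
Qed.

(** Tits' induction. Split [w] as [v ++ u] with lengths adding up, [u] in the letters [s], [t] and
    [v] as short as possible. Appending [s] or [t] then never shortens [v], so induction puts
    [act v (e s)] and [act v (e t)] in [C], and the root [act u (e s)] is a nonnegative combination
    of [e s] and [e t]. *)
Lemma reduced_pos_gen w s : reduced w ->
  (forall x, act x =1 act (rcons w s) -> (size w <= size x)%N) -> C (act w (e s)).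
Proof.
have [n] := ubnP (size w); elim: n w s => // n IH w s wn wred ws.
have [->|[w1 [t wE]]] : w = [::] \/ exists w1 t, w = rcons w1 t.
- by case/lastP: w {wn wred ws} => [|w1 t]; [left | right; exists w1, t].
- exact: Ce.
have st : s != t.
  apply/eqP => st; have := ws w1; rewrite wE size_rcons ltnn => H.
  by apply: notF; apply: H => u; rewrite st !act_rcons reflK.
pose D m := exists v u, [/\ size v = m, act (v ++ u) =1 act w,
  size (v ++ u) = size w & all (mem [:: s; t]) u].
have exD : exists m, `[< D m >].
  exists (size w1); apply/asboolP; exists w1, [:: t]; split => //.
  - by rewrite cats1 wE.
  - by rewrite cats1 wE.
  by rewrite /= !inE eqxx orbT.
case: (ex_minnP exD) => m /asboolP[v [u [vm vuw suw ust]]] mmin.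
have vlt : (size v < n)%N.
  have : (m <= size w1)%N.
    apply: mmin; apply/asboolP; exists w1, [:: t]; split => //.
    - by rewrite cats1 wE.
    - by rewrite cats1 wE.
    by rewrite /= !inE eqxx orbT.
  by move: wn; rewrite wE size_rcons vm ltnS => H1 H2; apply: leq_ltn_trans H2 H1.
have vred : reduced v.
  move=> x xv; have := wred (x ++ u); rewrite -suw !size_cat leq_add2r; apply.
  by move=> y; rewrite act_cat xv -act_cat vuw.
have ured : reduced u.
  move=> x xu; have := wred (v ++ x); rewrite -suw !size_cat leq_add2l; apply.
  by move=> y; rewrite act_cat xu -act_cat vuw.
have vpos i : i \in [:: s; t] -> C (act v (e i)).
  move=> ist; apply: IH => // x xvi; rewrite leqNgt; apply/negP => xlt.
  have E : act (x ++ (i :: u)) =1 act w.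
    by move=> y; rewrite act_cat xvi act_rcons /= reflK -act_cat vuw.
  have xs : size (x ++ i :: u) = size w.
    apply/eqP; rewrite eqn_leq wred // andbT -suw !size_cat /=.
    by rewrite addnS -addSn leq_add2r.
  have : `[< D (size x) >].
    by apply/asboolP; exists x, (i :: u); split => //; rewrite /= ist.
  by move=> /mmin; rewrite -vm leqNgt xlt.
have [a [b [k [uE ab abst]]]] := reduced_alt st ust ured.
have nolast x : act u =1 act (rcons x s) -> (size x < size u)%N -> False.
  move=> ux xlt; have := ws (v ++ x); rewrite -suw !size_cat leq_add2l leqNgt xlt => H.
  apply: notF; apply: H => y.
  by rewrite act_rcons -vuw !act_cat ux act_rcons reflK.
(* [u] does not end in [s], so [s] is the letter that continues its alternation. *)
have [{}a [{}b [{}uE {}ab {}abst sE]]] : exists a b, [/\ u = alt a b k, a != b,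
    (a, b) = (s, t) \/ (a, b) = (t, s) & s = if odd k then b else a].
  case: k uE => [|k] uE; first by exists s, t; split => //; left.
  exists a, b; split => //; case: (eqVneq s (if odd k then b else a)) => [sE|].
    exfalso; apply: (nolast (alt a b k)); last by rewrite uE !size_alt.
    by rewrite uE alt_rcons -sE.
  by case: abst => -[-> ->] /=; case: (odd k) => //=; rewrite eqxx.
rewrite -vuw act_cat uE.
have abB : B (e a) (e b) = - (- B (e a) (e b)) by rewrite opprK.
rewrite sE (act_alt k abB) actD !actZ.
have Ca : C (act v (e a)).
  by apply: vpos; case: abst => -[-> _]; rewrite !inE eqxx ?orbT.
have Cb : C (act v (e b)).
  by apply: vpos; case: abst => -[_ ->]; rewrite !inE eqxx ?orbT.
(* Two consecutive Chebyshev values cannot both vanish: the recursion, run backwards, would reach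
   (0, 1) from (0, 0). *)
have nz c : 0 <= (cheb c k).2 -> 0 <= (cheb c k).1 -> 0 < (cheb c k).2 + (cheb c k).1.
  move=> x0 y0; rewrite lt_def addr_ge0 // andbT paddr_eq0 //.
  apply/negP => /andP[/eqP xE /eqP yE].
  have : forall j, cheb c j = (0, 0) -> False.
    elim=> [[/eqP]|j IHj] /=; first by rewrite oner_eq0.
    case: (cheb c j) IHj => x y IHj /= [y_0 x_0]; apply: IHj.
    by rewrite y_0 (_ : x = 0) //; move: x_0; rewrite y_0; lra.
  by move/(_ k); apply; rewrite [LHS]surjective_pairing xE yE.
have [le1|[m2 m2n abE]] := angles ab.
  have /andP[x0 xy] : 0 <= (cheb (- B (e a) (e b)) k).1 <= (cheb (- B (e a) (e b)) k).2.
    by apply: cheb_ge1; lra.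
  by apply: CC => //; [exact: le_trans x0 xy | apply: nz => //; exact: le_trans x0 xy].
rewrite abE opprK.
(* If [u] had length [m2] or more, the braid relation would let it end in [s], against [nolast]. *)
have km : (k < m2)%N.
  rewrite ltnNge; apply/negP => mk.
  pose l := (k - m2)%N; have kE : k = (l + m2)%N by rewrite /l subnK.
  pose x := alt a b l ++ (if odd l then alt a b m2.-1 else alt b a m2.-1).
  apply: (nolast x); last first.
    by rewrite uE /x size_cat (fun_if size) !size_alt if_same kE; lia.
  move=> y; rewrite uE {1}kE alt_cat -cats1 /x -catA !act_cat; congr (act _ _).
  rewrite -act_cat cats1.
  have mE : m2.-1.+1 = m2 by lia.
  have oE : odd m2 = ~~ odd m2.-1 by rewrite -{1}mE.
  rewrite sE kE oddD oE.
  case: (odd l); rewrite /= ?negbK.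
    rewrite (_ : rcons _ _ = alt a b m2); first by rewrite -(braid m2n abE).
    by rewrite -[in RHS]mE alt_rcons; case: (odd m2.-1).
  rewrite (_ : rcons _ _ = alt b a m2); first by rewrite (braid m2n abE).
  by rewrite -[in RHS]mE alt_rcons; case: (odd m2.-1).
have [] := cheb_ge0 m2n km; move=> x0 y0.
by apply: CC => //; exact: nz.
Qed.

(** Either appending [s] does not shorten [w], or a reduced word [z] for the result is lengthened by
    [s], and [act z (e s) = - act w (e s)]. *)
Lemma refl_root_sign w s : C (act w (e s)) \/ C (- act w (e s)).
Proof.
have [x xred xw] := reduced_exists w; rewrite -!xw.
have [H|] := EM (forall y, act y =1 act (rcons x s) -> (size x <= size y)%N).
  by left; apply: reduced_pos_gen.
move=> /existsNP[y /not_implyP[yx /negP]]; rewrite -ltnNge => ylt.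
right; have [z zred zy] := reduced_exists y.
have -> : - act x (e s) = act z (e s).
  by rewrite zy yx act_rcons refl_e actN.
apply: reduced_pos_gen => // u uz.
have /leq_trans -> // : (size z <= size y)%N by apply: zred => v; rewrite zy.
apply: leq_trans (ltnW ylt) _; apply: xred => v.
by rewrite uz act_rcons zy yx act_rcons reflK.
Qed.

(** A reduced word ending in [s] would send [e s] to a negative root, so the reduced word of [w] is
    empty. *)
Lemma refl_fix w : (forall s, ~ C (- act w (e s))) -> act w =1 id.
Proof.
move=> pos; have [x xred xw] := reduced_exists w.
case/lastP: x xred xw => [|x s] xred xw; first by move=> u; rewrite -xw.
exfalso; apply: (pos s); rewrite -xw act_rcons refl_e actN opprK.
have sx : (size x <= size (rcons x s))%N by rewrite size_rcons.
apply: reduced_pos_gen => [y yx|y /xred]; last exact: leq_trans.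
have := xred (rcons y s); rewrite !size_rcons ltnS; apply => u.
by rewrite !act_rcons yx.
Qed.

End ReflectionGroup.

(** * The hyperboloid model *)
Section Lorentz.
Variable R : realType.
Local Notation C := R[i].
Local Notation Re := complex.Re.
Local Notation Im := complex.Im.

Lemma ReM (x y : C) : Re (x * y) = Re x * Re y - Im x * Im y.
Proof. by case: x y => ? ? [? ?]. Qed.
Lemma ImM (x y : C) : Im (x * y) = Re x * Im y + Im x * Re y.
Proof. by case: x y => ? ? [? ?]. Qed.
Lemma ReD (x y : C) : Re (x + y) = Re x + Re y.
Proof. by case: x y => ? ? [? ?]. Qed.
Lemma ImD (x y : C) : Im (x + y) = Im x + Im y.
Proof. by case: x y => ? ? [? ?]. Qed.
Lemma ReN (x : C) : Re (- x) = - Re x.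
Proof. by case: x. Qed.
Lemma ImN (x : C) : Im (- x) = - Im x.
Proof. by case: x. Qed.
Lemma ReJ (x : C) : Re (x^*) = Re x.
Proof. by case: x. Qed.
Lemma ImJ (x : C) : Im (x^*) = - Im x.
Proof. by case: x. Qed.
Lemma Re1 : Re (1 : C) = 1. Proof. by []. Qed.
Lemma Im1 : Im (1 : C) = 0. Proof. by []. Qed.
Lemma Re0 : Re (0 : C) = 0. Proof. by []. Qed.
Lemma Im0 : Im (0 : C) = 0. Proof. by []. Qed.
Lemma ReR (x : R) : Re x%:C%C = x. Proof. by []. Qed.
Lemma ImR (x : R) : Im x%:C%C = 0. Proof. by []. Qed.
Definition ReImE := (ReM, ImM, ReD, ImD, ReN, ImN, ReJ, ImJ, Re1, Im1, Re0, Im0, ReR, ImR).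

Lemma complexP (x y : C) : Re x = Re y -> Im x = Im y -> x = y.
Proof. by case: x y => ? ? [? ?] /= -> ->. Qed.

Definition sqn (z : C) : R := Re z ^+ 2 + Im z ^+ 2.

Lemma sqn_ge0 z : 0 <= sqn z.
Proof. by rewrite addr_ge0 ?sqr_ge0. Qed.
Lemma sqn_eq0 z : (sqn z == 0) = (z == 0).
Proof.
by rewrite paddr_eq0 ?sqr_ge0 // !sqrf_eq0 eq_complex.
Qed.
Lemma sqn_gt0 z : (0 < sqn z) = (z != 0).
Proof. by rewrite lt_def sqn_ge0 andbT sqn_eq0. Qed.
Lemma sqnM x y : sqn (x * y) = sqn x * sqn y.
Proof. by rewrite /sqn !ReImE; ring. Qed.
Lemma sqnJ x : sqn x^* = sqn x.
Proof. by rewrite /sqn !ReImE; ring. Qed.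
Lemma sqnN x : sqn (- x) = sqn x.
Proof. by rewrite /sqn !ReImE; ring. Qed.

Lemma norm_sqn (z : C) : `|z| = (Num.sqrt (sqn z))%:C%C.
Proof. exact: normc_def. Qed.
Lemma circleE (z : C) : circle z <-> sqn z = 1.
Proof.
rewrite /circle /= norm_sqn; split=> [[]|->]; last by rewrite sqrtr1.
by move=> /(congr1 (fun x => x ^+ 2)); rewrite sqr_sqrtr ?sqn_ge0 // expr1n.
Qed.
Lemma diskE (z : C) : disk z <-> sqn z < 1.
Proof.
by rewrite /disk /= norm_sqn -[X in _ < X]/(1%:C%C) ltcR -[X in _ < X]sqrtr1 ltr_sqrt.
Qed.
Lemma closed_diskE (z : C) : closed_disk z <-> sqn z <= 1.
Proof.
by rewrite /closed_disk /= norm_sqn -[X in _ <= X]/(1%:C%C) lecR -[X in _ <= X]sqrtr1 ler_sqrt.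
Qed.

Definition vect := (R^o * R^o * R^o)%type.
Implicit Types u w x : vect.
Definition cx u : R := u.1.1.
Definition cy u : R := u.1.2.
Definition ct u : R := u.2.
Definition vec (a b c : R) : vect := (a, b, c).

Lemma cxD u w : cx (u + w) = cx u + cx w. Proof. by []. Qed.
Lemma cyD u w : cy (u + w) = cy u + cy w. Proof. by []. Qed.
Lemma ctD u w : ct (u + w) = ct u + ct w. Proof. by []. Qed.
Lemma cxN u : cx (- u) = - cx u. Proof. by []. Qed.
Lemma cyN u : cy (- u) = - cy u. Proof. by []. Qed.
Lemma ctN u : ct (- u) = - ct u. Proof. by []. Qed.
Lemma cxZ a u : cx (a *: u) = a * cx u. Proof. by []. Qed.
Lemma cyZ a u : cy (a *: u) = a * cy u. Proof. by []. Qed.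
Lemma ctZ a u : ct (a *: u) = a * ct u. Proof. by []. Qed.
Lemma cx_vec a b c : cx (vec a b c) = a. Proof. by []. Qed.
Lemma cy_vec a b c : cy (vec a b c) = b. Proof. by []. Qed.
Lemma ct_vec a b c : ct (vec a b c) = c. Proof. by []. Qed.
Definition coE := (cxD, cyD, ctD, cxN, cyN, ctN, cxZ, cyZ, ctZ, cx_vec, cy_vec, ct_vec).

Lemma vecP u w : cx u = cx w -> cy u = cy w -> ct u = ct w -> u = w.
Proof. by case: u w => [[? ?] ?] [[? ?] ?]; rewrite /cx /cy /ct /= => -> -> ->. Qed.

Definition lor u w : R := cx u * cx w + cy u * cy w - ct u * ct w.

Lemma lorC u w : lor u w = lor w u.
Proof. by rewrite /lor; ring. Qed.
Lemma lorDl u w x : lor (u + w) x = lor u x + lor w x.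
Proof. by rewrite /lor !coE; ring. Qed.
Lemma lorDr u w x : lor x (u + w) = lor x u + lor x w.
Proof. by rewrite /lor !coE; ring. Qed.
Lemma lorZl a u w : lor (a *: u) w = a * lor u w.
Proof. by rewrite /lor !coE; ring. Qed.
Lemma lorZr a u w : lor u (a *: w) = a * lor u w.
Proof. by rewrite /lor !coE; ring. Qed.
Lemma lorNl u w : lor (- u) w = - lor u w.
Proof. by rewrite /lor !coE; ring. Qed.
Lemma lorNr u w : lor u (- w) = - lor u w.
Proof. by rewrite /lor !coE; ring. Qed.
Definition lorE := (lorDl, lorDr, lorNl, lorNr, lorZl, lorZr).

(* The vector orthogonal to u and w with [lor (cross u w) x = det (u, w, x)]. *)
Definition cross u w : vect :=
  vec (cy u * ct w - ct u * cy w) (ct u * cx w - cx u * ct w)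
      (cy u * cx w - cx u * cy w).
Definition det3 u w x : R := lor (cross u w) x.

Lemma det3_rot u w x : det3 u w x = det3 w x u.
Proof. by rewrite /det3 /lor /cross !coE; ring. Qed.
Lemma det3C u w x : det3 w u x = - det3 u w x.
Proof. by rewrite /det3 /lor /cross !coE; ring. Qed.
Lemma cross_l u w : lor (cross u w) u = 0.
Proof. by rewrite /lor /cross !coE; ring. Qed.
Lemma cross_r u w : lor (cross u w) w = 0.
Proof. by rewrite /lor /cross !coE; ring. Qed.
Lemma lor_cross u w x y :
  lor (cross u w) (cross x y) = lor u y * lor w x - lor u x * lor w y.
Proof. by rewrite /lor /cross !coE; ring. Qed.
Lemma cramer u w x y :
  det3 u w x *: y = det3 y w x *: u + det3 u y x *: w + det3 u w y *: x.
Proof. by apply: vecP; rewrite /det3 /lor /cross !coE; ring. Qed.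

Definition causal u := 0 < ct u /\ lor u u <= 0.
Definition timelike u := 0 < ct u /\ lor u u < 0.

Lemma timelike_causal u : timelike u -> causal u.
Proof. by case=> ? /ltW. Qed.

(** Cauchy-Schwarz for the spatial parts, whose lengths are bounded by [ct], strictly for [u]. *)
Lemma timelike_lor u w : timelike u -> causal w -> lor u w < 0.
Proof.
move=> [u0 uu] [w0 ww]; rewrite /lor subr_lt0.
have CS : (cx u * cx w + cy u * cy w) ^+ 2 <=
    (cx u ^+ 2 + cy u ^+ 2) * (cx w ^+ 2 + cy w ^+ 2).
  have := sqr_ge0 (cx u * cy w - cy u * cx w); lra.
have u1 : cx u ^+ 2 + cy u ^+ 2 < ct u ^+ 2 by move: uu; rewrite /lor; lra.
have w1 : cx w ^+ 2 + cy w ^+ 2 <= ct w ^+ 2 by move: ww; rewrite /lor; lra.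
have p : 0 < ct u * ct w by rewrite mulr_gt0.
have [le0|gt0] := lerP (cx u * cx w + cy u * cy w) 0; first exact: le_lt_trans le0 p.
rewrite -(@ltr_pXn2r _ 2) ?nnegrE ?ltW // exprMn.
apply: le_lt_trans CS _; apply: (@le_lt_trans _ _ ((cx u ^+ 2 + cy u ^+ 2) * ct w ^+ 2)).
  by rewrite ler_wpM2l // addr_ge0 ?sqr_ge0.
by rewrite ltr_pM2r // exprn_gt0.
Qed.

Lemma timelike_orth u w : timelike u -> lor u w = 0 -> w != 0 -> 0 < lor w w.
Proof.
move=> tu uw w0; rewrite ltNge; apply/negP => ww.
have [wt|wt|wt] := ltrgtP (ct w) 0.
- have : lor u (- w) < 0.
    by apply: timelike_lor => //; split; rewrite ?coE ?lorE; lra.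
  by rewrite lorE uw; lra.
- by have : lor u w < 0; [apply: timelike_lor | rewrite uw ltxx].
- move: ww w0; rewrite /lor wt => ww /negP; apply; apply/eqP.
  have : cx w ^+ 2 + cy w ^+ 2 <= 0 by lra.
  move=> h; have := sqr_ge0 (cx w); have := sqr_ge0 (cy w) => h1 h2.
  by apply: vecP => //; apply/eqP; rewrite -sqrf_eq0 eq_le; apply/andP; split; lra.
Qed.

Lemma timelikeD u w : timelike u -> causal w -> timelike (u + w).
Proof.
move=> tu cw; have := timelike_lor tu cw; case: tu cw => ? ? [? ?] ?.
by split; rewrite ?coE ?lorE ?(lorC w); lra.
Qed.
Lemma causalZ a u : 0 < a -> causal u -> causal (a *: u).
Proof.
move=> a0 [u0 uu]; split; rewrite ?coE ?lorE; first exact: mulr_gt0.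
by rewrite mulrA pmulr_rle0 // mulr_gt0.
Qed.
Lemma timelikeZ a u : 0 < a -> timelike u -> timelike (a *: u).
Proof.
move=> a0 [u0 uu]; split; rewrite ?coE ?lorE; first exact: mulr_gt0.
by rewrite mulrA pmulr_rlt0 // mulr_gt0.
Qed.

(* The hyperboloid model of the disk, up to scaling: points of the disk give timelike
   vectors, points of the circle null vectors. *)
Definition hlift (z : C) : vect := vec (2 * Re z) (2 * Im z) (1 + sqn z).

Lemma ct_hlift z : 0 < ct (hlift z).
Proof. by rewrite /hlift coE; have := sqn_ge0 z; lra. Qed.
Lemma hlift_lift z : lor (hlift z) (hlift z) = - (1 - sqn z) ^+ 2.
Proof. by rewrite /lor /hlift !coE /sqn; ring. Qed.
Lemma hlift_timelike z : disk z -> timelike (hlift z).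
Proof.
move=> /diskE z1; split; first exact: ct_hlift.
by rewrite hlift_lift oppr_lt0 exprn_gt0 // subr_gt0.
Qed.
Lemma hlift_causal z : causal (hlift z).
Proof. by split; [exact: ct_hlift | rewrite hlift_lift oppr_le0 sqr_ge0]. Qed.
Lemma hlift_circle z : circle z -> hlift z = 2 *: vec (Re z) (Im z) 1.
Proof. by move=> /circleE z1; apply: vecP; rewrite /hlift !coE ?z1 //; ring. Qed.
Lemma hlift_null z : circle z -> lor (hlift z) (hlift z) = 0.
Proof. by move=> /circleE z1; rewrite hlift_lift z1 subrr expr0n oppr0. Qed.
Lemma lor_hlift z (w : C) : lor (hlift z) (hlift w) =
  - 2 * sqn (z - w) - (1 - sqn z) * (1 - sqn w).
Proof. by rewrite /lor /hlift !coE /sqn !ReImE; ring. Qed.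

(** Outside the disk this fails: a point and its image under inversion in the circle have
    proportional lifts. The bound on the moduli fixes the sign of a square root and forces
    [k = 1]. *)
Lemma hlift_inj z (w : C) k : closed_disk z -> closed_disk w -> hlift z = k *: hlift w -> z = w.
Proof.
move=> /closed_diskE z1 /closed_diskE w1 E.
have := congr1 (@cx) E; have := congr1 cy E; have := congr1 ct E.
rewrite /hlift !coE => et ey ex.
have e0 : lor (hlift z) (hlift z) = k ^+ 2 * lor (hlift w) (hlift w).
  by rewrite E !lorE; ring.
have k0 : 0 < k.
  have w0 : 0 < 1 + sqn w by have := sqn_ge0 w; lra.
  by rewrite -(pmulr_lgt0 k w0) -et; have := sqn_ge0 z; lra.
have kw : 0 <= k * (1 - sqn w) by rewrite mulr_ge0 ?subr_ge0 // ltW.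
have e1 : 1 - sqn z = k * (1 - sqn w).
  have : (1 - sqn z - k * (1 - sqn w)) * (1 - sqn z + k * (1 - sqn w)) == 0.
    by apply/eqP; move: e0; rewrite !hlift_lift; lra.
  by rewrite mulf_eq0 => /orP[]/eqP; lra.
have k1 : k = 1 by lra.
by apply: complexP; move: ex ey; rewrite k1; lra.
Qed.

End Lorentz.

(** * Disk isometries as Lorentz transformations *)

Section DiskIsometries.
Variable R : realType.
Local Notation C := R[i].
Local Notation Re := complex.Re.
Local Notation Im := complex.Im.
Implicit Types (g h : 'M[C]_2) (u w : vect R) (z : C).

Let one2 : lift ord0 (ord0 : 'I_1) = 1 :> 'I_2. Proof. exact: val_inj. Qed.

Lemma mulmx2E g h i j : (g * h) i j = g i 0 * h 0 j + g i 1 * h 1 j.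
Proof. by rewrite !mxE !big_ord_recl big_ord0 addr0 one2. Qed.

Lemma det_mx2 g : \det g = g 0 0 * g 1 1 - g 0 1 * g 1 0.
Proof.
rewrite (expand_det_row g ord0) !big_ord_recl big_ord0 addr0 one2.
rewrite /cofactor !det_mx11 !mxE /= expr0 mul1r addn1 expr1 mulN1r mulrN.
by congr (_ * g _ _ - _ * g _ _); apply: val_inj.
Qed.

Lemma mx2P g h : g 0 0 = h 0 0 -> g 0 1 = h 0 1 -> g 1 0 = h 1 0 -> g 1 1 = h 1 1 ->
  g = h.
Proof.
have I2 (i : 'I_2) : i = 0 \/ i = 1.
  by case: i => [[|[|//]] p]; [left | right]; exact: val_inj.
by move=> *; apply/matrixP => i j; case: (I2 i) => ->; case: (I2 j) => ->.
Qed.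

Lemma mx21E : (((1 : 'M[C]_2) 0 0 = 1) * ((1 : 'M[C]_2) 0 1 = 0) *
  ((1 : 'M[C]_2) 1 0 = 0) * ((1 : 'M[C]_2) 1 1 = 1))%type.
Proof. by rewrite !mxE. Qed.

Definition mx2 (a b c d : C) : 'M[C]_2 :=
  \matrix_(i, j) if i == 0 then if j == 0 then a else b else if j == 0 then c else d.

Lemma mx2E a b c d :
  ((mx2 a b c d 0 0 = a) * (mx2 a b c d 0 1 = b) *
   (mx2 a b c d 1 0 = c) * (mx2 a b c d 1 1 = d))%type.
Proof. by rewrite !mxE. Qed.

Definition su (a b : C) : 'M[C]_2 := mx2 a b b^* a^*.

Lemma su_eta g : SU11 g -> g = su (g 0 0) (g 0 1).
Proof. by case=> g10 g11 _; apply: mx2P; rewrite mx2E. Qed.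

Lemma SU11P g : SU11 g <-> g = su (g 0 0) (g 0 1) /\ sqn (g 0 0) - sqn (g 0 1) = 1.
Proof.
have E a b : a * a^* - b * b^* = (sqn a - sqn b)%:C%C :> C.
  by apply: complexP; rewrite !ReImE /sqn; ring.
split=> [[g10 g11 dg]|[gE d]].
  split; first exact: su_eta.
  by apply: complexI; rewrite -E; move: dg; rewrite det_mx2 g10 g11.
by split; rewrite gE ?det_mx2 /su !mx2E // E d.
Qed.

Lemma SU11_sqn g : SU11 g -> sqn (g 0 0) - sqn (g 0 1) = 1.
Proof. by case/SU11P. Qed.

Lemma su_SU11 a b : sqn a - sqn b = 1 -> SU11 (su a b).
Proof. by move=> ab; apply/SU11P; rewrite /su !mx2E. Qed.

Lemma SU11_1 : SU11 (1 : 'M[C]_2).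
Proof. by split; rewrite ?det1 // !mxE /= ?rmorph0 ?rmorph1. Qed.

Lemma SU11_M g h : SU11 g -> SU11 h -> SU11 (g * h).
Proof.
case=> g10 g11 dg [h10 h11 dh]; split; last by rewrite det_mulmx dg dh mul1r.
  by rewrite !mulmx2E g10 g11 h10 h11 rmorphD !rmorphM /= !conjCK addrC.
by rewrite !mulmx2E g10 g11 h10 h11 rmorphD !rmorphM /= !conjCK addrC.
Qed.

Lemma SU11_mulV g : SU11 g -> g * g^-1 = 1.
Proof. by case=> _ _ dg; apply: mulrV; rewrite unitmxE dg unitr1. Qed.
Lemma SU11_mulVr g : SU11 g -> g^-1 * g = 1.
Proof. by case=> _ _ dg; apply: mulVr; rewrite unitmxE dg unitr1. Qed.

Lemma SU11_inv g : SU11 g -> g^-1 = su (g 0 0)^* (- g 0 1).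
Proof.
move=> sg; apply: (mulrI (_ : g \is a GRing.unit)).
  by case: sg => _ _ dg; rewrite unitmxE dg unitr1.
rewrite SU11_mulV //; case/SU11P: (sg) => gE d.
have one (i j : 'I_2) : (1 : 'M[C]_2) i j = (i == j)%:R by rewrite mxE.
apply: mx2P; rewrite mulmx2E one [in RHS]gE /su !mx2E; apply: complexP; rewrite !ReImE /=;
  move: d; rewrite /sqn; lra.
Qed.

Lemma SU11_V g : SU11 g -> SU11 g^-1.
Proof.
by move=> sg; rewrite SU11_inv //; apply: su_SU11; rewrite sqnJ sqnN SU11_sqn.
Qed.

Lemma generated_SU11 (T : 'Z_4 -> 'M[C]_2) g :
  (forall i, SU11 (T i)) -> generated_group T g -> SU11 g.
Proof.
move=> sT; elim=> //; [exact: SU11_1|by move=> *; apply: SU11_M|].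
by move=> *; apply: SU11_V.
Qed.

Definition den g z : C := g 1 0 * z + g 1 1.
Definition num g z : C := g 0 0 * z + g 0 1.

Lemma den_num g z : SU11 g -> sqn (den g z) - sqn (num g z) = 1 - sqn z.
Proof.
move=> sg; have d := SU11_sqn sg.
transitivity ((sqn (g 0 0) - sqn (g 0 1)) * (1 - sqn z)); last by rewrite d mul1r.
rewrite /den /num [in LHS](su_eta sg) /su !mx2E.
by rewrite /sqn !ReImE; ring.
Qed.

Lemma den_neq0 g z : SU11 g -> closed_disk z -> den g z != 0.
Proof.
move=> sg /closed_diskE z1; rewrite -sqn_gt0.
have := den_num z sg; have := sqn_ge0 (num g z); have := sqn_ge0 (den g z).
move=> h1 h2 h3; rewrite lt_def h1 andbT; apply/negP => /eqP d0.
have n0 : sqn (num g z) = 0 by lra.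
move/eqP: d0; move/eqP: n0; rewrite !sqn_eq0 => /eqP n0 /eqP d0.
have : g 0 0 * den g z - g 1 0 * num g z = 1.
  by case: (sg) => _ _ dg; rewrite -[RHS]dg det_mx2 /den /num; ring.
by rewrite d0 n0 !mulr0 subr0 => /esym/eqP; rewrite oner_eq0.
Qed.

Lemma mobius_den g z : SU11 g -> closed_disk z -> mobius g z * den g z = num g z.
Proof. by move=> sg zd; rewrite /mobius divfK // den_neq0. Qed.

(** The double cover of SU(1,1) onto the identity component of SO(2,1), written out in real
    coordinates. *)
Definition lact g u : vect R :=
  let a1 := Re (g 0 0) in let a2 := Im (g 0 0) in
  let b1 := Re (g 0 1) in let b2 := Im (g 0 1) in
  vec ((a1^+2 - a2^+2 + b1^+2 - b2^+2) * cx u + 2 * (b1 * b2 - a1 * a2) * cy u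
        + 2 * (a1 * b1 - a2 * b2) * ct u)
      (2 * (a1 * a2 + b1 * b2) * cx u + (a1^+2 - a2^+2 - b1^+2 + b2^+2) * cy u
        + 2 * (a1 * b2 + a2 * b1) * ct u)
      (2 * (a1 * b1 + a2 * b2) * cx u + 2 * (a1 * b2 - a2 * b1) * cy u
        + (a1^+2 + a2^+2 + b1^+2 + b2^+2) * ct u).

Lemma lactD g u w : lact g (u + w) = lact g u + lact g w.
Proof. by apply: vecP; rewrite /lact !coE; ring. Qed.
Lemma lactZ g c u : lact g (c *: u) = c *: lact g u.
Proof. by apply: vecP; rewrite /lact !coE; ring. Qed.
Lemma lactN g u : lact g (- u) = - lact g u.
Proof. by apply: vecP; rewrite /lact !coE; ring. Qed.
Lemma lact1 u : lact 1 u = u.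
Proof. by apply: vecP; rewrite /lact !mx21E !coE !ReImE; ring. Qed.
Lemma lactNg g u : lact (- g) u = lact g u.
Proof. by rewrite /lact !mxE !ReImE !sqrrN !mulrNN. Qed.
Lemma lactM g h u : SU11 h -> lact (g * h) u = lact g (lact h u).
Proof.
by case=> h10 h11 _; apply: vecP; rewrite /lact !mulmx2E h10 h11 !coE !ReImE; ring.
Qed.

Lemma lact_lor g u w : SU11 g -> lor (lact g u) (lact g w) = lor u w.
Proof.
move=> /SU11_sqn d.
(* The claim becomes a polynomial identity once the factor [sqn (g 0 0) - sqn (g 0 1)], which equals
   1, is made visible. *)
transitivity ((sqn (g 0 0) - sqn (g 0 1)) ^+ 2 * lor u w); last by rewrite d expr1n mul1r.
rewrite /sqn /lor /lact !coE.
by ring.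
Qed.

Lemma lact_det3 g u w x : SU11 g -> det3 (lact g u) (lact g w) (lact g x) = det3 u w x.
Proof.
move=> /SU11_sqn d.
transitivity ((sqn (g 0 0) - sqn (g 0 1)) ^+ 3 * det3 u w x); last by rewrite d expr1n mul1r.
rewrite /sqn /det3 /lor /cross /lact !coE; ring.
Qed.

Lemma hlift_mobius g z : SU11 g -> closed_disk z ->
  lact g (hlift z) = sqn (den g z) *: hlift (mobius g z).
Proof.
move=> sg zd; have mE := mobius_den sg zd; move: (mobius g z) mE => m mE.
have nE : sqn m * sqn (den g z) = sqn (num g z) by rewrite -sqnM mE.
have xE : 2 * Re (m * den g z * (den g z)^*) = cx (lact g (hlift z)).
  rewrite mE /lact /hlift /num /den; rewrite (su_eta sg) /su; rewrite !mx2E !coE /sqn !ReImE.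
  by ring.
have yE : 2 * Im (m * den g z * (den g z)^*) = cy (lact g (hlift z)).
  rewrite mE /lact /hlift /num /den; rewrite (su_eta sg) /su; rewrite !mx2E !coE /sqn !ReImE.
  by ring.
have tE : sqn (den g z) + sqn (num g z) = ct (lact g (hlift z)).
  rewrite /lact /hlift /num /den; rewrite (su_eta sg) /su; rewrite !mx2E !coE /sqn !ReImE.
  by ring.
apply: vecP; rewrite -?xE -?yE -?tE -?nE /hlift !coE /sqn !ReImE; ring.
Qed.

Lemma mobius_sqn g z : SU11 g -> closed_disk z ->
  (1 - sqn (mobius g z)) * sqn (den g z) = 1 - sqn z.
Proof. by move=> sg zd; rewrite -(den_num z sg) -mobius_den // sqnM; ring. Qed.

Lemma mobius_disk g z : SU11 g -> disk z -> disk (mobius g z).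
Proof.
move=> sg /diskE zd; have zc : closed_disk z by apply/closed_diskE/ltW.
apply/diskE; have := mobius_sqn sg zc; have := den_neq0 sg zc; rewrite -sqn_gt0 => d0 E.
by rewrite -subr_gt0 -(pmulr_lgt0 _ d0) E subr_gt0.
Qed.
Lemma mobius_circle g z : SU11 g -> circle z -> circle (mobius g z).
Proof.
move=> sg /circleE zd; have zc : closed_disk z by apply/closed_diskE; rewrite zd.
apply/circleE; have := mobius_sqn sg zc; have := den_neq0 sg zc; rewrite -sqn_eq0 => d0 E.
apply/eqP; rewrite eq_sym -subr_eq0; apply/eqP/(mulIf d0).
by rewrite E zd subrr mul0r.
Qed.
Lemma disk_closed z : disk z -> closed_disk z.
Proof. by move=> /diskE /ltW /closed_diskE. Qed.
Lemma circle_closed z : circle z -> closed_disk z.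
Proof. by move=> /circleE z1; apply/closed_diskE; rewrite z1. Qed.
Lemma mobius_closed g z : SU11 g -> closed_disk z -> closed_disk (mobius g z).
Proof.
move=> sg /closed_diskE; rewrite le_eqVlt => /orP[/eqP|] z1.
  by apply/circle_closed/mobius_circle => //; apply/circleE.
by apply/disk_closed/mobius_disk => //; apply/diskE.
Qed.

Lemma denM g h z : SU11 h -> closed_disk z ->
  den (g * h) z = den g (mobius h z) * den h z.
Proof.
move=> sh zd; rewrite {2}/den mulrDl -(mulrA (g 1 0)) mobius_den //.
by rewrite /den /num !mulmx2E; ring.
Qed.
Lemma numM g h z : SU11 h -> closed_disk z ->
  num (g * h) z = num g (mobius h z) * den h z.
Proof.
move=> sh zd; rewrite {2}/num mulrDl -(mulrA (g 0 0)) mobius_den //.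
by rewrite /den /num !mulmx2E; ring.
Qed.
Lemma mobiusM g h z : SU11 g -> SU11 h -> closed_disk z ->
  mobius (g * h) z = mobius g (mobius h z).
Proof.
move=> sg sh zd; rewrite {1}/mobius -/(num _ _) -/(den _ _) numM // denM //.
by rewrite -mulf_div divff ?mulr1 // den_neq0.
Qed.
Lemma mobius1 z : mobius 1 z = z.
Proof. by rewrite /mobius !mx21E mul1r mul0r add0r addr0 divr1. Qed.
Lemma mobiusN g z : mobius (- g) z = mobius g z.
Proof. by rewrite /mobius !mxE !mulNr -!opprD invrN mulrNN. Qed.
Lemma mobiusK g z : SU11 g -> closed_disk z -> mobius g^-1 (mobius g z) = z.
Proof.
by move=> sg zd; rewrite -mobiusM ?SU11_mulVr ?mobius1 //; apply: SU11_V.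
Qed.
Lemma mobiusKV g z : SU11 g -> closed_disk z -> mobius g (mobius g^-1 z) = z.
Proof.
by move=> sg zd; rewrite -mobiusM ?SU11_mulV ?mobius1 //; apply: SU11_V.
Qed.

End DiskIsometries.

(** * Cyclic order and arcs *)
Section CyclicOrder.
Variable R : realType.
Local Notation C := R[i].
Local Notation Re := complex.Re.
Local Notation Im := complex.Im.
Implicit Types (x y z b : C).

Lemma ccw_det x y z : circle x -> circle y -> circle z ->
  ccw x y z <-> 0 < det3 (hlift x) (hlift y) (hlift z).
Proof.
move=> cx cy cz; have E : det3 (hlift x) (hlift y) (hlift z) =
    8 * Im ((y - x)^* * (z - x)).
  rewrite !hlift_circle // /det3 /lor /cross !coE !ReImE; ring.
by rewrite E pmulr_rgt0 //; split=> [[]|].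
Qed.

Lemma ccw_circle x y z : ccw x y z -> [/\ circle x, circle y & circle z].
Proof. by case. Qed.

Lemma ccw_rot x y z : ccw x y z -> ccw y z x.
Proof.
move=> H; have [? ? ?] := ccw_circle H; move: H.
by rewrite !ccw_det // det3_rot.
Qed.

Lemma ccw_asym x y z : ccw x y z -> ~ ccw x z y.
Proof.
move=> H; have [? ? ?] := ccw_circle H; move: H.
rewrite !ccw_det // [det3 _ (hlift z) _]det3_rot det3C -det3_rot; lra.
Qed.

(* The stereographic coordinate on the circle minus [b], increasing
   counterclockwise: [- cot (t / 2)] at [b * exp (i t)]. *)
Definition pos b y : R := - Im (b^* * y) / (1 - Re (b^* * y)).

Lemma pos_gt0 b y : circle b -> circle y -> y <> b -> 0 < 1 - Re (b^* * y).
Proof.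
move=> /circleE b1 /circleE y1 yb.
have E : sqn (y - b) = 2 * (1 - Re (b^* * y)).
  by move: b1 y1; rewrite /sqn !ReImE; lra.
have : 0 < sqn (y - b) by rewrite sqn_gt0 subr_eq0; apply/eqP.
rewrite E; lra.
Qed.

Lemma ccw_pos b y z : circle b -> circle y -> circle z -> y <> b -> z <> b ->
  ccw b y z <-> pos b y < pos b z.
Proof.
move=> cb cy cz yb zb; have hy := pos_gt0 cb cy yb; have hz := pos_gt0 cb cz zb.
rewrite /pos ltr_pdivrMr // mulrAC ltr_pdivlMr //.
have /circleE b1 := cb.
have E : Im ((y - b)^* * (z - b)) = Im ((b^* * y - 1)^* * (b^* * z - 1)).
  transitivity (sqn b * Im ((y - b)^* * (z - b))); first by rewrite b1 mul1r.
  have -> : b^* * y - 1 = b^* * (y - b).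
    by apply: complexP; move: b1; rewrite !ReImE /sqn; lra.
  have -> : b^* * z - 1 = b^* * (z - b).
    by apply: complexP; move: b1; rewrite !ReImE /sqn; lra.
  by rewrite /sqn !ReImE; ring.
have -> : ccw b y z <-> 0 < Im ((y - b)^* * (z - b)) by split=> [[]|].
by rewrite E; move: (b^* * y) (b^* * z) => p q; rewrite !ReImE; split; lra.
Qed.

Lemma pos_inj b y z : circle b -> circle y -> circle z -> y <> b -> z <> b ->
  pos b y = pos b z -> y = z.
Proof.
move=> cb cy cz yb zb; have hy := pos_gt0 cb cy yb; have hz := pos_gt0 cb cz zb.
have b0 : b^* != 0.
  by move/circleE: cb => b1; rewrite -sqn_eq0 sqnJ b1 oner_eq0.
have S w : circle w -> Im (b^* * w) ^+ 2 = 1 - Re (b^* * w) ^+ 2.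
  move=> /circleE w1; move/circleE: cb => b1.
  by have : sqn (b^* * w) = 1; [rewrite sqnM sqnJ b1 w1 mulr1 | rewrite /sqn; lra].
move=> E; apply: (mulfI b0); move: E; rewrite /pos.
have := S y cy; have := S z cz.
move: hy hz; move: (b^* * y) (b^* * z) => p q hp hq Sq Sp E.
have Ep : (- Im p / (1 - Re p)) ^+ 2 * (1 - Re p) = 1 + Re p.
  by rewrite expr_div_n sqrrN Sp; field; exact: lt0r_neq0.
have Eq : (- Im q / (1 - Re q)) ^+ 2 * (1 - Re q) = 1 + Re q.
  by rewrite expr_div_n sqrrN Sq; field; exact: lt0r_neq0.
move: Ep; rewrite E => Ep.
have RE : Re p = Re q.
  have h : 0 < 1 + (- Im q / (1 - Re q)) ^+ 2 by have := sqr_ge0 (- Im q / (1 - Re q)); lra.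
  by apply: (mulfI (lt0r_neq0 h)); lra.
apply: complexP => //; move: E; rewrite RE => /(mulIf _) E.
by apply: oppr_inj; apply: E; rewrite invr_neq0 // lt0r_neq0.
Qed.

Lemma ccw_neq x y z : ccw x y z -> [/\ x <> y, y <> z & x <> z].
Proof.
have N u w : ~ ccw u u w.
  by case=> _ _ _; rewrite subrr rmorph0 mul0r ltxx.
move=> H; split=> E; move: H; rewrite E; first exact: N.
  by move/ccw_rot; apply: N.
by move/ccw_rot/ccw_rot; apply: N.
Qed.

Lemma ccw_total x y z : circle x -> circle y -> circle z ->
  x <> y -> y <> z -> x <> z -> ccw x y z \/ ccw x z y.
Proof.
move=> cx cy cz xy yz xz; rewrite !ccw_pos //; try exact: nesym.
case: (ltrgtP (pos x y) (pos x z)) => [||E]; [by left|by right|].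
by case: yz; apply: pos_inj E => //; exact: nesym.
Qed.

Lemma ccw_trans x y z w : ccw x y z -> ccw x z w -> ccw x y w.
Proof.
move=> h1 h2; have [? ? ?] := ccw_circle h1; have [_ _ ?] := ccw_circle h2.
have [? _ ?] := ccw_neq h1; have [_ _ ?] := ccw_neq h2.
move: h1 h2; rewrite !ccw_pos //; try exact: nesym; exact: lt_trans.
Qed.

Lemma ccw_trans' x y z w : ccw x y z -> ccw x z w -> ccw y z w.
Proof. by move=> /ccw_rot/ccw_rot h1 /ccw_rot h2; apply/ccw_rot/ccw_rot/(ccw_trans h2 h1). Qed.

Lemma ccw_pos3 b x y z : circle b -> circle x -> circle y -> circle z ->
  x <> b -> y <> b -> z <> b ->
  ccw x y z <-> [|| (pos b x < pos b y) && (pos b y < pos b z),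
    (pos b y < pos b z) && (pos b z < pos b x) |
    (pos b z < pos b x) && (pos b x < pos b y)].
Proof.
move=> cb cx cy cz xb yb zb.
have P u w : circle u -> circle w -> u <> b -> w <> b -> pos b u < pos b w -> ccw b u w.
  by move=> cu cw ub wb /(ccw_pos cb cu cw ub wb).
have Q u v w : circle u -> circle v -> circle w -> u <> b -> v <> b -> w <> b ->
    (pos b u < pos b v) && (pos b v < pos b w) -> ccw u v w.
  move=> cu cv cw ub vb wb /andP[uv vw].
  by apply: ccw_trans' (P u v _ _ _ _ uv) (P v w _ _ _ _ vw).
split=> [H|/or3P[]]; last 3 first.
- exact: Q.
- by move=> /Q H; apply/ccw_rot/ccw_rot/H.
- by move=> /Q H; apply/ccw_rot/H.
have [xy yz xz] := ccw_neq H; apply: contrapT => N; apply: (ccw_asym H).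
have pxy : pos b x != pos b y by apply/eqP => E; apply: xy; apply: pos_inj E.
have pyz : pos b y != pos b z by apply/eqP => E; apply: yz; apply: pos_inj E.
have pxz : pos b x != pos b z by apply/eqP => E; apply: xz; apply: pos_inj E.
move/negP: N; case: (ltrgtP (pos b x) (pos b y)) pxy => //= h1 _;
  case: (ltrgtP (pos b y) (pos b z)) pyz => //= h2 _;
  case: (ltrgtP (pos b z) (pos b x)) pxz => //= h3 _ _.
- by apply: Q => //; rewrite h3 h2.
- by apply/ccw_rot/Q => //; rewrite h1 h3.
- by apply/ccw_rot/ccw_rot/Q => //; rewrite h2 h1.
- by have := lt_trans h3 (lt_trans h2 h1); rewrite ltxx.
Qed.

Lemma ccw_mobius g x y z : SU11 g -> ccw x y z -> ccw (mobius g x) (mobius g y) (mobius g z).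
Proof.
move=> sg H; have [hx hy hz] := ccw_circle H; move: H.
have D t : circle t -> 0 < sqn (den g t) by move=> /circle_closed ht; rewrite sqn_gt0 den_neq0.
have cm t : circle t -> circle (mobius g t) by apply: mobius_circle.
have hx' := circle_closed hx; have hy' := circle_closed hy; have hz' := circle_closed hz.
move=> /(ccw_det hx hy hz); rewrite -(lact_det3 _ _ _ sg) !hlift_mobius //.
move=> H; apply/(ccw_det (cm _ hx) (cm _ hy) (cm _ hz)); move: H.
have -> k l m (u v w : vect R) :
    det3 (k *: u) (l *: v) (m *: w) = k * (l * (m * det3 u v w)).
  by rewrite /det3 /lor /cross !coE; ring.
by rewrite !pmulr_rgt0 ?D.
Qed.

Lemma mobius_inj g x y : SU11 g -> closed_disk x -> closed_disk y ->
  mobius g x = mobius g y -> x = y.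
Proof. by move=> sg hx hy E; rewrite -(mobiusK sg hx) E mobiusK. Qed.

Lemma circle_arcP x y z : circle_arc x y z <->
  [/\ circle x, circle y, x <> y & z = x \/ ccw x z y].
Proof.
split=> [[hx hy [[-> ?]|H]]|[hx hy xy [->|H]]]; split => //; auto.
- by case: (ccw_neq H).
Qed.

Lemma circle_arc_circle x y z : circle_arc x y z -> circle z.
Proof. by case/circle_arcP => hx hy xy [->//|[]]. Qed.

Lemma mobius_arc g x y : SU11 g -> circle x -> circle y ->
  mobius g @` circle_arc x y = circle_arc (mobius g x) (mobius g y).
Proof.
move=> sg cx cy; have sgV := SU11_V sg.
have cgx := mobius_circle sg cx; have cgy := mobius_circle sg cy.
have xd := circle_closed cx; have yd := circle_closed cy.
apply/seteqP; split=> [_ [z /circle_arcP[_ _ xy H] <-]|z /circle_arcP[_ _ xy H]].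
  apply/circle_arcP; split => //; first by move/mobius_inj => /(_ sg xd yd).
  by case: H => [->|H]; [left|right; apply: ccw_mobius].
have cz : circle z by case: H => [->|[]].
have zd := circle_closed cz.
exists (mobius g^-1 z); last by rewrite mobiusKV.
apply/circle_arcP; split => //; first by move=> xyE; apply: xy; rewrite xyE.
by case: H => [->|/(ccw_mobius sgV)]; rewrite !mobiusK //; [left|right].
Qed.

(** * Arcs cut out by a set of points of the circle *)

Section Arcs.
Variable W : set C.
Hypothesis Wc : W `<=` @circle R.

Lemma arc_pos x y z : circle x -> circle y -> circle z -> x <> y -> z <> x ->
  circle_arc x y z <-> pos x z < pos x y.
Proof.
move=> hx hy hz xy zx; rewrite circle_arcP -ccw_pos //; last exact: nesym.
by split=> [[_ _ _ [|]]|] // ?; split => //; right.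
Qed.

Lemma arc_posl b x z : circle b -> circle x -> circle z -> x <> b -> z <> b ->
  circle_arc x b z <-> pos b x <= pos b z.
Proof.
move=> hb hx hz xb zb; rewrite circle_arcP le_eqVlt.
split=> [[_ _ _ [->|H]]|]; first by rewrite eqxx.
  by move/ccw_rot/ccw_rot: H => /ccw_pos -> //; rewrite orbT.
case/orP=> [/eqP/pos_inj ->//|H]; split => //; [by left|right].
by apply/ccw_rot/ccw_pos.
Qed.

(** In the coordinate seen from [b] an arc is an interval, or the complement of one when it contains
    [b]. *)
Lemma arc_pos3 b x y z : circle b -> circle x -> circle y -> circle z ->
  x <> b -> y <> b -> z <> b ->
  circle_arc x y z <-> if pos b x < pos b y then (pos b x <= pos b z < pos b y)
    else (pos b y < pos b x) && ((pos b x <= pos b z) || (pos b z < pos b y)).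
Proof.
move=> hb hx hy hz xb yb zb; rewrite circle_arcP.
split=> [[_ _ xy zxy]|].
  have pxy : pos b x != pos b y by apply/eqP => E; apply: xy; apply: pos_inj E.
  case: zxy => [zx|/(ccw_pos3 hb hx hz hy xb zb yb)].
    by rewrite zx lexx /=; case: (ltrgtP (pos b x) (pos b y)) pxy.
  case: (ltrgtP (pos b x) (pos b y)) pxy => //= h _;
   rewrite ?andbF ?orbF ?andbT /=; rewrite ?lt_def /=; lra.
move=> H; have xy : x <> y by move=> xy; move: H; rewrite xy ltxx.
split => //; have [->|zx] := pselect (z = x); first by left.
right; apply/(ccw_pos3 hb hx hz hy xb zb yb).
have pxz : pos b x != pos b z by apply/eqP => E; apply: zx; apply/esym; apply: pos_inj E.
by move: H; case: (ltrgtP (pos b x) (pos b y)) => //= h; rewrite ?andbT ?andbF ?orbF;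
  rewrite le_eqVlt (negPf pxz) /=; lra.
Qed.

Lemma arc_base b x y : circle b -> circle x -> circle y -> x <> b -> y <> b -> x <> y ->
  circle_arc x y b <-> pos b y < pos b x.
Proof.
move=> hb hx hy xb yb xy; rewrite circle_arcP -ccw_pos //.
split=> [[_ _ _ [bx|/ccw_rot//]]|H]; first by case: xb.
by split => //; right; apply/ccw_rot/ccw_rot.
Qed.

(** Seen from [x], the other points of [W] lie at or beyond [y], and the rest of the arc lies before
    [y]; so an arc with ends in [W] cannot cut it. The Markov property is checked in this form. *)
Lemma arc_sub x y X Y z : W x -> W y -> W X -> W Y ->
  (forall w, W w -> circle_arc x y w -> w = x) ->
  circle_arc x y z -> circle_arc X Y z -> circle_arc x y `<=` circle_arc X Y.
Proof.
move=> Wx Wy WX WY Wxy zxy zXY t txy.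
have hx := Wc Wx; have hy := Wc Wy; have hX := Wc WX; have hY := Wc WY.
have hz := circle_arc_circle zxy; have ht := circle_arc_circle txy.
have xy : x <> y by case/circle_arcP: txy.
have XY : X <> Y by case/circle_arcP: zXY.
have far w : W w -> w <> x -> pos x y <= pos x w.
  move=> Ww wx; rewrite leNgt; apply/negP => /(arc_pos hx hy (Wc Ww) xy wx).
  by move/(Wxy w Ww).
have near s : circle_arc x y s -> s <> x -> pos x s < pos x y.
  by move=> sxy sx; apply/(arc_pos hx hy (circle_arc_circle sxy) xy sx).
have [Xx|Xx] := pselect (X = x).
  have Yx : Y <> x by rewrite -Xx; exact: nesym.
  rewrite Xx; have [->|tx] := pselect (t = x).
    by apply/circle_arcP; split => //; [exact: nesym|left].
  apply/(arc_pos hx hY ht _ tx); first exact: nesym.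
  by apply: lt_le_trans (near t txy tx) (far Y WY Yx).
have [Yx|Yx] := pselect (Y = x).
  have [zx|zx] := pselect (z = x).
    by move: zXY; rewrite zx Yx => /circle_arcP[_ _ _ [/esym//|/ccw_neq[]]].
  move: zXY; rewrite Yx => /(arc_posl hx hX hz Xx zx).
  by rewrite leNgt (lt_le_trans (near z zxy zx) (far X WX Xx)).
have YX : pos x Y < pos x X.
  have [zx|zx] := pselect (z = x).
    by move: zXY; rewrite zx => /(arc_base hx hX hY Xx Yx XY).
  have := (arc_pos3 hx hX hY hz Xx Yx zx).1 zXY.
  case: ltP => [_ /andP[]|_ /andP[]//].
  by rewrite leNgt (lt_le_trans (near z zxy zx) (far X WX Xx)).
have [->|tx] := pselect (t = x); first by apply/arc_base.
apply/(arc_pos3 hx hX hY ht Xx Yx tx); rewrite ltNge (ltW YX) /= YX /=.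
by rewrite (lt_le_trans (near t txy tx) (far Y WY Yx)) orbT.
Qed.

Lemma arcs_of_disjoint x y x' y' z : W x -> W y -> W x' -> W y' ->
  (forall w, W w -> circle_arc x y w -> w = x) ->
  (forall w, W w -> circle_arc x' y' w -> w = x') ->
  circle_arc x y z -> circle_arc x' y' z -> circle_arc x y = circle_arc x' y'.
Proof.
move=> Wx Wy Wx' Wy' Wxy Wxy' zxy zxy'.
by apply/seteqP; split; [exact: (arc_sub _ _ _ _ _ zxy)|exact: (arc_sub _ _ _ _ _ zxy')].
Qed.

Lemma finite_argmin (f : C -> R) (A : set C) : finite_set A -> A !=set0 ->
  exists2 m, A m & forall z, A z -> f m <= f z.
Proof.
move=> /finite_seqP[s ->] [a0]; elim: s a0 => //= a [|b s] IH a0 _.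
  by exists a; rewrite /= ?mem_head // => z; rewrite /= inE => /eqP ->.
have [|m ms mmin] := IH b; first by rewrite /= mem_head.
have [am|ma] := leP (f a) (f m).
  exists a; first by rewrite /= mem_head.
  move=> z; rewrite /= inE => /orP[/eqP->//|zs]; exact: le_trans am (mmin z zs).
exists m; first by rewrite /= inE ms orbT.
by move=> z; rewrite /= inE => /orP[/eqP->|/mmin//]; exact: ltW.
Qed.

(** If [x] is in [W], the next point of [W] closes the arc. Otherwise the last and the first point
    of [W] in the coordinate seen from [x] bound the arc around [x]. *)
Lemma arcs_of_cover x : finite_set W -> (exists w1 w2, [/\ W w1, W w2 & w1 <> w2]) ->
  circle x -> exists2 I, arcs_of W I & I x.
Proof.
move=> Wfin W2 hx.
have nex b : exists2 w, W w & w <> b.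
  have [w1 [w2 [W1 W2' w12]]] := W2.
  have [w1b|] := pselect (w1 = b); last by exists w1.
  by exists w2 => // w2b; apply: w12; rewrite w1b w2b.
pose W' := W `\ x.
have W'fin : finite_set W' by apply: sub_finite_set Wfin => w [].
have W'0 : W' !=set0 by have [w Ww wx] := nex x; exists w; split.
have [r [Wr rx] rmin] := finite_argmin (pos x) W'fin W'0.
have hr := Wc Wr.
have [Wx|Wx] := pselect (W x).
  exists (circle_arc x r); last by apply/circle_arcP; split => //; [exact: nesym|left].
  exists x, r; split => //; first exact: nesym.
  move=> w Ww wxr; apply: contrapT => wx.
  have := (arc_pos hx hr (Wc Ww) (nesym rx) wx).1 wxr.
  by rewrite ltNge rmin.
have [l [Wl lx] lmin] := finite_argmin (fun w => - pos x w) W'fin W'0.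
have hl := Wc Wl.
have W'W w : W w -> W' w by move=> Ww; split => // wx; apply: Wx; rewrite -wx.
have lr : l <> r.
  move=> lr; have [w Ww wl] := nex l; apply: wl.
  apply: (pos_inj hx (Wc Ww) hl _ lx); first by case: (W'W w Ww).
  have := lmin w (W'W w Ww); have := rmin w (W'W w Ww); rewrite lr.
  by rewrite lerN2 => h1 h2; apply/eqP; rewrite eq_le h1 h2.
have rl : pos x r < pos x l.
  rewrite lt_def rmin ?andbT //.
  by apply/eqP => /pos_inj E; apply: lr; apply: E.
exists (circle_arc l r); last by apply/arc_base.
exists l, r; split => // w Ww wlr; have [_ wx] := W'W w Ww.
have := (arc_pos3 hx hl hr (Wc Ww) lx rx wx).1 wlr.
rewrite ltNge (ltW rl) /= rl /= [pos x w < _]ltNge (rmin w (W'W w Ww)) orbF => lw.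
 apply: (pos_inj hx (Wc Ww) hl wx lx); apply/eqP.
by rewrite eq_le lw andbT -lerN2 (lmin w (W'W w Ww)).
Qed.

Lemma arcs_of_partition : finite_set W -> (exists w1 w2, [/\ W w1, W w2 & w1 <> w2]) ->
  finite_set (arcs_of W) /\ partition (arcs_of W) id (@circle R).
Proof.
move=> Wfin W2; split.
  pose S := (fun p : C * C => circle_arc p.1 p.2) @` (W `*` W).
  apply: (@sub_finite_set _ _ S); last by apply/finite_image/finite_setX.
  by move=> I [x [y [Wx Wy _ -> _]]]; exists (x, y).
split.
- apply/seteqP; split=> [z [I [x [y [Wx Wy _ -> _]]]]|z hz]; first exact: circle_arc_circle.
  by have [I WI Iz] := arcs_of_cover Wfin W2 hz; exists I.
- apply/trivIsetP => I J [x [y [Wx Wy xy -> Wxy]]] [x' [y' [Wx' Wy' xy' -> Wxy']]] IJ.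
  apply: contrapT => /eqP/set0P[z [zI zJ]].
  by move/eqP: IJ; apply; apply: (arcs_of_disjoint Wx Wy Wx' Wy' Wxy Wxy' zI zJ).
- move=> I [x [y [Wx Wy xy -> _]]]; exists x; apply/circle_arcP; split => //;
    [exact: Wc|exact: Wc|by left].
Qed.

(** An arc contains no point of [W] besides its left end, so finitely many arcs covering the circle
    leave room for finitely many points. *)
Lemma partition_finite : finite_set (arcs_of W) -> partition (arcs_of W) id (@circle R) ->
  finite_set W.
Proof.
move=> fin [cov _ _].
have left I : arcs_of W I -> exists x, forall w, W w -> I w -> w = x.
  by move=> [x [y [_ _ _ -> H]]]; exists x.
pose F (I : set C) := xget 0 [set x | forall w, W w -> I w -> w = x].
apply: (@sub_finite_set _ _ (F @` arcs_of W)); last exact: finite_image.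
move=> w Ww; have : circle w by exact: Wc.
rewrite -cov => -[I WI Iw]; exists I => //.
have [x Hx] := left I WI.
have /= HF : [set x | forall w, W w -> I w -> w = x] (F I) by apply: xgetI Hx.
by rewrite -(HF w).
Qed.

End Arcs.
End CyclicOrder.

(** * The fundamental quadrilateral *)
Section Charts.
Variable R : realType.
Local Notation C := R[i].
Local Notation Re := complex.Re.
Local Notation Im := complex.Im.
Implicit Types (p q r z : C).

Lemma chart_den_neq0 p z : disk p -> closed_disk z -> 1 - p^* * z != 0.
Proof.
move=> /diskE p1 /closed_diskE z1; apply/eqP => E.
have : sqn (p^* * z) = 1.
  by rewrite (_ : p^* * z = 1) ?/sqn ?ReImE ?expr1n ?expr0n ?addr0 //; apply/esym/eqP; rewrite -subr_eq0 E.
rewrite sqnM sqnJ => H; have := sqn_ge0 p; have := sqn_ge0 z => h1 h2.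
have : sqn p * sqn z <= sqn p * 1 by rewrite ler_wpM2l.
by rewrite H; lra.
Qed.

(** Clears the denominators of the charts; the imaginary and real parts then carry orientation and
    angle over to [det3] and [lor]. *)
Lemma chart_conjM p q r : disk p -> closed_disk q -> closed_disk r ->
  (disk_chart p q)^* * disk_chart p r * (sqn (1 - p^* * q) * sqn (1 - p^* * r))%:C%C =
  (q - p)^* * (r - p) * ((1 - p^* * q) * (1 - p^* * r)^*).
Proof.
move=> dp dq dr; have q0 := chart_den_neq0 dp dq; have r0 := chart_den_neq0 dp dr.
rewrite /disk_chart; move: (1 - p^* * q) (1 - p^* * r) q0 r0 => a b a0 b0.
have -> : (sqn a * sqn b)%:C%C = a^* * a * (b^* * b).
  by apply: complexP; rewrite /sqn !ReImE; ring.
have a0' : a^* != 0 by rewrite conjC_eq0.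
by rewrite rmorphM fmorphV /=; field; rewrite b0 a0'.
Qed.

Lemma chart_Im p q r : disk p -> closed_disk q -> closed_disk r ->
  4 * (Im ((disk_chart p q)^* * disk_chart p r) * (sqn (1 - p^* * q) * sqn (1 - p^* * r))) =
  (1 - sqn p) * det3 (hlift p) (hlift q) (hlift r).
Proof.
move=> dp dq dr; have := congr1 (@complex.Im R) (chart_conjM dp dq dr).
rewrite ImM ReR ImR mulr0 add0r => ->.
by rewrite /det3 /lor /cross /hlift !coE /sqn !ReImE; ring.
Qed.

Lemma chart_Re p q r : disk p -> closed_disk q -> closed_disk r ->
  4 * (Re ((disk_chart p q)^* * disk_chart p r) * (sqn (1 - p^* * q) * sqn (1 - p^* * r))) =
  lor (cross (hlift p) (hlift q)) (cross (hlift p) (hlift r)).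
Proof.
move=> dp dq dr; have := congr1 (@complex.Re R) (chart_conjM dp dq dr).
rewrite ReM ReR ImR mulr0 subr0 => ->.
by rewrite /lor /cross /hlift !coE /sqn !ReImE; ring.
Qed.

Lemma sqnE z : sqn z = Re (z^* * z).
Proof. by rewrite /sqn !ReImE; ring. Qed.

Lemma left_ofE p q r : disk p -> disk q -> disk r ->
  left_of p q r <-> 0 < det3 (hlift p) (hlift q) (hlift r).
Proof.
move=> dp /disk_closed dq /disk_closed dr; rewrite /left_of.
have D1 : 0 < sqn (1 - p^* * q) * sqn (1 - p^* * r).
  by rewrite mulr_gt0 ?sqn_gt0 ?chart_den_neq0.
have P1 : 0 < 1 - sqn p by rewrite subr_gt0; apply/diskE.
rewrite -[X in _ <-> is_true X](pmulr_rgt0 _ P1) -chart_Im // pmulr_rgt0 //.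
by rewrite pmulr_lgt0.
Qed.

(** The angle between two sides at [p] is the angle between their normals [cross (hlift p) _]. *)
Lemma cos_angle p q r t : disk p -> disk q -> disk r -> q != p -> r != p ->
  0 <= t <= pi -> hyperbolic_angle p q r = t ->
  lor (cross (hlift p) (hlift q)) (cross (hlift p) (hlift r)) =
  cos t * (Num.sqrt (lor (cross (hlift p) (hlift q)) (cross (hlift p) (hlift q))) *
           Num.sqrt (lor (cross (hlift p) (hlift r)) (cross (hlift p) (hlift r)))).
Proof.
move=> dp /disk_closed dq /disk_closed dr qp rp tpi <-; rewrite /hyperbolic_angle.
have NE z : Normc.normc z = Num.sqrt (sqn z) by case: z.
rewrite !NE; have D z : closed_disk z -> 0 < sqn (1 - p^* * z).
  by move=> dz; rewrite sqn_gt0 chart_den_neq0.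
have S z : closed_disk z -> lor (cross (hlift p) (hlift z)) (cross (hlift p) (hlift z)) =
    sqn (disk_chart p z) * (2 * sqn (1 - p^* * z)) ^+ 2.
  by move=> dz; rewrite -chart_Re // (sqnE (disk_chart p z)); ring.
have Q z : closed_disk z ->
    Num.sqrt (lor (cross (hlift p) (hlift z)) (cross (hlift p) (hlift z))) =
    Num.sqrt (sqn (disk_chart p z)) * (2 * sqn (1 - p^* * z)).
  by move=> dz; rewrite S // sqrtrM ?sqn_ge0 // sqrtr_sqr gtr0_norm // mulr_gt0 // D.
rewrite !Q //.
rewrite -chart_Re //; set u := disk_chart p q; set w := disk_chart p r.
have U z : closed_disk z -> z != p -> 0 < Num.sqrt (sqn (disk_chart p z)).
  move=> dz zp; rewrite sqrtr_gt0 sqn_gt0 /disk_chart mulf_neq0 ?subr_eq0 //.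
  by rewrite invr_neq0 // chart_den_neq0.
have u0 := U q dq qp; have w0 := U r dr rp; rewrite -/u -/w in u0 w0.
have bnd : (Re (u^* * w) / (Num.sqrt (sqn u) * Num.sqrt (sqn w))) ^+ 2 <= 1.
  rewrite expr_div_n ler_pdivrMr ?exprn_gt0 ?mulr_gt0 // mul1r exprMn !sqr_sqrtr ?sqn_ge0 //.
  by rewrite -(sqnJ u) -sqnM /sqn lerDl sqr_ge0.
rewrite acosK; first by field; rewrite !lt0r_neq0.
by rewrite in_itv /= -ler_norml -(@expr_le1 _ 2) // real_normK // num_real.
Qed.

(* The reflection in the vertical diameter. *)
Definition sg (u : vect R) := vec (- cx u) (cy u) (ct u).
Lemma sgK : involutive sg.
Proof. by move=> u; apply: vecP; rewrite /sg !coE ?opprK. Qed.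
Lemma sgD u w : sg (u + w) = sg u + sg w.
Proof. by apply: vecP; rewrite /sg !coE //; ring. Qed.
Lemma sgZ k u : sg (k *: u) = k *: sg u.
Proof. by apply: vecP; rewrite /sg !coE //; ring. Qed.
Lemma sgN u : sg (- u) = - sg u.
Proof. by apply: vecP; rewrite /sg !coE. Qed.
Lemma lor_sg u w : lor (sg u) (sg w) = lor u w.
Proof. by rewrite /lor /sg !coE; ring. Qed.
Lemma sg_cross u w : sg (cross u w) = - cross (sg u) (sg w).
Proof. by apply: vecP; rewrite /cross /sg !coE; ring. Qed.
Lemma sg_hlift z : sg (hlift z) = hlift (- z^*).
Proof. by apply: vecP; rewrite /sg /hlift !coE /sqn !ReImE; ring. Qed.

End Charts.

Lemma Z4P (i : 'Z_4) : [\/ i = 0, i = 1, i = 2 | i = 3].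
Proof.
case: i => [[|[|[|[|//]]]] p]; [apply: Or41|apply: Or42|apply: Or43|apply: Or44];
  exact: val_inj.
Qed.

Lemma Z4E : ((4 = 0 :> 'Z_4) * (5 = 1 :> 'Z_4) * (-1 = 3 :> 'Z_4))%type.
Proof. by repeat split; apply: val_inj. Qed.

Lemma Z4D : ((1 + 1 = 2 :> 'Z_4)%R * (1 + 2 = 3 :> 'Z_4)%R * (1 + 3 = 0 :> 'Z_4)%R *
  (2 + 1 = 3 :> 'Z_4)%R * (2 + 2 = 0 :> 'Z_4)%R * (2 + 3 = 1 :> 'Z_4)%R *
  (3 + 1 = 0 :> 'Z_4)%R * (3 + 2 = 1 :> 'Z_4)%R * (3 + 3 = 2 :> 'Z_4)%R *
  (- 1 = 3 :> 'Z_4)%R * (- 2 = 2 :> 'Z_4)%R * (- 3 = 1 :> 'Z_4)%R)%type.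
Proof. by repeat split; apply: val_inj. Qed.

Lemma Z4A (i : 'Z_4) : ((i + 1 + 1 = i + 2)%R * (i + 1 + 2 = i + 3)%R *
  (i + 1 + 3 = i)%R * (i + 2 + 1 = i + 3)%R * (i + 2 + 2 = i)%R *
  (i + 2 + 3 = i + 1)%R * (i + 3 + 1 = i)%R * (i + 3 + 2 = i + 1)%R *
  (i + 3 + 3 = i + 2)%R)%type.
Proof. by rewrite -!(addrA i) !Z4D addr0. Qed.

(* [e i] is the outward unit normal of the side joining [P i] to [P (i + 1)]; the last two
   fields express the symmetry in the vertical axis. *)
Record quadrilateral (R : realType) (P e : 'Z_4 -> vect R) : Prop := Quadrilateral {
  quad_timelike : forall i, timelike (P i);
  quad_left : forall i, 0 < det3 (P i) (P (i + 1)) (P (i + 2));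
  quad_normal : forall i, exists2 k, 0 < k & e i = (- k) *: cross (P i) (P (i + 1));
  quad_unit : forall i, lor (e i) (e i) = 1;
  quad_angle : forall i, exists2 n, (2 <= n)%N & lor (e i) (e (i + 1)) = - cos (pi / n%:R);
  quad_sgP : forall i, sg (P i) = P (- i);
  quad_sge : forall i, sg (e i) = e (3 - i) }.

(** * From the Bowen-Series domain to the unit normals of its sides *)

Section Domain.
Variable R : realType.
Local Notation C := R[i].
Local Notation Re := complex.Re.

Definition nrm (u : vect R) : vect R := (Num.sqrt (lor u u))^-1 *: u.

Lemma nrmN u : nrm (- u) = - nrm u.
Proof. by rewrite /nrm lorNl lorNr opprK scalerN. Qed.
Lemma nrm_unit u : 0 < lor u u -> lor (nrm u) (nrm u) = 1.
Proof.
move=> u0; rewrite /nrm lorZl lorZr mulrA -expr2 exprVn sqr_sqrtr ?ltW //.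
by rewrite mulVf // lt0r_neq0.
Qed.
Lemma lor_nrm u w k : 0 < lor u u -> 0 < lor w w ->
  lor u w = k * (Num.sqrt (lor u u) * Num.sqrt (lor w w)) -> lor (nrm u) (nrm w) = k.
Proof.
rewrite -(sqrtr_gt0 (lor u u)) -(sqrtr_gt0 (lor w w)) => u0 w0 E; rewrite /nrm lorZl lorZr E.
by field; rewrite !lt0r_neq0.
Qed.

Definition side_normal (v : 'Z_4 -> C) i : vect R :=
  - nrm (cross (hlift (v i)) (hlift (v (i + 1)))).

(** If [m1] or [m2] were 2, then [m3] would be 2 as well, and two of the inverses would already add
    up to 1. *)
Lemma admissible_bounds m1 m2 m3 : admissible m1 m2 m3 ->
  [/\ (2 <= m1./2)%N, (2 <= m2./2)%N, (2 <= m3)%N, m1 = (m1./2).*2 & m2 = (m2./2).*2].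
Proof.
case/and5P => /and3P[m1p m2p m3p] lt1 o1 o2 H.
have H2 : (m1 == 2)%N || (m2 == 2)%N || (m3 == 2)%N -> m3 = 2%N.
  by move=> h; apply/eqP/(implyP H); rewrite !inE orbA (eq_sym 2%N) (eq_sym 2%N m2) (eq_sym 2%N m3).
have inv (m : nat) : 0 <= m%:R^-1 :> rat by rewrite invr_ge0.
have M3 : (2 <= m3)%N.
  case: m3 m3p lt1 {H H2} => [|[|m3]] // _; have := inv m1; have := inv m2; rewrite invr1; lra.
have half m : ~~ odd m -> m = (m./2).*2 by move=> om; rewrite -[LHS]odd_double_half (negPf om).
have ge m : (0 < m)%N -> ~~ odd m -> ((m == 2)%N -> m3 = 2%N) ->
    m%:R^-1 + m3%:R^-1 < 1 :> rat -> (2 <= m./2)%N.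
  case: m => [|[|[|[|m]]]] //= _ _ /(_ erefl) -> /=; lra.
have h1 : (2 <= m1./2)%N.
  apply: ge => //; first by move=> h; apply: H2; rewrite h.
  by have := inv m2; lra.
have h2 : (2 <= m2./2)%N.
  apply: ge => //; first by move=> h; apply: H2; rewrite h orbT.
  by have := inv m1; lra.
by split => //; apply: half.
Qed.

(** The angle at [v 1] and [v 3] is that of the triangle. At [v 2] and [v 4] the diagonal bisects
    it: the adjacent normals are mirror images with product [1 - 2 * x ^+ 2], where [x] is up to
    sign the cosine of the half angle, and the doubling formula applies. *)
Lemma domain_quadrilateral m1 m2 m3 (v : 'Z_4 -> C) :
  admissible m1 m2 m3 -> bowen_series_domain m1 m2 m3 v ->
  quadrilateral (fun i => hlift (v i)) (side_normal v).
Proof.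
move=> /admissible_bounds[m1h m2h m3h m1E m2E] [dv [v2 v4 v3] lv [a4 a2 a1]].
have left i : 0 < det3 (hlift (v i)) (hlift (v (i + 1))) (hlift (v (i + 2))).
  by apply/left_ofE => //; apply: lv.
have tv i := hlift_timelike (dv i).
have v40 : v 4 = v 0 by rewrite Z4E.
rewrite v40 in v4 a4 a2 a1.
have sv i : - (v i)^* = v (- i).
  have re0 (z : C) : Re z = 0 -> - z^* = z :> C.
    by move=> z0; apply: complexP; rewrite !ReImE ?z0 ?oppr0 ?opprK.
  case: (Z4P i) => ->.
  - by rewrite oppr0 re0.
  - by rewrite Z4E v3.
  - by rewrite (_ : - 2 = 2 :> 'Z_4) ?re0 //; apply: val_inj.
  - rewrite (_ : - 3 = 1 :> 'Z_4) ?v3; last exact: val_inj.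
    by rewrite rmorphN /= conjCK opprK.
have sP i : sg (hlift (v i)) = hlift (v (- i)) by rewrite sg_hlift sv.
pose N i := cross (hlift (v i)) (hlift (v (i + 1))).
have N0 i : 0 < lor (N i) (N i).
  apply: (timelike_orth (tv i)); first by rewrite lorC cross_l.
  by apply/eqP => N0; have := left i; rewrite /det3 -/(N i) N0 /lor /cx /cy /ct !mul0r; lra.
have k0 i : 0 < (Num.sqrt (lor (N i) (N i)))^-1 by rewrite invr_gt0 sqrtr_gt0.
have unit i : lor (side_normal v i) (side_normal v i) = 1.
  by rewrite /side_normal lorNl lorNr opprK; apply: nrm_unit; exact: N0.
have sN i : sg (N i) = N (3 - i).
  rewrite /N sg_cross !sP.
  have -> : 3 - i + 1 = - i by rewrite -[RHS]add0r -Z4E; ring.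
  have -> : - (i + 1) = 3 - i by rewrite -(Z4E.2); ring.
  by apply: vecP; rewrite /cross !coE; ring.
have se i : sg (side_normal v i) = side_normal v (3 - i).
  by rewrite /side_normal -/(N i) -/(N (3 - i)) sgN /nrm sgZ sN -(lor_sg (N i)) sN.
have ang (m : nat) : (2 <= m)%N -> (0 : R) <= (pi : R) / m%:R <= (pi : R).
  move=> mge; have m0 : 0 < m%:R :> R by rewrite ltr0n; lia.
  apply/andP; split; first by rewrite divr_ge0 ?pi_ge0 // ltW.
  have m1' : 1 <= m%:R :> R by rewrite ler1n; lia.
  by rewrite ler_pdivrMr //; have := pi_ge0 R; nra.
have neq i j k : 0 < det3 (hlift (v i)) (hlift (v j)) (hlift (v k)) ->
    (v j != v i) && (v k != v i).
  move=> H; apply/andP; split; apply/eqP => E; move: H; rewrite E.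
    by rewrite /det3 /cross /lor !coE; lra.
  by rewrite /det3 cross_l ltxx.
have crossN i j k : det3 (hlift (v i)) (hlift (v j)) (hlift (v k)) != 0 ->
    0 < lor (cross (hlift (v i)) (hlift (v j))) (cross (hlift (v i)) (hlift (v j))).
  move=> D; apply: (timelike_orth (tv i)); first by rewrite lorC cross_l.
  by apply/eqP => E; move/eqP: D; apply; rewrite /det3 E /lor /cx /cy /ct !mul0r; lra.
have detC i j k : 0 < det3 (hlift (v i)) (hlift (v j)) (hlift (v k)) ->
    det3 (hlift (v i)) (hlift (v k)) (hlift (v j)) != 0.
  move=> D; have -> (p q r : vect R) : det3 p r q = - det3 p q r.
    by rewrite /det3 /lor /cross !coE; ring.
  by rewrite oppr_eq0 lt0r_neq0.
have cosA i j k (m : nat) : (2 <= m)%N ->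
    0 < det3 (hlift (v i)) (hlift (v j)) (hlift (v k)) ->
    hyperbolic_angle (v i) (v j) (v k) = pi / m%:R \/
    hyperbolic_angle (v i) (v k) (v j) = pi / m%:R ->
    lor (nrm (cross (hlift (v i)) (hlift (v j)))) (nrm (cross (hlift (v i)) (hlift (v k)))) =
    cos (pi / m%:R).
  move=> mge D; have /andP[ji ki] := neq _ _ _ D.
  have c1 := crossN i j k (lt0r_neq0 D); have c2 := crossN i k j (detC _ _ _ D).
  case=> [/(cos_angle (dv i) (dv j) (dv k) ji ki (ang m mge))|
          /(cos_angle (dv i) (dv k) (dv j) ki ji (ang m mge))].
    exact: lor_nrm.
  by move=> H; rewrite lorC; apply: lor_nrm.
have crossC p q : cross p q = - cross q p :> vect R.
  by apply: vecP; rewrite /cross !coE; ring.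
have eE i : side_normal v i = - nrm (cross (hlift (v i)) (hlift (v (i + 1)))) by [].
have eE' i : side_normal v i = nrm (cross (hlift (v (i + 1))) (hlift (v i))).
  by rewrite eE crossC nrmN opprK.
have L0 : 0 < det3 (hlift (v 0)) (hlift (v 1)) (hlift (v 2)) by have := left 0; rewrite !add0r.
have L1 : 0 < det3 (hlift (v 1)) (hlift (v 2)) (hlift (v 3)) by have := left 1; rewrite !Z4D.
have L2 : 0 < det3 (hlift (v 2)) (hlift (v 3)) (hlift (v 0)) by have := left 2; rewrite !Z4D.
have L3 : 0 < det3 (hlift (v 3)) (hlift (v 0)) (hlift (v 1)) by have := left 3; rewrite !Z4D.
have e3 : side_normal v 3 = sg (side_normal v 0) by rewrite se subr0.
have e2 : side_normal v 2 = sg (side_normal v 1) by rewrite se !Z4D.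
have A01 : lor (side_normal v 0) (side_normal v 1) = - cos (pi / m3%:R).
  rewrite (eE' 0) (eE 1) add0r Z4D lorNr lorC; congr (- _).
  by apply: (cosA _ _ _ _ m3h); [rewrite -det3_rot|left].
(* the normals at v2 and v4 make half the angle with the vertical *)
have vert i j : Re (v i) = 0 -> Re (v j) = 0 ->
    0 < lor (cross (hlift (v i)) (hlift (v j))) (cross (hlift (v i)) (hlift (v j))) ->
    exists2 s, s ^+ 2 = 1 & nrm (cross (hlift (v i)) (hlift (v j))) = vec s 0 0.
  move=> vi vj /nrm_unit; set u := nrm _ => uu.
  have uy : cy u = 0 by rewrite /u /nrm /cross /hlift !coE vi vj; ring.
  have ut : ct u = 0 by rewrite /u /nrm /cross /hlift !coE vi vj; ring.
  exists (cx u); last by apply: vecP; rewrite ?coE.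
  by move: uu; rewrite /lor uy ut; lra.
have dbl (m : nat) : (2 <= m)%N -> cos (pi / m%:R) = 2 * cos (pi / m.*2%:R) ^+ 2 - 1 :> R.
  move=> mge; have -> : pi / m%:R = pi / m.*2%:R *+ 2 :> R.
    rewrite -muln2 natrM -mulr_natr; field.
    by rewrite pnatr_eq0; lia.
  by rewrite cos_mulr2n; lra.
have sgsq u : lor u u = 1 -> lor u (sg u) = 1 - 2 * cx u ^+ 2.
  by rewrite /lor /sg !coE; lra.
have cxA k i j a b (m : nat) : (2 <= m)%N ->
    0 < det3 (hlift (v i)) (hlift (v j)) (hlift (v k)) ->
    Re (v i) = 0 -> (a = j /\ b = k) \/ (a = k /\ b = j) -> Re (v b) = 0 ->
    hyperbolic_angle (v i) (v j) (v k) = pi / m%:R \/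
    hyperbolic_angle (v i) (v k) (v j) = pi / m%:R ->
    cx (nrm (cross (hlift (v i)) (hlift (v a)))) ^+ 2 = cos (pi / m%:R) ^+ 2.
  move=> mge D vi ab vb A; have := cosA _ _ _ _ mge D A.
  have c1 := crossN i j k (lt0r_neq0 D); have c2 := crossN i k j (detC _ _ _ D).
  case: ab => -[aE bE]; rewrite aE bE in vb *.
    have [s s1 ->] := vert _ _ vi vb c2.
    by move=> <-; rewrite /lor !coE; move: s1; rewrite !expr2 => s1; ring: s1.
  have [s s1 ->] := vert _ _ vi vb c1.
  by move=> <-; rewrite /lor !coE; move: s1; rewrite !expr2 => s1; ring: s1.
have A12 : lor (side_normal v 1) (side_normal v 2) = - cos (pi / (m2./2)%:R).
  rewrite e2 sgsq // (dbl _ m2h) -m2E (eE' 1) Z4D.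
  rewrite (cxA 1 2 0 1 0 m2) //; first by ring.
  - by lia.
  - by rewrite -det3_rot -det3_rot.
  - by right.
  - by right.
have A30 : lor (side_normal v 3) (side_normal v 0) = - cos (pi / (m1./2)%:R).
  rewrite lorC e3 sgsq // (dbl _ m1h) -m1E (eE 0) add0r /cxN.
  rewrite cxN sqrrN (cxA 2 0 1 1 2 m1) //; first by ring.
  - by lia.
  - by left.
  - by left.
have A23 : lor (side_normal v 2) (side_normal v 3) = - cos (pi / m3%:R).
  by rewrite e2 e3 lor_sg lorC.
split => //.
- by move=> i; exists (Num.sqrt (lor (N i) (N i)))^-1; rewrite // scaleNr.
- move=> i; case: (Z4P i) => ->; rewrite ?add0r ?Z4D.
  + by exists m3.
  + by exists m2./2.
  + by exists m3.
  + by exists m1./2.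
Qed.

End Domain.

(** * The mirrors of the quadrilateral and their ends at infinity *)

Section Quadrilateral.
Variable R : realType.
Variables (P e : 'Z_4 -> vect R).
Hypothesis Q : quadrilateral P e.
Implicit Types (u w x y m : vect R) (i j k : 'Z_4).

Lemma eP0 i : lor (e i) (P i) = 0.
Proof. by have [k _ ->] := quad_normal Q i; rewrite lorZl cross_l mulr0. Qed.
Lemma eP1 i : lor (e i) (P (i + 1)) = 0.
Proof. by have [k _ ->] := quad_normal Q i; rewrite lorZl cross_r mulr0. Qed.
Lemma eP2 i : lor (e i) (P (i + 2)) < 0.
Proof.
have [k k0 ->] := quad_normal Q i; rewrite lorZl mulNr oppr_lt0.
by rewrite mulr_gt0 //; exact: (quad_left Q).
Qed.
Lemma eP3 i : lor (e i) (P (i + 3)) < 0.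
Proof.
have [k k0 ->] := quad_normal Q i; rewrite lorZl mulNr oppr_lt0 mulr_gt0 //.
by have := quad_left Q (i + 3); rewrite det3_rot !Z4A.
Qed.

Lemma eeN i : lor (e i) (e (i + 1)) <= 0.
Proof.
have [n n2 ->] := quad_angle Q i; rewrite oppr_le0 cos_ge0_pihalf //.
have n0 : 2 <= n%:R :> R by rewrite ler_nat.
have p0 : 0 < (pi : R) := pi_gt0 R.
apply/andP; split.
  apply: (@le_trans _ _ 0); first by rewrite oppr_le0 divr_ge0 // ltW.
  by rewrite divr_ge0 // ltW //; lra.
have n1 : 0 < n%:R :> R by lra.
by rewrite ler_pM2l // lef_pV2 ?posrE.
Qed.

Definition interior x := forall j, lor (e j) x < 0.

(** A point of the vertical diagonal, hence fixed by [sg]: heights measured from it ignore the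
    vertical reflection contained in each [T i]. *)
Definition center : vect R := P 0 + P 2.

Lemma center_interior : interior center.
Proof.
move=> j; rewrite /center lorDr; case: (Z4P j) => ->.
- by have := eP0 0; have := eP2 0; rewrite add0r => h ->; rewrite add0r.
- by have := eP1 1; have := eP3 1; rewrite !Z4D => h ->; rewrite addr0.
- by have := eP0 2; have := eP2 2; rewrite !Z4D => h ->; rewrite addr0.
- by have := eP1 3; have := eP3 3; rewrite !Z4D => h ->; rewrite add0r.
Qed.
Lemma center_timelike : timelike center.
Proof. by apply: timelikeD; [|apply: timelike_causal]; exact: (quad_timelike Q). Qed.
Lemma center_sg : sg center = center.
Proof. by rewrite /center sgD !(quad_sgP Q) oppr0 Z4D. Qed.

Lemma det3_basis u1 u2 u3 x : det3 u1 u2 u3 != 0 -> exists a b c,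
  x = a *: u1 + b *: u2 + c *: u3.
Proof.
move=> d0; have := cramer u1 u2 u3 x; move: (det3 u1 u2 u3) d0 => d d0 E.
exists (det3 x u2 u3 / d), (det3 u1 x u3 / d), (det3 u1 u2 x / d).
by apply: (scalerI d0); rewrite E !scalerDr !scalerA ![d * _]mulrC !divfK.
Qed.

Lemma basis i x : exists a b c,
  x = a *: P i + b *: P (i + 1) + c *: P (i + 2).
Proof. by apply: det3_basis; rewrite lt0r_neq0 // (quad_left Q). Qed.

(* This uses that the angles are at most [pi / 2]. *)
Lemma opposite_aux i x : causal x -> 0 <= lor (e i) x -> 0 <= lor (e (i + 2)) x ->
  lor (e (i + 1)) x < 0.
Proof.
move=> cx h0 h2; rewrite ltNge; apply/negP => h1.
(* The projection of [x] to the line of side [i + 1]. Non-obtuse angles keep it beyond both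
   neighbours, so its coordinates on the two vertices are nonpositive, which no causal [x]
   allows. *)
pose y := x - lor (e (i + 1)) x *: e (i + 1).
have e1y : lor (e (i + 1)) y = 0.
  by rewrite /y lorDr lorNr lorZr (quad_unit Q) mulr1 subrr.
have ey (j : 'Z_4) : lor (e j) (e (i + 1)) <= 0 -> 0 <= lor (e j) x -> 0 <= lor (e j) y.
  by move=> ej jx; rewrite /y lorDr lorNr lorZr; nra.
have [a [b [c yE]]] := basis (i + 1) y.
have q1 := eP0 (i + 1); have q2 := eP1 (i + 1); have q3 := eP2 (i + 1).
have c0 : c = 0.
  move: e1y; rewrite yE !lorDr !lorZr q1 q2 !mulr0 !add0r => /eqP.
  by rewrite mulf_eq0 (negPf (ltr0_neq0 q3)) orbF => /eqP.
rewrite c0 scale0r addr0 in yE.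
have b0 : b <= 0.
  have := ey i (eeN i) h0; rewrite yE lorDr !lorZr (eP1 i) mulr0 add0r.
  by have := eP2 i; rewrite !Z4A; nra.
have a0 : a <= 0.
  have := ey (i + 2) _ h2; have ee1 := eeN (i + 1); rewrite Z4A in ee1; rewrite lorC => /(_ ee1).
  rewrite yE lorDr !lorZr !Z4A (eP0 (i + 2)) mulr0 addr0.
  by have := eP3 (i + 2); rewrite !Z4A; nra.
have t1 := quad_timelike Q (i + 1); have t2 := quad_timelike Q (i + 1 + 1).
have : lor (P (i + 1)) x = lor (P (i + 1)) y.
  by rewrite /y lorDr lorNr lorZr (lorC (P (i + 1)) (e _)) q1 mulr0 subr0.
have l1 := timelike_lor t1 (timelike_causal t2); have := timelike_lor t1 cx.
by rewrite yE lorDr !lorZr; have [_ l2] := t1; nra.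
Qed.

(** The half planes beyond opposite sides are disjoint, at infinity as well: by [opposite_aux] a
    common point lies strictly inside the two remaining sides, and its coordinates on three vertices
    then have contradictory signs. *)
Lemma opposite i x : causal x -> 0 <= lor (e i) x -> lor (e (i + 2)) x < 0.
Proof.
move=> cx h0; rewrite ltNge; apply/negP => h2.
have h1 := opposite_aux cx h0 h2.
have h3 : lor (e (i + 3)) x < 0.
  have := @opposite_aux (i + 2) x cx h2; rewrite !Z4A; exact.
have [a [b [c xE]]] := basis i x.
have k0 := eP2 i.
have k1 : lor (e (i + 1)) (P i) < 0 by have := eP3 (i + 1); rewrite !Z4A.
have k2 : lor (e (i + 2)) (P i) < 0 by have := eP2 (i + 2); rewrite !Z4A.
have k3 : lor (e (i + 2)) (P (i + 1)) < 0 by have := eP3 (i + 2); rewrite !Z4A.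
have k4 : lor (e (i + 3)) (P (i + 1)) < 0 by have := eP2 (i + 3); rewrite !Z4A.
have k5 : lor (e (i + 3)) (P (i + 2)) < 0 by have := eP3 (i + 3); rewrite !Z4A.
have z1 : lor (e (i + 1)) (P (i + 2)) = 0 by have := eP1 (i + 1); rewrite !Z4A.
have z3 : lor (e (i + 3)) (P i) = 0 by have := eP1 (i + 3); rewrite !Z4A.
move: h0 h1 h2 h3; rewrite xE !lorDr !lorZr (eP0 i) (eP1 i) (eP0 (i + 1)) z1 (eP0 (i + 2)) z3.
rewrite !mulr0 !add0r !addr0 => h0 h1 h2 h3.
have c0 : c <= 0 by rewrite -(nmulr_lge0 _ k0).
have a0 : 0 < a by rewrite -(nmulr_llt0 _ k1).
have b0 : 0 < b.
  rewrite -(nmulr_llt0 _ k4); have : 0 <= c * lor (e (i + 3)) (P (i + 2)).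
    by rewrite nmulr_lge0.
  lra.
have : a * lor (e (i + 2)) (P i) < 0 by rewrite pmulr_rlt0.
have : b * lor (e (i + 2)) (P (i + 1)) < 0 by rewrite pmulr_rlt0.
lra.
Qed.

(** Otherwise [x] would be a combination of three vertices with nonnegative coefficients, hence
    timelike. Which three depends on the side of the diagonal on which [x] lies. *)
Lemma circle_exterior x : causal x -> lor x x = 0 -> exists k, 0 <= lor (e k) x.
Proof.
move=> cx xx; apply: contrapT => N.
have n j : lor (e j) x < 0 by rewrite ltNge; apply/negP => h; apply: N; exists j.
have pos a b c (i : 'Z_4) : x = a *: P i + b *: P (i + 1) + c *: P (i + 2) ->
    0 <= b -> False.
  move=> xE b0; have k0 := eP2 i.
  have k1 : lor (e (i + 1)) (P i) < 0 by have := eP3 (i + 1); rewrite !Z4A.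
  have z1 : lor (e (i + 1)) (P (i + 2)) = 0 by have := eP1 (i + 1); rewrite !Z4A.
  have := n i; have := n (i + 1).
  rewrite {1 2}xE !lorDr !lorZr (eP0 i) (eP1 i) (eP0 (i + 1)) z1 !mulr0 !add0r !addr0.
  rewrite nmulr_llt0 // nmulr_llt0 // => a0 c0.
  have T j := quad_timelike Q j.
  have : timelike x.
    rewrite xE; apply: timelikeD; last by apply/causalZ/timelike_causal.
    move: b0; rewrite le_eqVlt => /orP[/eqP <-|b0].
      by rewrite scale0r addr0; apply: timelikeZ.
    by apply: timelikeD; [apply: timelikeZ|apply/timelike_causal/timelikeZ].
  by case=> _; rewrite xx ltxx.
have [a [b [c xE]]] := basis 0 x; have [b0|b0] := lerP 0 b; first exact: (pos _ _ _ _ xE).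
have [p [q [r PE]]] := basis 2 (P 1).
have := eP2 3; have := eP3 1; rewrite !Z4D => k1 k2.
have := eP2 2; have := eP2 1; rewrite !Z4D => k3 k4.
(* [P 1] and [P 3] lie on opposite sides of the diagonal *)
have d1 : 0 < det3 (P 0) (P 1) (P 2) by have := quad_left Q 0; rewrite !add0r.
have d3 : 0 < det3 (P 2) (P 3) (P 0) by have := quad_left Q 2; rewrite !Z4D.
have q0 : q < 0.
  have E : det3 (P 2) (P 1) (P 0) = q * det3 (P 2) (P 3) (P 0).
    by rewrite PE !Z4D /det3 /lor /cross !coE; ring.
  have : q * det3 (P 2) (P 3) (P 0) < 0.
    by rewrite -E det3C oppr_lt0 -det3_rot.
  by rewrite pmulr_llt0.
apply: (pos (c + b * p) (b * q) (a + b * r) 2); last by apply: mulr_le0; exact: ltW.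
rewrite {1}xE !add0r {1}PE !Z4D !scalerDr !scalerDl !scalerA.
by apply: vecP; rewrite !coE; ring.
Qed.

Lemma refl_lor i u w : lor (refl (@lor R) e i u) (refl (@lor R) e i w) = lor u w.
Proof.
rewrite /refl !lorDl !lorDr !lorNl !lorNr !lorZl !lorZr (quad_unit Q) (lorC u (e i)).
by ring.
Qed.

Lemma timelike_causal_of u w : timelike u -> lor u w < 0 -> lor w w <= 0 -> causal w.
Proof.
move=> tu uw ww; split=> //; rewrite ltNge; apply/negP; rewrite le_eqVlt => /orP[/eqP wt|wt].
  have [w0|w0] := eqVneq w 0; first by move: uw; rewrite w0 /lor /cx /cy /ct /=; lra.
  have : cx w ^+ 2 + cy w ^+ 2 <= 0 by move: ww; rewrite /lor wt; lra.
  have := sqr_ge0 (cx w); have := sqr_ge0 (cy w) => h1 h2 h3.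
  have /eqP : cx w ^+ 2 = 0 by lra.
  have /eqP : cy w ^+ 2 = 0 by lra.
  rewrite !sqrf_eq0 => /eqP y0 /eqP x0; move/eqP: w0; apply.
  by apply: vecP.
have cN : causal (- w) by split; rewrite ?coE ?lorNl ?lorNr; lra.
by have := timelike_lor tu cN; rewrite lorNr; lra.
Qed.

Lemma refl_causal i x : causal x -> causal (refl (@lor R) e i x).
Proof.
move=> cx; apply: (timelike_causal_of (quad_timelike Q i)); last first.
  by rewrite refl_lor; case: cx.
rewrite /refl lorDr lorNr lorZr (lorC (P i) (e i)) eP0 mulr0 subr0.
exact: timelike_lor (quad_timelike Q i) cx.
Qed.

(** A value in (-1, 1) would make the lines cross; a value at least 1 would put one of the half
    planes inside the other. *)
Lemma opposite_lor i : lor (e i) (e (i + 2)) <= -1.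
Proof.
set c := lor _ _; rewrite leNgt; apply/negP => c1.
have u1 := quad_unit Q i; have u2 := quad_unit Q (i + 2).
have [lt1|ge1] := ltP c 1.
(* the two sides would meet *)
  pose q := cross (e i) (e (i + 2)).
  have qq : lor q q < 0.
    rewrite /q lor_cross u1 u2 (lorC (e (i + 2))) -/c.
    have : 0 < (1 + c) * (1 - c) by apply: mulr_gt0; lra.
    lra.
  have [q' [cq' q1 q2]] : exists q', [/\ causal q', lor (e i) q' = 0 & lor (e (i + 2)) q' = 0].
    have q1 : lor (e i) q = 0 by rewrite lorC cross_l.
    have q2 : lor (e (i + 2)) q = 0 by rewrite lorC cross_r.
    have T := quad_timelike Q 0; have [T1 T2] := T.
    have [Pq|Pq|Pq] := ltrgtP (lor (P 0) q) 0.
    - by exists q; split => //; apply: (timelike_causal_of T) => //; exact: ltW.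
    - exists (- q); rewrite !lorNr q1 q2 !oppr0; split => //.
      by apply: (timelike_causal_of T); rewrite ?lorNl ?lorNr; lra.
    have q0 : q != 0 by apply/eqP => q0; move: qq; rewrite q0 /lor /cx /cy /ct /=; lra.
    by have := timelike_orth T Pq q0; lra.
  have q1' : 0 <= lor (e i) q' by rewrite q1.
  by have := opposite cq' q1'; rewrite q2 ltxx.
(* otherwise the component of [e (i + 2)] along the side [i] is causal *)
pose k := e (i + 2) - c *: e i.
have kk : lor k k = 1 - c ^+ 2.
  by rewrite /k !lorDl !lorDr !lorNl !lorNr !lorZl !lorZr u1 u2 (lorC (e (i + 2))) -/c; ring.
have kP : lor (P (i + 1)) k < 0.
  rewrite /k lorDr lorNr lorZr !(lorC (P _)) eP1 mulr0 subr0.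
  by have := eP3 (i + 2); rewrite !Z4A.
have ck : causal k.
  by apply: (timelike_causal_of (quad_timelike Q (i + 1))) => //; rewrite kk; nra.
have := timelike_lor (quad_timelike Q (i + 2)) ck.
rewrite /k lorDr lorNr lorZr !(lorC (P _)) eP0.
by have := eP2 i; nra.
Qed.

Definition root m := exists (w : seq 'Z_4) j,
  m = act (@lor R) e w (e j) \/ m = - act (@lor R) e w (e j).

Lemma root_e j : root (e j).
Proof. by exists [::], j; left. Qed.
Lemma root_refl i m : root m -> root (refl (@lor R) e i m).
Proof.
move=> [w [j [->|->]]]; exists (i :: w), j; [by left|right].
by rewrite -(actN (@lorC R) (@lorZl R) e [:: i]).
Qed.

(** The convex cone fed to [refl_root_sign], whose conclusion then reads that no mirror crosses the
    interior. *)
Definition positive m := forall y, interior y -> lor m y < 0.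

Let Ce i : positive (e i). Proof. by move=> y; apply. Qed.
Let CC p q u w : 0 <= p -> 0 <= q -> 0 < p + q -> positive u -> positive w ->
  positive (p *: u + q *: w).
Proof.
move=> p0 q0 pq hu hw y iy; rewrite lorDl !lorZl.
have hU := hu y iy; have hW := hw y iy.
have [p1|p1] := ltP 0 p.
  have : p * lor u y < 0 by rewrite pmulr_rlt0.
  have : q * lor w y <= 0 by rewrite mulr_ge0_le0 // ltW.
  lra.
have -> : p = 0 by apply/eqP; rewrite eq_le p1.
by rewrite mul0r add0r pmulr_rlt0 //; lra.
Qed.
Let angles i j : i != j -> lor (e i) (e j) <= -1 \/
  exists2 n, (2 <= n)%N & lor (e i) (e j) = - cos (pi / n%:R).
Proof.
have D (k : 'Z_4) : [\/ k = 0, k = 1, k = 2 | k = 3] := Z4P k.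
move=> ij; have -> : j = i + (j - i) by rewrite addrC subrK.
have : j - i != 0 by rewrite subr_eq0 eq_sym.
case: (D (j - i)) => -> // _; [right|left|right].
- exact: (quad_angle Q i).
- exact: opposite_lor.
- have [n n2 E] := quad_angle Q (i + 3); rewrite Z4A in E.
  by exists n; rewrite // lorC.
Qed.

Lemma root_sign (w : seq 'Z_4) j : positive (act (@lor R) e w (e j)) \/
  positive (- act (@lor R) e w (e j)).
Proof. exact: (refl_root_sign (@lorC R) (@lorDl R) (@lorZl R) (quad_unit Q) Ce CC angles). Qed.

Lemma act_id (w : seq 'Z_4) : (forall j, lor (act (@lor R) e w (e j)) center < 0) ->
  act (@lor R) e w =1 id.
Proof.
move=> H; apply: (refl_fix (@lorC R) (@lorDl R) (@lorZl R) (quad_unit Q) Ce CC angles).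
by move=> j /(_ center center_interior); rewrite lorNl; have := H j; lra.
Qed.

Lemma root_interior m y : root m -> interior y -> lor m y != 0.
Proof.
have N u : positive u \/ positive (- u) -> interior y -> lor u y != 0.
  by case=> H iy; have := H y iy; rewrite ?lorNl => h; rewrite neq_lt; apply/orP; [left|right]; lra.
move=> [w [j [->|->]]]; apply: N; first exact: root_sign.
by rewrite opprK; apply/or_comm; exact: root_sign.
Qed.

(** The mirror would contain [s *: P k + x], which is interior for large [s]: [x] lies in the sector
    of the quadrilateral at the vertex [P k]. *)
Lemma root_vertex m k x : root m -> lor m (P k) = 0 -> lor m x = 0 ->
  lor (e k) x < 0 -> lor (e (k + 3)) x < 0 -> False.
Proof.
move=> rm mk mx h0 h3.
pose a1 := lor (e (k + 1)) (P k); pose a2 := lor (e (k + 2)) (P k).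
have a1n : a1 < 0 by have := eP3 (k + 1); rewrite !Z4A.
have a2n : a2 < 0 by have := eP2 (k + 2); rewrite !Z4A.
pose b1 := lor (e (k + 1)) x; pose b2 := lor (e (k + 2)) x.
(* Large enough to make the two sides not passing through [P k] negative on the sum. *)
pose s := 1 + `|b1 / a1| + `|b2 / a2|.
have s0 : 0 < s by rewrite /s; have := normr_ge0 (b1 / a1); have := normr_ge0 (b2 / a2); lra.
have S a b : a < 0 -> `|b / a| < s -> s * a + b < 0.
  move=> a0; rewrite normf_div ltr_pdivrMr ?normr_gt0 ?ltr0_neq0 // (ltr0_norm a0).
  by have := ler_norm b; lra.
have iy : interior (s *: P k + x).
  move=> j; rewrite lorDr lorZr.
  have -> : j = k + (j - k) by rewrite addrC subrK.
  case: (Z4P (j - k)) => ->.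
  - by rewrite addr0 eP0 mulr0 add0r.
  - apply: S => //; rewrite -/a1 -/b1 /s; have := normr_ge0 (b2 / a2); lra.
  - apply: S => //; rewrite -/a2 -/b2 /s; have := normr_ge0 (b1 / a1); lra.
  - by have := eP1 (k + 3); rewrite Z4A => ->; rewrite mulr0 add0r.
by have := root_interior rm iy; rewrite lorDr lorZr mk mx mulr0 addr0 eqxx.
Qed.

(** Where the half planes beyond two adjacent sides overlap, a mirror through another vertex cannot
    end. For a neighbouring vertex, reflecting in the side it shares with [P i] brings [x] into its
    sector; the sector of the opposite vertex contains [x] already. *)
Lemma root_corner m k i x : causal x -> root m -> lor m (P k) = 0 -> lor m x = 0 ->
  0 < lor (e i) x -> 0 < lor (e (i + 3)) x -> k = i.
Proof.
move=> cx rm mk mx h0 h3.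
have -> : k = i + (k - i) by rewrite addrC subrK.
have {mk} : lor m (P (i + (k - i))) = 0 by rewrite [i + _]addrC subrK.
have E j l : lor (e j) (refl (@lor R) e l x) = lor (e j) x - 2 * lor (e l) x * lor (e j) (e l).
  by rewrite /refl lorDr lorNr lorZr; ring.
have rP j l : lor (e l) (P j) = 0 -> refl (@lor R) e l (P j) = P j.
  by move=> z; rewrite /refl z mulr0 scale0r subr0.
case: (Z4P (k - i)) => -> mk; first by rewrite addr0.
- exfalso; apply: (@root_vertex _ (i + 1) (refl (@lor R) e i x) (root_refl i rm)).
  + by rewrite -(rP (i + 1) i) ?eP1 // refl_lor.
  + by rewrite refl_lor.
  + have cx' := refl_causal i cx.
    rewrite ltNge; apply/negP => h; have := opposite cx' h; rewrite !Z4A E.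
    have := eeN (i + 3); rewrite Z4A; nra.
  + by rewrite !Z4A E (quad_unit Q); lra.
- exfalso; have h1 := opposite cx (ltW h3); rewrite Z4A in h1.
  by apply: (@root_vertex _ (i + 2) x rm mk mx (opposite cx (ltW h0))); rewrite Z4A.
- exfalso; apply: (@root_vertex _ (i + 3) (refl (@lor R) e (i + 3) x) (root_refl (i + 3) rm)).
  + by rewrite -(rP (i + 3) (i + 3)) ?eP0 // refl_lor.
  + by rewrite refl_lor.
  + by rewrite E (quad_unit Q); lra.
  + have cx' := refl_causal (i + 3) cx.
    rewrite !Z4A ltNge; apply/negP => h; have := opposite cx' h; rewrite !Z4A E.
    by have := eeN (i + 3); rewrite Z4A lorC; nra.
Qed.

(* For [x] on the circle, the hypotheses on [e j] and [e (j + 1)] define the sector on which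
   the Bowen-Series map is [T j], which is compatible with the mirrors through [P j] and
   [P (j + 1)] only; so the map preserves the set of labels. *)
Lemma root_sector m k j x : causal x -> root m -> lor m (P k) = 0 -> lor m x = 0 ->
  0 <= lor (e j) x -> lor (e (j + 1)) x < 0 ->
  exists m' l, [/\ root m', lor m' x = 0, lor m' (P l) = 0 & l = j \/ l = j + 1].
Proof.
move=> cx rm mk mx h0 h1.
have kE : k = j + (k - j) by rewrite addrC subrK.
have h2 := opposite cx h0.
move: mk; rewrite kE; case: (Z4P (k - j)) => -> mk.
- by exists m, j; split => //; [rewrite addr0 in mk|left].
- by exists m, (j + 1); split => //; right.
- exfalso; apply: (root_vertex rm mk mx h2); rewrite Z4A; exact: h1.
have [h|h|h] := ltrgtP (lor (e (j + 3)) x) 0.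
- by exfalso; apply: (root_vertex rm mk mx h); rewrite !Z4A.
- move: h0; rewrite le_eqVlt => /orP[/eqP h0|h0].
    by exists (e j), j; split => //; [exact: root_e|exact: eP0|left].
  have := root_corner cx rm mk mx h0 h => /(canRL (addKr _)).
  by rewrite addNr => /(congr1 val).
- exists (e (j + 3)), j; split => //; [exact: root_e| |by left].
  by have := eP1 (j + 3); rewrite Z4A.
Qed.

Lemma sg_refl i u : sg (refl (@lor R) e i u) = refl (@lor R) e (3 - i) (sg u).
Proof. by rewrite /refl sgD sgN sgZ (quad_sge Q) -(lor_sg (e i)) (quad_sge Q). Qed.

End Quadrilateral.

(** * The group generated by the side pairings *)
Section SideGroup.
Variable R : realType.
Local Notation C := R[i].
Local Notation Re := complex.Re.
Local Notation Im := complex.Im.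
Implicit Types (u w x m : vect R) (g h : 'M[C]_2) (i j k : 'Z_4).

Lemma lact_cross g u w : SU11 g -> lact g (cross u w) = cross (lact g u) (lact g w).
Proof.
move=> /SU11_sqn d; rewrite -[LHS]scale1r -d /sqn.
by apply: vecP; rewrite /cross /lact !coE; ring.
Qed.

Lemma lact_id g : SU11 g -> (forall u, lact g u = u) -> g = 1 \/ g = - 1.
Proof.
move=> sg H; have d := SU11_sqn sg.
have := congr1 (@ct R) (H (vec 0 0 1)); have := congr1 (@cx R) (H (vec 1 0 0)).
rewrite /lact !coE !mulr0 !mulr1 !addr0 !add0r => h1 h2.
have b0 : sqn (g 0 1) == 0 by apply/eqP; move: d h2; rewrite /sqn; lra.
rewrite sqn_eq0 in b0; move/eqP: b0 => b0.
have a2 : Im (g 0 0) = 0.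
  by apply/eqP; rewrite -sqrf_eq0; apply/eqP; move: d h1; rewrite b0 /sqn !ReImE; lra.
have a1 : (Re (g 0 0) - 1) * (Re (g 0 0) + 1) = 0.
  by move: h1; rewrite b0 a2 !ReImE; lra.
rewrite (su_eta sg) b0; move/eqP: a1; rewrite mulf_eq0 => /orP[]/eqP a1; [left|right].
  have -> : g 0 0 = 1 by apply: complexP; rewrite !ReImE; lra.
  by apply: mx2P; rewrite mx2E mx21E ?rmorph0 ?rmorph1.
have -> : g 0 0 = - 1 by apply: complexP; rewrite !ReImE; lra.
by apply: mx2P; rewrite mx2E mxE mx21E ?rmorph0 ?rmorphN ?rmorph1 ?oppr0.
Qed.

Lemma cross_hlift_gt0 (p q : C) : disk p -> disk q -> p <> q ->
  0 < lor (cross (hlift p) (hlift q)) (cross (hlift p) (hlift q)).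
Proof.
move=> /diskE dp /diskE dq pq; rewrite lor_cross !hlift_lift (lorC (hlift q)) lor_hlift.
have s0 : 0 < sqn (p - q) by rewrite sqn_gt0 subr_eq0; apply/eqP.
have a0 : 0 < (1 - sqn p) * (1 - sqn q) by apply: mulr_gt0; lra.
have : 0 < sqn (p - q) * ((1 - sqn p) * (1 - sqn q)) by exact: mulr_gt0.
have : 0 < sqn (p - q) * sqn (p - q) by exact: mulr_gt0.
lra.
Qed.

Lemma fix2_id g (p q : C) : SU11 g -> disk p -> disk q -> p <> q ->
  mobius g p = p -> mobius g q = q -> g = 1 \/ g = - 1.
Proof.
move=> sg dp dq pq gp gq; apply: lact_id => //.
have F z : disk z -> mobius g z = z -> lact g (hlift z) = hlift z.
  move=> dz gz; have := hlift_mobius sg (disk_closed dz); rewrite gz => E.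
  have := lact_lor (hlift z) (hlift z) sg; rewrite E lorZl lorZr mulrA.
  have [_ lz] := hlift_timelike dz; rewrite -[RHS]mul1r => /(mulIf (ltr0_neq0 lz)) /eqP.
  rewrite -expr2 sqrf_eq1 => /orP[]/eqP E1; first by rewrite E1 scale1r.
  by have := sqn_ge0 (den g z); rewrite E1 ler0N1.
have Fp := F p dp gp; have Fq := F q dq gq.
have FN : lact g (cross (hlift p) (hlift q)) = cross (hlift p) (hlift q).
  by rewrite lact_cross // Fp Fq.
have D : det3 (hlift p) (hlift q) (cross (hlift p) (hlift q)) != 0.
  by rewrite lt0r_neq0 //; exact: cross_hlift_gt0.
move=> u; have [a [b [c ->]]] := det3_basis u D.
by rewrite !lactD !lactZ Fp Fq FN.
Qed.

(* The matrix of the reflection in [n] followed by the reflection in the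
   vertical diameter. *)
Definition side_matrix n : 'M[C]_2 := su (Complex (cx n) (- cy n)) (- ct n)%:C%C.

Lemma side_matrix_SU11 n : lor n n = 1 -> SU11 (side_matrix n).
Proof. by move=> n1; apply: su_SU11; move: n1; rewrite /lor /sqn /=; lra. Qed.

Lemma lact_side_matrix n u : lor n n = 1 ->
  lact (side_matrix n) u = sg (u - (2 * lor n u) *: n).
Proof.
move=> n1; have nt : ct n ^+ 2 = cx n ^+ 2 + cy n ^+ 2 - 1 by move: n1; rewrite /lor; lra.
apply: vecP; rewrite /lact /side_matrix /su !mx2E /sg !coE !ReImE /= /lor.
- by have -> : (- ct n) ^+ 2 = cx n ^+ 2 + cy n ^+ 2 - 1; [rewrite sqrrN|ring].
- by have -> : (- ct n) ^+ 2 = cx n ^+ 2 + cy n ^+ 2 - 1; [rewrite sqrrN|ring].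
- by move: nt; rewrite !expr2 => nt; ring: nt.
Qed.

Lemma side_matrix_sg n : lor n n = 1 -> (side_matrix n)^-1 = - side_matrix (sg n).
Proof.
move=> n1; rewrite SU11_inv; last exact: side_matrix_SU11.
rewrite /side_matrix /su !mx2E.
apply: mx2P; rewrite !mx2E [in RHS]mxE !mx2E; apply: complexP; rewrite ?ReImE /=;
  by rewrite ?opprK ?oppr0 // /sg ?coE ?opprK.
Qed.

Variables (v : 'Z_4 -> C) (T : 'Z_4 -> 'M[C]_2) (e : 'Z_4 -> vect R).
Let P i := hlift (v i).
Hypothesis Q : quadrilateral P e.
Hypothesis dv : forall i, disk (v i).
Hypothesis hT : side_rotations v T.

Lemma vertex_neq i : v i <> v (i + 1).
Proof.
move=> E; have := quad_left Q i; rewrite /P -E.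
by rewrite /det3 /lor /cross !coE; lra.
Qed.

Lemma side_matrix_mobius i j : lor (e i) (P j) = 0 -> mobius (side_matrix (e i)) (v j) = v (- j).
Proof.
have si := side_matrix_SU11 (quad_unit Q i).
move=> ej; have dj := disk_closed (dv j).
have := hlift_mobius si dj; rewrite lact_side_matrix ?(quad_unit Q) // -/(P j) ej.
rewrite mulr0 scale0r subr0 (quad_sgP Q) => E.
have d0 : sqn (den (side_matrix (e i)) (v j)) != 0.
  by rewrite lt0r_neq0 // sqn_gt0 den_neq0.
symmetry; apply: (@hlift_inj _ _ _ (sqn (den (side_matrix (e i)) (v j)))) => //.
- exact: disk_closed.
- exact: mobius_closed.
Qed.

Lemma rotation_eq i j : SU11 (T i) -> mobius (T i) (v j) = v (- j) ->
  mobius (T i) (v (j + 1)) = v (- (j + 1)) -> i = j ->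
  T i = side_matrix (e i) \/ T i = - side_matrix (e i).
Proof.
move=> sT h0 h1 ij; set S := side_matrix (e i).
have sS : SU11 S := side_matrix_SU11 (quad_unit Q i).
have sV := SU11_V sS.
have cl k := disk_closed (dv k).
have f k : mobius (T i) (v k) = v (- k) -> lor (e i) (P k) = 0 -> mobius (S^-1 * T i) (v k) = v k.
  by move=> Tk ek; rewrite mobiusM // Tk -(side_matrix_mobius ek) mobiusK.
have [||E|E] := fix2_id (SU11_M sV sT) (dv j) (dv (j + 1)) (@vertex_neq j).
- by apply: f => //; rewrite ij (eP0 Q).
- by apply: f => //; rewrite ij (eP1 Q).
- by left; rewrite -[T i]mul1r -(SU11_mulV sS) -mulrA E mulr1.
- by right; rewrite -[T i]mul1r -(SU11_mulV sS) -mulrA E mulrN1.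
Qed.

(** Two isometries that agree on both ends of side [i] agree up to sign. For [T 2] and [T 4],
    defined as inverses, [side_matrix_sg] identifies the inverse. *)
Lemma rotation_side i : T i = side_matrix (e i) \/ T i = - side_matrix (e i).
Proof.
have [sT [T12 T11] T2 [T34 T33] T4] := hT.
rewrite !Z4E in T34 T33 T4.
have R1 : T 1 = side_matrix (e 1) \/ T 1 = - side_matrix (e 1).
  by apply: (@rotation_eq 1 1) => //; rewrite !Z4D.
have R3 : T 3 = side_matrix (e 3) \/ T 3 = - side_matrix (e 3).
  by apply: (@rotation_eq 3 3) => //; rewrite !Z4D // oppr0.
have VN A : (- A)^-1 = - A^-1 :> 'M[C]_2 by rewrite invrN.
have I k : (side_matrix (e k))^-1 = - side_matrix (e (3 - k)).
  by rewrite side_matrix_sg ?(quad_unit Q) // (quad_sge Q).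
case: (Z4P i) => -> //.
- rewrite T4; case: R3 => ->; rewrite ?VN I subrr; [by right|by rewrite opprK; left].
- rewrite T2; case: R1 => ->; rewrite ?VN I (_ : 3 - 1 = 2 :> 'Z_4); try exact: val_inj.
    by right.
  by rewrite opprK; left.
Qed.

Lemma rotation_SU11 i : SU11 (T i). Proof. by case: hT. Qed.

Lemma group_SU11 g : generated_group T g -> SU11 g.
Proof. exact/generated_SU11/rotation_SU11. Qed.

Lemma lact_T i u : lact (T i) u = sg (refl (@lor R) e i u).
Proof.
by case: (rotation_side i) => ->; rewrite ?lactNg lact_side_matrix ?(quad_unit Q).
Qed.

Lemma T_vertex i : mobius (T i) (v i) = v (- i) /\ mobius (T i) (v (i + 1)) = v (- (i + 1)).
Proof.
by case: (rotation_side i) => ->; rewrite ?mobiusN !side_matrix_mobius ?(eP0 Q) ?(eP1 Q).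
Qed.

Definition sgb b u := if b then sg u else u.

(** Each [T i] is [refl e i] followed by [sg], and [sg] moves past a letter by turning [i] into
    [3 - i]. With the converse [word_lact], the two groups give the normals the same images up to
    sign. *)
Lemma lact_word g : generated_group T g -> exists (w : seq 'Z_4) b,
  forall u, lact g u = act (@lor R) e w (sgb b u).
Proof.
have act_sg (w : seq 'Z_4) u : sg (act (@lor R) e w u) = act (@lor R) e [seq 3 - i | i <- w] (sg u).
  by elim: w => //= i w IH; rewrite (sg_refl Q) IH.
elim=> {g} [i||g h gT [w [b gE]] hT' [w' [b' hE]]|g gT [w [b gE]]].
- by exists [:: 3 - i], true => u; rewrite lact_T (sg_refl Q).
- by exists [::], false => u; rewrite lact1.
- exists (w ++ (if b then [seq 3 - i | i <- w'] else w')), (b (+) b') => u.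
  have sh := group_SU11 hT'; rewrite lactM // gE hE act_cat; congr (act _ _ _ _).
  by case: b {gE} => //=; rewrite act_sg; case: b' {hE} => //=; rewrite sgK.
exists (if b then [seq 3 - i | i <- rev w] else rev w), b => u.
have sg' := group_SU11 gT.
have rK := act_rev (@lorC R) (@lorDl R) (@lorZl R) (quad_unit Q).
rewrite -[in RHS](lact1 u) -(SU11_mulV sg') lactM ?gE; last exact: SU11_V.
by case: b {gE} => /=; rewrite ?act_sg ?rK -?act_sg ?rK ?sgK.
Qed.

Lemma word_lact (w : seq 'Z_4) : exists g b, generated_group T g /\
  forall u, act (@lor R) e w u = lact g (sgb b u).
Proof.
elim/last_ind: w => [|w i [g [b [gT gE]]]].
  by exists 1, false; split => [|u]; [exact: generated_1|rewrite lact1].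
case: b gE => /= gE.
- exists (g * T i), false; split; first by apply: generated_M => //; exact: generated_gen.
  by move=> u; rewrite act_rcons gE lactM ?lact_T //; exact: rotation_SU11.
- exists (g * T (3 - i)), true; split; first by apply: generated_M => //; exact: generated_gen.
  move=> u; rewrite act_rcons gE lactM ?lact_T; last exact: rotation_SU11.
  by rewrite /= -(sg_refl Q) sgK.
Qed.

Lemma rootP m : root e m <-> exists g j, generated_group T g /\
  (m = lact g (e j) \/ m = - lact g (e j)).
Proof.
have sgbe b j : exists l, sgb b (e j) = e l.
  by case: b; [exists (3 - j); rewrite /= (quad_sge Q)|exists j].
split=> [[w [j mE]]|[g [j [gT mE]]]].
  have [g [b [gT gE]]] := word_lact w; have [l lE] := sgbe b j.
  by exists g, l; split => //; rewrite -lE -gE.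
have [w [b gE]] := lact_word gT; have [l lE] := sgbe b j.
by exists w, l; rewrite -lE -gE.
Qed.

Lemma root_lact g m : generated_group T g -> root e m -> root e (lact g m).
Proof.
move=> gT /rootP[h [j [hT' mE]]]; apply/rootP; exists (g * h), j.
split; first exact: generated_M.
by have sh := group_SU11 hT'; rewrite lactM //; case: mE => ->; [left|right; rewrite lactN].
Qed.

Lemma root_unit m : root e m -> lor m m = 1.
Proof.
move=> /rootP[g [j [gT mE]]]; have sg' := group_SU11 gT.
by case: mE => ->; rewrite ?lorNl ?lorNr ?opprK lact_lor ?(quad_unit Q).
Qed.

(* The images of the quadrilateral do not overlap. *)
Lemma lact_center_id g : generated_group T g -> interior e (lact g (center P)) ->
  g = 1 \/ g = - 1.
Proof.
move=> gT ig; have sg' := group_SU11 gT.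
have gV : generated_group T g^-1 by exact: generated_V.
have sgV := SU11_V sg'.
have [w [b gE]] := lact_word gV.
have wid : act (@lor R) e w =1 id.
  apply: (act_id Q) => j.
  have [l lE] : exists l, sgb b (e l) = e j.
    by case: (b); [exists (3 - j); rewrite /= (quad_sge Q) subKr|exists j].
  rewrite -lE -gE -(lact_lor _ _ sg') -lactM // SU11_mulV // lact1.
  exact: ig.
have gb u : lact g^-1 u = sgb b u by rewrite gE wid.
have : g^-1 = 1 \/ g^-1 = - 1.
  apply: lact_id => // u; rewrite gb; case: b gb {gE} => //= gb.
  (* [sg] reverses orientation, whereas [lact] preserves [det3]. *)
  exfalso; have := lact_det3 (vec 1 0 0) (vec 0 1 0) (vec 0 0 1) sgV.
  by rewrite !gb /det3 /lor /cross /sg !coE; lra.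
by case=> E; [left|right]; rewrite -[g]invrK E ?invrN invr1.
Qed.

End SideGroup.

(** * Geodesics as planes, and half turns *)

Section Lines.
Variable R : realType.
Local Notation C := R[i].
Local Notation Re := complex.Re.
Local Notation Im := complex.Im.
Implicit Types (p q z : C) (m u x y : vect R).

Definition line m : set C := [set z | closed_disk z /\ lor m (hlift z) = 0].

Lemma chart_neq0 p q : disk p -> closed_disk q -> p <> q -> disk_chart p q != 0.
Proof.
move=> dp dq pq; rewrite /disk_chart mulf_neq0 ?subr_eq0 //; last first.
  by rewrite invr_neq0 // chart_den_neq0.
by apply/eqP => E; apply: pq.
Qed.

Lemma chart_collinear p q z : disk p -> closed_disk q -> closed_disk z -> p <> q ->
  (exists t : R, disk_chart p z = t%:C%C * disk_chart p q) <->
  det3 (hlift p) (hlift q) (hlift z) = 0.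
Proof.
move=> dp dq dz pq; have u0 := chart_neq0 dp dq pq.
have p1 : 1 - sqn p != 0 by rewrite lt0r_neq0 // subr_gt0; apply/diskE.
have D0 : sqn (1 - p^* * q) * sqn (1 - p^* * z) != 0.
  by rewrite mulf_neq0 // sqn_eq0 chart_den_neq0.
have E : det3 (hlift p) (hlift q) (hlift z) = 0 <->
    Im ((disk_chart p q)^* * disk_chart p z) = 0.
  have K (I D a d : R) : D != 0 -> a != 0 -> 4 * (I * D) = a * d -> d = 0 <-> I = 0.
    move=> hD ha H; split=> h; apply/eqP; move/eqP: H; rewrite h ?mulr0 ?mul0r ?mulr0.
      by rewrite !mulf_eq0 (negPf hD) orbF pnatr_eq0.
    by rewrite eq_sym mulf_eq0 (negPf ha).
  exact: K D0 p1 (chart_Im dp dq dz).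
rewrite E; move: u0; move: (disk_chart p q) (disk_chart p z) => u w u0.
split=> [[t ->]|I0]; first by rewrite !ReImE; ring.
have su : sqn u != 0 by rewrite sqn_eq0.
exists (Re (u^* * w) / sqn u).
have uw : u^* * w = (Re (u^* * w))%:C%C by apply: complexP; rewrite ?ReR ?ImR.
have uu : u^* * u = (sqn u)%:C%C by apply: complexP; rewrite !ReImE /sqn; ring.
have uc : u^* != 0 by rewrite conjC_eq0.
apply: (mulfI uc); rewrite mulrCA uu uw.
by apply: complexP; rewrite !ReImE; field.
Qed.

Lemma geodesic_lineE p q : disk p -> disk q -> p <> q ->
  geodesic_line p q = line (cross (hlift p) (hlift q)).
Proof.
move=> dp dq pq; apply/seteqP; split=> z [dz /(chart_collinear dp (disk_closed dq) dz pq) H];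
  by split.
Qed.

Lemma orth2 m x y : lor m m = 1 -> lor m x = 0 -> lor m y = 0 ->
  0 < lor (cross x y) (cross x y) ->
  exists2 k, k != 0 & m = k *: cross x y.
Proof.
move=> m1 mx my N0; have D : det3 x y (cross x y) != 0 by rewrite lt0r_neq0.
have [a [b [c mE]]] := det3_basis m D.
have N1 := cross_l x y; have N2 := cross_r x y.
have [g11 g22] : a *: x + b *: y = 0 /\ c != 0.
  have ax : a * lor x x + b * lor x y = 0.
    by move: mx; rewrite mE !lorDl !lorZl N1 mulr0 addr0 (lorC y).
  have ay : a * lor x y + b * lor y y = 0.
    by move: my; rewrite mE !lorDl !lorZl N2 mulr0 addr0.
  have d : lor x y * lor x y - lor x x * lor y y != 0.
    by move: N0; rewrite lor_cross (lorC y x) => /lt0r_neq0.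
  have a0 : a = 0.
    apply: (mulIf d); rewrite mul0r.
    transitivity (lor x y * (a * lor x y + b * lor y y) -
      lor y y * (a * lor x x + b * lor x y)); first by ring.
    by rewrite ax ay; ring.
  have b0 : b = 0.
    apply: (mulIf d); rewrite mul0r.
    transitivity (lor x y * (a * lor x x + b * lor x y) -
      lor x x * (a * lor x y + b * lor y y)); first by ring.
    by rewrite ax ay; ring.
  split; first by rewrite a0 b0 !scale0r addr0.
  apply/eqP => c0; move: m1; rewrite mE a0 b0 c0 !scale0r !addr0.
  by rewrite /lor /cx /cy /ct /=; lra.
by exists c => //; rewrite mE g11 add0r.
Qed.

Lemma lineZ k m : k != 0 -> line (k *: m) = line m.
Proof.
move=> k0; apply/seteqP; split=> z [dz]; rewrite /line /= lorZl.
  by move=> /eqP; rewrite mulf_eq0 (negPf k0) => /eqP.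
by move=> ->; rewrite mulr0.
Qed.

Lemma line_endpoints m (x y z : C) : lor m m = 1 -> circle x -> circle y -> circle z ->
  lor m (hlift x) = 0 -> lor m (hlift y) = 0 -> lor m (hlift z) = 0 ->
  x <> y -> z = x \/ z = y.
Proof.
move=> m1 cx cy cz mx my mz xy.
have [zx|zx] := pselect (z = x); [by left|].
have [zy|zy] := pselect (z = y); [by right|].
have D : det3 (hlift x) (hlift y) (hlift z) != 0.
  case: (ccw_total cx cy cz xy (nesym zy) (nesym zx)) => [/(ccw_det cx cy cz)/lt0r_neq0//|].
  move=> /(ccw_det cx cz cy); rewrite det3_rot det3C -det3_rot oppr_gt0.
  exact: ltr0_neq0.
have [a [b [c mE]]] := det3_basis m D.
by move: m1; rewrite {2}mE !lorDr !lorZr mx my mz !mulr0 !addr0 => /eqP; rewrite eq_sym oner_eq0.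
Qed.

(** On vectors it is the negative of the reflection along [hlift p], so it exchanges the two ends of
    every geodesic through [p]. *)
Definition half_turn p : 'M[C]_2 :=
  su (Complex 0 (- (1 + sqn p) / (1 - sqn p)))
     (Complex (- 2 * Im p / (1 - sqn p)) (2 * Re p / (1 - sqn p))).

Lemma half_turn_SU11 p : disk p -> SU11 (half_turn p).
Proof.
move=> /diskE dp; apply: su_SU11; rewrite {1 4}/sqn /=.
have p1 : 1 - sqn p != 0 by rewrite lt0r_neq0 // subr_gt0.
by rewrite /sqn /= in p1 *; field.
Qed.

Lemma lact_half_turn p u : disk p ->
  lact (half_turn p) u =
  - u + (2 * lor (hlift p) u / lor (hlift p) (hlift p)) *: hlift p.
Proof.
move=> /diskE dp; have p1 : 1 - sqn p != 0 by rewrite lt0r_neq0 // subr_gt0.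
rewrite hlift_lift /lact /half_turn /su !mx2E /hlift /lor /=.
by apply: vecP; rewrite !coE /=; rewrite /sqn in p1 *; field.
Qed.

End Lines.

(** * Antipodal labels *)

Section Antipodes.
Variable R : realType.
Local Notation C := R[i].
Implicit Types (x y z : C) (j k l p q r : nat).

(** [J] exchanges the two open arcs between [a 1] and [J (a 1)], hence their labels; equal numbers
    on both sides leave [n + 1] as the only possible index. *)
Lemma antipode_index (n : nat) (a : nat -> C) (J : C -> C) : (2 <= n)%N ->
  (forall j k l, (1 <= j)%N -> (j < k)%N -> (k < l)%N -> (l <= 2 * n)%N ->
     ccw (a j) (a k) (a l)) ->
  (forall k, (1 <= k <= 2 * n)%N -> exists2 l, (1 <= l <= 2 * n)%N & J (a k) = a l) ->
  (forall k, (1 <= k <= 2 * n)%N -> J (J (a k)) = a k) ->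
  (forall x y z, ccw x y z -> ccw (J x) (J y) (J z)) ->
  J (a 1) <> a 1 -> J (a 1) = a n.+1.
Proof.
move=> n2 aord Jex JK Jccw J1.
have ainj k l : (1 <= k <= 2 * n)%N -> (1 <= l <= 2 * n)%N -> a k = a l -> k = l.
  move=> kn ln kl; apply/eqP; apply: contraT; rewrite neq_ltn.
  have ne p q : (1 <= p)%N -> (p < q)%N -> (q <= 2 * n)%N -> a p <> a q.
    move=> p1 pq qn.
    have [q2|q2] := ltnP q (2 * n).
      by have [? _ _] := ccw_neq (aord p q (2 * n)%N p1 pq q2 (leqnn _)).
    have [p2|p2] := ltnP 1 p.
      by have [_ ? _] := ccw_neq (aord 1%N p q (leqnn _) p2 pq qn).
    have [_ _ N] := ccw_neq (aord 1%N 2%N (2 * n)%N (leqnn _) (leqnn _) ltac:(lia) (leqnn _)).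
    have p1E : p = 1%N by lia.
    have qE : q = (2 * n)%N by lia.
    by rewrite p1E qE.
  by case/orP=> lt; [case: (ne k l)|case: (ne l k)] => //; lia.
pose ok k := (1 <= k <= 2 * n)%N.
(* The permutation of the indices induced by [J]; the default 0 is not the index of a label. *)
pose f k := if pselect (exists2 l, ok l & J (a k) = a l) is left H
  then s2val (cid2 H) else 0%N.
have fP k : ok k -> ok (f k) /\ J (a k) = a (f k).
  move=> kn; rewrite /f; case: pselect => [H|/(_ (Jex k kn))//].
  by case: (cid2 H).
have fK k : ok k -> f (f k) = k.
  move=> kn; have [fk1 fk2] := fP k kn; have [fk3 fk4] := fP _ fk1.
  by apply: ainj => //; rewrite -fk4 -fk2 JK.
have ok1 : ok 1%N by rewrite /ok; lia.
have [okm JE] := fP _ ok1; set m := f 1%N in okm JE *.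
have m1 : m <> 1%N by move=> E; apply: J1; rewrite JE E.
have fm : f m = 1%N by exact: fK.
have Jm : J (a m) = a 1%N by have [_ ->] := fP m okm; rewrite fm.
have nasym p q r : ok p -> ok q -> ok r -> ccw (a p) (a q) (a r) ->
    (p < r)%N -> (p < q)%N && (q < r)%N.
  move=> okp okq okr H pr.
  have [pq qr _] := ccw_neq H.
  have pq' : p <> q by move=> E; apply: pq; rewrite E.
  have qr' : q <> r by move=> E; apply: qr; rewrite E.
  apply: contraT => N; exfalso; move: okp okq okr; rewrite /ok => okp okq okr.
  apply: (ccw_asym H); case: (ltngtP p q) pq' => // h1 _.
    by apply: aord; lia.
  by apply/ccw_rot; apply: aord; lia.
have up k : (1 < k < m)%N -> (m < f k <= 2 * n)%N.
  move=> km; have okk : ok k by move: okm; rewrite /ok; lia.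
  have [okf fE] := fP k okk.
  have := Jccw _ _ _ (aord 1%N k m (leqnn _) ltac:(lia) ltac:(lia) ltac:(move: okm; rewrite /ok; lia)).
  rewrite JE fE Jm => /ccw_rot/ccw_rot H.
  have H' := ccw_rot H.
  have := ccw_neq H'; move=> [n1 n2' n3].
  have mf : m <> f k by move=> E; apply: n1; rewrite E.
  have f1 : f k <> 1%N by move=> E; apply: n2'; rewrite E.
  have [lt|] := ltnP (f k) m; last by move: okf mf; rewrite /ok; lia.
  exfalso; apply: (ccw_asym H); move: okf okm; rewrite /ok => okf okm'.
  by apply: aord; lia.
have down l : (m < l <= 2 * n)%N -> (1 < f l < m)%N.
  move=> ml; have okl : ok l by rewrite /ok; lia.
  have [okf fE] := fP l okl.
  have m2 : (1 < m)%N by move: okm m1; rewrite /ok; lia.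
  have := Jccw _ _ _ (aord 1%N m l (leqnn _) m2 ltac:(lia) ltac:(lia)).
  rewrite JE fE Jm => /ccw_rot H.
  by apply: nasym => //; apply/ccw_rot/ccw_rot/H.
have finj (s : seq nat) : uniq s -> all ok s -> uniq (map f s).
  move=> us /allP oks; rewrite map_inj_in_uniq // => k l ks ls E.
  by rewrite -(fK k (oks _ ks)) E fK // oks.
have m2 : (1 < m)%N by move: okm m1; rewrite /ok; lia.
have le1 : (m - 2 <= 2 * n - m)%N.
  rewrite -(size_iota 2 (m - 2)) -(size_map f) -[X in (_ <= X)%N](size_iota m.+1).
  apply: uniq_leq_size.
    apply: finj; first exact: iota_uniq.
    by apply/allP => k; rewrite mem_iota /ok; move: okm; rewrite /ok; lia.
  by move=> _ /mapP[k + ->]; rewrite !mem_iota => km; have := up k; lia.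
have le2 : (2 * n - m <= m - 2)%N.
  rewrite -(size_iota m.+1 (2 * n - m)) -(size_map f) -[X in (_ <= X)%N](size_iota 2).
  apply: uniq_leq_size.
    apply: finj; first exact: iota_uniq.
    by apply/allP => k; rewrite mem_iota /ok; move: okm; rewrite /ok; lia.
  by move=> _ /mapP[k + ->]; rewrite !mem_iota => km; have := down k; lia.
by rewrite JE; congr (a _); move: okm; rewrite /ok; lia.
Qed.
End Antipodes.

(** * Metric estimates *)
Section Estimates.
Variable R : realType.
Local Notation C := R[i].
Local Notation Re := complex.Re.
Local Notation Im := complex.Im.
Implicit Types (u w : vect R) (x y z : C).

Lemma timelike_bounds u : timelike u -> exists m M : R,
  [/\ 0 < m, 0 < M & forall x, circle x -> m <= - lor u (hlift x) <= M].
Proof.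
move=> [u0 uu]; pose s := Num.sqrt (cx u ^+ 2 + cy u ^+ 2).
have s0 : 0 <= s by exact: sqrtr_ge0.
have s2 : s ^+ 2 = cx u ^+ 2 + cy u ^+ 2 by rewrite sqr_sqrtr // addr_ge0 ?sqr_ge0.
have su : s < ct u.
  rewrite -(@ltr_pXn2r _ 2) ?nnegrE ?(ltW u0) // s2; move: uu; rewrite /lor; lra.
exists (2 * (ct u - s)), (2 * (ct u + s)); split; [lra|lra|].
move=> x cx'; rewrite hlift_circle // lorZr /lor !coE.
have /circleE x1 := cx'.
set d := cx u * Re x + cy u * Im x.
have ds : d ^+ 2 <= s ^+ 2.
  rewrite s2 -[X in _ <= X]mulr1 -x1 /sqn /d.
  have := sqr_ge0 (cx u * Im x - cy u * Re x); lra.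
have : - s <= d <= s.
  by rewrite -ler_norml -(@ler_pXn2r _ 2) ?nnegrE // real_normK // num_real.
rewrite /d; lra.
Qed.

Lemma lor_lipschitz u x y : circle x -> circle y ->
  (lor u (hlift x) - lor u (hlift y)) ^+ 2 <= 4 * (cx u ^+ 2 + cy u ^+ 2) * sqn (x - y).
Proof.
move=> hx hy; rewrite !hlift_circle // !lorZr /lor !coE /sqn !ReImE.
have := sqr_ge0 (cx u * (Im x - Im y) - cy u * (Re x - Re y)); lra.
Qed.

Lemma sqn_triangle x y z : sqn (x - z) <= 2 * (sqn (x - y) + sqn (y - z)).
Proof.
rewrite /sqn !ReImE.
have := sqr_ge0 (Re x - Re y - (Re y - Re z)).
have := sqr_ge0 (Im x - Im y - (Im y - Im z)); lra.
Qed.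

Lemma sqnB x y : sqn (x - y) = sqn (y - x).
Proof. by rewrite -sqnN opprB. Qed.

Lemma Z4_min (Q : 'Z_4 -> R -> Prop) :
  (forall k r s, Q k r -> 0 < s -> s <= r -> Q k s) ->
  (forall k, exists2 r, 0 < r & Q k r) -> exists2 r, 0 < r & forall k, Q k r.
Proof.
move=> mono ex; have [r0 p0 q0] := ex 0; have [r1 p1 q1] := ex 1.
have [r2 p2 q2] := ex 2; have [r3 p3 q3] := ex 3.
exists (Num.min (Num.min r0 r1) (Num.min r2 r3)); first by rewrite !lt_min p0 p1 p2 p3.
move=> k; case: (Z4P k) => ->; [apply: mono q0 _ _|apply: mono q1 _ _|
  apply: mono q2 _ _|apply: mono q3 _ _]; rewrite ?lt_min ?p0 ?p1 ?p2 ?p3 // !ge_min lexx ?orbT //.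
Qed.

(* Up to normalization, the formula [a * b * c / 4] for the area of a triangle inscribed in
   the unit circle. *)
Lemma det3_circle x y z : circle x -> circle y -> circle z ->
  det3 (hlift x) (hlift y) (hlift z) ^+ 2 = 16 * (sqn (x - y) * sqn (y - z) * sqn (x - z)).
Proof.
move=> hx hy hz.
have G (a b c : vect R) : lor a a = 0 -> lor b b = 0 -> lor c c = 0 ->
    det3 a b c ^+ 2 = - 2 * (lor a b * lor b c * lor a c).
  move=> a0 b0 c0.
  transitivity (- (lor a a * lor b b * lor c c + 2 * (lor a b * lor b c * lor a c)
    - lor a c ^+ 2 * lor b b - lor a b ^+ 2 * lor c c - lor b c ^+ 2 * lor a a)).
    by rewrite /det3 /lor /cross !coE; ring.
  by rewrite a0 b0 c0; ring.
rewrite G ?hlift_null // !lor_hlift.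
move: hx hy hz => /circleE -> /circleE -> /circleE ->; rewrite subrr; ring.
Qed.

Lemma mobius_sub g x y : SU11 g -> closed_disk x -> closed_disk y ->
  sqn (mobius g x - mobius g y) * (sqn (den g x) * sqn (den g y)) = sqn (x - y).
Proof.
move=> sg hx hy; rewrite -!sqnM; congr sqn.
rewrite mulrBl [in X in _ - X](mulrC (den g x)) !mulrA !mobius_den //.
case: sg => _ _; rewrite det_mx2 => d; rewrite -[RHS]mul1r -d /num /den; ring.
Qed.

Lemma int_interval_finite (a b : int) : finite_set [set z : int | a <= z <= b].
Proof.
apply: (@sub_finite_set _ _ ((fun k : nat => a + k%:Z) @` `I_(`|b - a|%N.+1))).
  move=> z /= /andP[az zb]; exists `|z - a|%N; last by rewrite gez0_abs; lia.
  by rewrite /=; lia.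
exact/finite_image/finite_II.
Qed.

(** Coordinates are rounded to a grid of mesh [r]: separated points get distinct cells, and a
    bounded set meets finitely many cells. *)
Lemma grid_finite (S : set (R * R * R * R)) (K r : R) : 0 < r ->
  (forall p, S p -> [/\ `|p.1.1.1| <= K, `|p.1.1.2| <= K, `|p.1.2| <= K & `|p.2| <= K]) ->
  (forall p q, S p -> S q -> `|p.1.1.1 - q.1.1.1| < r -> `|p.1.1.2 - q.1.1.2| < r ->
     `|p.1.2 - q.1.2| < r -> `|p.2 - q.2| < r -> p = q) ->
  finite_set S.
Proof.
move=> r0 bnd sep.
pose f (t : R) : int := Num.floor (t / r).
pose F (p : R * R * R * R) := (f p.1.1.1, f p.1.1.2, f p.1.2, f p.2).
have fr s t : f s = f t -> `|s - t| < r.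
  move=> E; have := floor_itv (s / r); have := floor_itv (t / r).
  rewrite -/(f s) -/(f t) E !ler_pdivlMr // !ltr_pdivrMr // intrD => /andP[a1 a2] /andP[b1 b2].
  by rewrite ltr_norml; apply/andP; split; lra.
have inj : {in S &, injective F}.
  move=> p q /set_mem Sp /set_mem Sq [E1 E2 E3 E4].
  by apply: sep => //; apply: fr.
rewrite -(eq_finite_set (inj_card_eq inj)).
pose I := [set z : int | f (- K) <= z <= f K].
have Ifin : finite_set I by exact: int_interval_finite.
apply: (@sub_finite_set _ _ (I `*` I `*` I `*` I)); last by do 3?apply: finite_setX.
have fI t : `|t| <= K -> I (f t).
  rewrite ler_norml => /andP[h1 h2]; rewrite /I /=.
  by apply/andP; split; apply: le_floor; rewrite ler_pM2r ?invr_gt0.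
by move=> _ [p Sp <-]; have [h1 h2 h3 h4] := bnd p Sp; rewrite /F; do !split; apply: fI.
Qed.

Lemma lact_near1 (u w : vect R) : lor u w < 0 -> exists2 r, 0 < r & forall g : 'M[C]_2,
  `|Re (g 0 0) - 1| <= r -> `|Im (g 0 0)| <= r -> `|Re (g 0 1)| <= r -> `|Im (g 0 1)| <= r ->
  lor u (lact g w) < 0.
Proof.
move=> uw; pose K := (`|cx u| + `|cy u| + `|ct u|) * (`|cx w| + `|cy w| + `|ct w|) + 1.
have K0 : 0 < K by rewrite /K ltr_wpDl // mulr_ge0 // !addr_ge0.
(* Every entry of [lact g] is within [6 * r] of that of the identity; the factor 20 leaves room for
   strictness. *)
pose r := Num.min 1 (- lor u w / (20 * K)).
have r0 : 0 < r by rewrite lt_min ltr01 divr_gt0 ?oppr_gt0 ?mulr_gt0.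
have r1 : r <= 1 by rewrite ge_min lexx.
have rK : r * (20 * K) <= - lor u w.
  by rewrite -ler_pdivlMr ?mulr_gt0 // ge_min lexx orbT.
exists r => // g; set p := Re (g 0 0) - 1; set q := Im (g 0 0).
set s := Re (g 0 1); set t := Im (g 0 1) => hp hq hs ht.
have B (x y : R) : `|x| <= r -> `|y| <= r -> - r <= x * y <= r.
  move=> hx hy; rewrite -ler_norml normrM; apply: (@le_trans _ _ (r * r)); first by apply: ler_pM.
  by rewrite ler_piMl // ltW.
have /andP[p1 p2] : - r <= p <= r by rewrite -ler_norml.
have /andP[q1 q2] : - r <= q <= r by rewrite -ler_norml.
have /andP[s1 s2] : - r <= s <= r by rewrite -ler_norml.
have /andP[t1 t2] : - r <= t <= r by rewrite -ler_norml.
have /andP[pp1 pp2] := B p p hp hp; have /andP[qq1 qq2] := B q q hq hq.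
have /andP[ss1 ss2] := B s s hs hs; have /andP[tt1 tt2] := B t t ht ht.
have /andP[pq1 pq2] := B p q hp hq; have /andP[ps1 ps2] := B p s hp hs.
have /andP[pt1 pt2] := B p t hp ht; have /andP[qs1 qs2] := B q s hq hs.
have /andP[qt1 qt2] := B q t hq ht; have /andP[st1 st2] := B s t hs ht.
have N (x m y : R) : - (6 * r) <= m <= 6 * r -> x * m * y <= 6 * r * (`|x| * `|y|).
  rewrite -ler_norml => hm; apply: le_trans (ler_norm _) _.
  rewrite !normrM mulrAC [X in X <= _]mulrC.
  exact: ler_wpM2r (mulr_ge0 (normr_ge0 x) (normr_ge0 y)) _ _ hm.
have E : lor u (lact g w) = lor u w
   + cx u * (2 * p + p * p - q * q + s * s - t * t) * cx w
   + cx u * (2 * (s * t - q - p * q)) * cy w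
   + cx u * (2 * (s + p * s - q * t)) * ct w
   + cy u * (2 * (q + p * q + s * t)) * cx w
   + cy u * (2 * p + p * p - q * q - s * s + t * t) * cy w
   + cy u * (2 * (t + p * t + q * s)) * ct w
   + ct u * (- (2 * (s + p * s + q * t))) * cx w
   + ct u * (- (2 * (t + p * t - q * s))) * cy w
   + ct u * (- (2 * p + p * p + q * q + s * s + t * t)) * ct w.
  have a1E : Re (g 0 0) = 1 + p by rewrite /p; ring.
  by rewrite /lact /lor !coE -/s -/t -/q a1E; ring.
rewrite E.
have := N (cx u) (2 * p + p * p - q * q + s * s - t * t) (cx w) ltac:(lra).
have := N (cx u) (2 * (s * t - q - p * q)) (cy w) ltac:(lra).
have := N (cx u) (2 * (s + p * s - q * t)) (ct w) ltac:(lra).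
have := N (cy u) (2 * (q + p * q + s * t)) (cx w) ltac:(lra).
have := N (cy u) (2 * p + p * p - q * q - s * s + t * t) (cy w) ltac:(lra).
have := N (cy u) (2 * (t + p * t + q * s)) (ct w) ltac:(lra).
have := N (ct u) (- (2 * (s + p * s + q * t))) (cx w) ltac:(lra).
have := N (ct u) (- (2 * (t + p * t - q * s))) (cy w) ltac:(lra).
have := N (ct u) (- (2 * p + p * p + q * q + s * s + t * t)) (ct w) ltac:(lra).
have : r * (20 * K) = 20 * r * (`|cx u| * `|cx w|) + 20 * r * (`|cx u| * `|cy w|)
  + 20 * r * (`|cx u| * `|ct w|) + 20 * r * (`|cy u| * `|cx w|)
  + 20 * r * (`|cy u| * `|cy w|) + 20 * r * (`|cy u| * `|ct w|)
  + 20 * r * (`|ct u| * `|cx w|) + 20 * r * (`|ct u| * `|cy w|)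
  + 20 * r * (`|ct u| * `|ct w|) + 20 * r by rewrite /K; ring.
have P (x y : R) : 0 <= r * (`|x| * `|y|) by rewrite !mulr_ge0 // ltW.
have := P (cx u) (cx w); have := P (cx u) (cy w); have := P (cx u) (ct w).
have := P (cy u) (cx w); have := P (cy u) (cy w); have := P (cy u) (ct w).
have := P (ct u) (cx w); have := P (ct u) (cy w); have := P (ct u) (ct w).
move: rK r0 {E N P B}; lra.
Qed.

Lemma lor_near u p (eta : R) : circle p -> 0 < eta -> exists2 r, 0 < r & forall x, circle x ->
  sqn (x - p) <= r -> `|lor u (hlift x) - lor u (hlift p)| <= eta.
Proof.
move=> cp eta0; pose K := 4 * (cx u ^+ 2 + cy u ^+ 2) + 1.
have K0 : 0 < K by rewrite /K; have := sqr_ge0 (cx u); have := sqr_ge0 (cy u); lra.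
exists (eta ^+ 2 / K); first by rewrite divr_gt0 ?exprn_gt0.
move=> x hx; rewrite ler_pdivlMr // => h.
rewrite -(@ler_pXn2r _ 2) ?nnegrE ?normr_ge0 ?(ltW eta0) // real_normK ?num_real //.
apply: le_trans (lor_lipschitz u hx cp) _; apply: le_trans h.
by rewrite mulrC ler_wpM2l ?sqn_ge0 // /K; lra.
Qed.

(** The lower bound is the upper bound for the inverse, whose denominator at the image point is the
    reciprocal. *)
Lemma den_bounds (g : 'M[C]_2) : SU11 g -> exists2 K, 0 < K & forall x, circle x ->
  sqn (den g x) <= K /\ 1 <= K * sqn (den g x).
Proof.
move=> sg; have sV := SU11_V sg; have d := SU11_sqn sg.
pose K := 2 * (sqn (g 0 0) + sqn (g 0 1)) + 1.
have K0 : 0 < K by rewrite /K; have := sqn_ge0 (g 0 0); have := sqn_ge0 (g 0 1); lra.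
have up h x : circle x -> sqn (den h x) <= 2 * (sqn (h 1 0) + sqn (h 1 1)).
  move=> /circleE x1; have -> : den h x = h 1 0 * x - (- h 1 1 - 0) by rewrite subr0 opprK.
  apply: le_trans (sqn_triangle _ 0 _) _; rewrite subr0 sqnM x1 mulr1.
  by rewrite !sub0r subr0 opprK.
have [g10 g11 _] := sg.
exists K => // x hx; have xd := circle_closed hx.
have cgx := mobius_circle sg hx.
split; first by apply: le_trans (up g x hx) _; rewrite g10 g11 !sqnJ /K; lra.
have : den g^-1 (mobius g x) * den g x = 1.
  by rewrite -denM // SU11_mulVr // /den !mx21E mul0r add0r.
move/(congr1 (@sqn R)); rewrite sqnM => E.
have -> : 1 = sqn (den g^-1 (mobius g x)) * sqn (den g x).
  by rewrite E /sqn !ReImE; ring.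
rewrite ler_wpM2r ?sqn_ge0 //; apply: le_trans (up _ _ cgx) _.
by rewrite SU11_inv // /su !mx2E !sqnJ !sqnN ?sqnJ /K; lra.
Qed.

Lemma mobius_lipschitz (g : 'M[C]_2) : SU11 g -> exists2 K, 0 < K & forall x y,
  circle x -> circle y ->
  sqn (mobius g x - mobius g y) <= K * sqn (x - y) /\
  sqn (x - y) <= K * sqn (mobius g x - mobius g y).
Proof.
move=> sg; have [K K0 H] := den_bounds sg; exists (K * K); first exact: mulr_gt0.
move=> x y hx hy; have [x1 x2] := H x hx; have [y1 y2] := H y hy.
rewrite -(mobius_sub sg (circle_closed hx) (circle_closed hy)).
move: (sqn (_ - _)) (sqn_ge0 (mobius g x - mobius g y)) => s s0.
split; last by rewrite mulrC ler_wpM2r // ler_pM ?sqn_ge0.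
rewrite mulrCA ler_peMr //.
have -> : K * K * (sqn (den g x) * sqn (den g y)) = (K * sqn (den g x)) * (K * sqn (den g y)).
  ring.
by rewrite -[1]mulr1 ler_pM.
Qed.

End Estimates.

(** * Endpoints of the geodesics through the vertices *)
Section Labels.
Variable R : realType.
Local Notation C := R[i].
Variables (v : 'Z_4 -> C) (T : 'Z_4 -> 'M[C]_2) (n : 'Z_4 -> nat) (a : 'Z_4 -> nat -> C).
Variable e : 'Z_4 -> vect R.
Let P i := hlift (v i).
Hypothesis Q : quadrilateral P e.
Hypothesis dv : forall i, disk (v i).
Hypothesis hT : side_rotations v T.
Hypothesis ha : vertex_labels v T n a.
Implicit Types (x y z : C) (m u : vect R) (i j k : 'Z_4).

Let sG g := @group_SU11 R v T hT g.

Lemma unit_orth2 m m' x y : disk x -> disk y -> x <> y -> lor m m = 1 -> lor m' m' = 1 ->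
  lor m (hlift x) = 0 -> lor m (hlift y) = 0 ->
  lor m' (hlift x) = 0 -> lor m' (hlift y) = 0 -> m = m' \/ m = - m'.
Proof.
move=> dx dy xy m1 m1' mx my mx' my'; have N0 := cross_hlift_gt0 dx dy xy.
have [c c0 mE] := orth2 m1 mx my N0; have [c' c0' mE'] := orth2 m1' mx' my' N0.
have E : c ^+ 2 == c' ^+ 2.
  apply/eqP/(mulIf (lt0r_neq0 N0)).
  move: m1 m1'; rewrite mE mE' !lorZl !lorZr => m1 m1'.
  by rewrite !expr2 -!mulrA m1 m1'.
by move: E; rewrite eqf_sqr mE mE' => /orP[]/eqP ->; [left|right; rewrite scaleNr].
Qed.

Lemma lor_mobius g m x : SU11 g -> closed_disk x ->
  lor (lact g m) (hlift (mobius g x)) = 0 <-> lor m (hlift x) = 0.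
Proof.
move=> sg dx; have d0 := den_neq0 sg dx; rewrite -sqn_eq0 in d0.
have := lact_lor m (hlift x) sg; rewrite hlift_mobius // lorZr => <-.
by split=> [->|/eqP]; rewrite ?mulr0 // mulf_eq0 (negPf d0) => /eqP.
Qed.

(** The image of a side determines its line, whose unit normal is a root up to sign. From here on
    labels are ends of mirrors through a vertex. *)
Lemma vertex_geodesicsP k G : vertex_geodesics v T k G <->
  exists m, [/\ root e m, lor m (P k) = 0 & G = line m].
Proof.
split=> [[[p [q [dp dq pq GE]]] Gk [g [j [gT gG]]]]|[m [rm mk ->]]].
- have sg := sG gT; have N0 := cross_hlift_gt0 dp dq pq.
  pose m := nrm (cross (hlift p) (hlift q)); have m1 : lor m m = 1 := nrm_unit N0.
  have Gm : G = line m.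
    by rewrite GE geodesic_lineE // /m /nrm lineZ // invr_neq0 // lt0r_neq0 // sqrtr_gt0.
  have on (l : 'Z_4) : side v j (v l) -> lor m (hlift (mobius g (v l))) = 0.
    by move=> sl; have : G (mobius g (v l)) by [apply: gG; exists (v l)]; rewrite Gm => -[].
  have h0 : lor m (hlift (mobius g (v j))) = 0.
    apply: on; split; first exact: dv.
    by exists 0; rewrite lexx ler01 mul0r /disk_chart subrr mul0r.
  have h1 : lor m (hlift (mobius g (v (j + 1)))) = 0.
    apply: on; split; first exact: dv.
    by exists 1; rewrite lexx ler01 mul1r.
  have dj i : closed_disk (v i) by exact: disk_closed.
  have N : mobius g (v j) <> mobius g (v (j + 1)).
    by move/(mobius_inj sg (dj _) (dj _)); apply: (vertex_neq Q).
  have e1 : lor (lact g (e j)) (lact g (e j)) = 1 by rewrite lact_lor // (quad_unit Q).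
  have e2 : lor (lact g (e j)) (hlift (mobius g (v j))) = 0.
    by apply/lor_mobius => //; exact: (eP0 Q).
  have e3 : lor (lact g (e j)) (hlift (mobius g (v (j + 1)))) = 0.
    by apply/lor_mobius => //; exact: (eP1 Q).
  have [mE|mE] := unit_orth2 (mobius_disk sg (dv j)) (mobius_disk sg (dv (j + 1)))
    N m1 e1 h0 h1 e2 e3.
  + exists m; split => //; last by move: Gk; rewrite Gm => -[].
    by apply/(rootP Q dv hT); exists g, j; split => //; left.
  + exists m; split => //; last by move: Gk; rewrite Gm => -[].
    by apply/(rootP Q dv hT); exists g, j; split => //; right.
- have /(rootP Q dv hT)[g [j [gT mE]]] := rm; have sg := sG gT.
  have m1 := root_unit Q dv hT rm.
  have dj i : closed_disk (v i) by exact: disk_closed.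
  have lm (x : vect R) : lor m x = 0 <-> lor (lact g (e j)) x = 0.
    case: mE => ->; rewrite ?lorNl //; split=> [/eqP|->]; last by rewrite oppr0.
    by rewrite oppr_eq0 => /eqP.
  split.
  + have N : mobius g (v j) <> mobius g (v (j + 1)).
      by move/(mobius_inj sg (dj _) (dj _)); apply: (vertex_neq Q).
    exists (mobius g (v j)), (mobius g (v (j + 1))).
    have d0 := mobius_disk sg (dv j); have d1 := mobius_disk sg (dv (j + 1)).
    split => //; rewrite geodesic_lineE //.
    have e2 : lor m (hlift (mobius g (v j))) = 0.
      by apply/lm/lor_mobius => //; exact: (eP0 Q).
    have e3 : lor m (hlift (mobius g (v (j + 1)))) = 0.
      by apply/lm/lor_mobius => //; exact: (eP1 Q).
    have [c c0 ->] := orth2 m1 e2 e3 (cross_hlift_gt0 d0 d1 N).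
    by rewrite lineZ.
  + by split.
  + exists g, j; split => // _ [z [dz [t [_ ct]]] <-].
    have dz' := disk_closed dz; split; first exact: mobius_closed.
    apply/lm/lor_mobius => //.
    have [c _ ->] := quad_normal Q j; rewrite lorZl.
    rewrite [lor _ _](_ : _ = 0) ?mulr0 //.
    by apply/(chart_collinear (dv j) (dj _) dz' (@vertex_neq _ _ _ Q j)); exists t.
Qed.

Definition ends k : set C :=
  [set x | circle x /\ exists m, [/\ root e m, lor m (P k) = 0 & lor m (hlift x) = 0]].

Lemma endsP k x : ends k x <-> exists l, (1 <= l <= 2 * n k)%N /\ x = a k l.
Proof.
have [_ E _ _] := ha k; split=> [[cx [m [rm mk mx]]]|[l [ln xE]]].
  have : [set x | exists2 l, (1 <= l <= 2 * n k)%N & x = a k l] x.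
    rewrite E; split => //; exists (line m); last by split => //; exact: circle_closed.
    by apply/vertex_geodesicsP; exists m.
  by case=> l; exists l.
have : [set x | exists2 l, (1 <= l <= 2 * n k)%N & x = a k l] x by exists l.
rewrite E => -[cx [G /vertex_geodesicsP[m [rm mk ->]] [_ mx]]].
by split => //; exists m.
Qed.

Lemma label_setP x : label_set n a x <-> exists k, ends k x.
Proof.
split=> [[k [l [ln xE]]]|[k /endsP[l H]]]; last by exists k, l.
by exists k; apply/endsP; exists l.
Qed.

Lemma n_gt0 k : (0 < n k)%N.
Proof.
rewrite lt0n; apply/eqP => n0; have [+ _ _ _] := ha k; rewrite n0 II0 card_eq0 => /eqP E.
have : vertex_geodesics v T k (line (e k)).
  by apply/vertex_geodesicsP; exists (e k); split; [exact: root_e|exact: (eP0 Q)|].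
by rewrite E.
Qed.

(* The endpoint of the side line [i] lying beyond [v i]. *)
Definition sE i : C := a (i + 1) 1%N.

Lemma ends_circle k x : ends k x -> circle x. Proof. by case. Qed.

Lemma label_ends k l : (1 <= l <= 2 * n k)%N -> ends k (a k l).
Proof. by move=> ln; apply/endsP; exists l. Qed.

Lemma label1_ends k : ends k (a k 1%N).
Proof. by apply: label_ends; have := n_gt0 k; lia. Qed.

Lemma sE_circle i : circle (sE i). Proof. exact: ends_circle (label1_ends _). Qed.

Let cs i := sE_circle i.

Lemma sE_side i : lor (e i) (hlift (sE i)) = 0 /\ lor (e (i + 1)) (hlift (sE i)) < 0.
Proof.
have [_ _ _] := ha (i + 1); rewrite addrK => -[dx [t [t0 tE]]]; rewrite -/(sE i) in dx tE.
have d1 := dv (i + 1); have cl j := disk_closed (dv j).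
have N : v (i + 1) <> v i by apply/nesym/(vertex_neq Q).
have t1 : 0 < t.
  rewrite lt_def t0 andbT; apply/eqP => t00; move: tE; rewrite t00 mul0r => /eqP.
  apply/negP/chart_neq0 => // E; move: (cs i) d1; rewrite -E => /circleE E1 /diskE.
  by rewrite E1 ltxx.
split.
  have [k _ ->] := quad_normal Q i; rewrite lorZl [lor _ _](_ : _ = 0) ?mulr0 //.
  rewrite -[lor _ _]/(det3 _ _ _) det3C; apply/eqP; rewrite oppr_eq0; apply/eqP.
  by apply/(chart_collinear d1 (cl i) dx N); exists t.
have [k k0 ->] := quad_normal Q (i + 1); rewrite lorZl mulNr oppr_lt0 mulr_gt0 //.
have p1 : 0 < 1 - sqn (v (i + 1)) by rewrite subr_gt0; apply/diskE.
have D z : closed_disk z -> 0 < sqn (1 - (v (i + 1))^* * z).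
  by move=> dz; rewrite sqn_gt0 chart_den_neq0.
have S z : closed_disk z -> 0 < lor (cross (P (i + 1)) (P (i + 1 + 1))) (hlift z) <->
    0 < complex.Im ((disk_chart (v (i + 1)) (v (i + 1 + 1)))^* * disk_chart (v (i + 1)) z).
  move=> dz; rewrite -[lor _ _]/(det3 _ _ _) -(pmulr_rgt0 _ p1) -(chart_Im d1 (cl _) dz).
  by rewrite pmulr_rgt0 // pmulr_lgt0 // mulr_gt0 // D.
have i4 : i + 1 + 3 = i by rewrite Z4A.
apply/S => //; have := eP3 Q (i + 1); rewrite i4; have [k' k0' ->] := quad_normal Q (i + 1).
rewrite lorZl mulNr oppr_lt0 pmulr_rgt0 // => /(S _ (cl _)).
move=> H; rewrite tE mulrCA ImM ReR ImR mul0r addr0.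
by rewrite mulr_gt0.
Qed.

Definition antipode k : 'M[C]_2 := half_turn (v k).
(** The end of the side line [i] beyond [v (i + 1)]. By [tE_next] the half turn about [v (i + 1)]
    gives the same point; half turns are used because they permute the labels at their vertex. *)
Definition tE i : C := mobius (antipode i) (sE i).

Let sJ k : SU11 (antipode k) := half_turn_SU11 (dv k).

Lemma antipode_lor k m x : circle x -> lor m (P k) = 0 -> exists2 c, 0 < c &
  c * lor m (hlift (mobius (antipode k) x)) = - lor m (hlift x).
Proof.
move=> cx mk; have dx := circle_closed cx.
exists (sqn (den (antipode k) x)); first by rewrite sqn_gt0 den_neq0.
rewrite -lorZr -hlift_mobius // lact_half_turn // lorDr lorNr lorZr mk; lra.
Qed.

Lemma antipode_circle k x : circle x -> circle (mobius (antipode k) x).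
Proof. exact: mobius_circle. Qed.

Lemma antipodeK k x : circle x -> mobius (antipode k) (mobius (antipode k) x) = x.
Proof.
move=> /circle_closed dx; rewrite -mobiusM //.
have [_ Pk] := quad_timelike Q k.
have [] : antipode k * antipode k = 1 \/ antipode k * antipode k = - 1; last 2 first.
- by move=> ->; rewrite mobius1.
- by move=> ->; rewrite mobiusN mobius1.
apply: lact_id; first exact: SU11_M.
move=> u; rewrite lactM // lact_half_turn // lact_half_turn // lorDr lorNr lorZr.
rewrite opprD opprK -addrA -scaleNr -scalerDl [X in X *: _](_ : _ = 0) ?scale0r ?addr0 //.
by field; exact: ltr0_neq0.
Qed.

Lemma antipode_neq k x : circle x -> mobius (antipode k) x <> x.
Proof.
move=> cx E; have dx := circle_closed cx; have T1 := quad_timelike Q k.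
have H := hlift_mobius (sJ k) dx; rewrite E lact_half_turn // in H.
have l1 := timelike_lor T1 (hlift_causal x); have [_ l2] := T1.
have d0 : 0 < sqn (den (antipode k) x) by rewrite sqn_gt0 den_neq0.
have := congr1 (lor (hlift x)) H; rewrite lorDr lorNr !lorZr hlift_null // mulr0 oppr0 add0r.
rewrite (lorC (hlift x)) => /eqP; apply/negP.
by rewrite !mulf_neq0 ?invr_neq0 ?pnatr_eq0 // ltr0_neq0.
Qed.

Lemma antipode_ends k x : ends k x -> ends k (mobius (antipode k) x).
Proof.
move=> [cx [m [rm mk mx]]]; split; first exact: antipode_circle.
exists m; split => //; have [c c0] := antipode_lor cx mk.
by rewrite mx oppr0 => /eqP; rewrite mulf_eq0 gt_eqF //= => /eqP.
Qed.

Lemma tE_circle i : circle (tE i). Proof. exact/antipode_circle/cs. Qed.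
Let ct' i := tE_circle i.

Lemma side_endpoints i x : circle x -> lor (e i) (hlift x) = 0 -> x = sE i \/ x = tE i.
Proof.
move=> cx ex; have [s0 _] := sE_side i.
have t0 : lor (e i) (hlift (tE i)) = 0.
  have [c c0] := antipode_lor (cs i) (eP0 Q i).
  by rewrite s0 oppr0 => /eqP; rewrite mulf_eq0 gt_eqF //= => /eqP.
apply: (line_endpoints (quad_unit Q i) (cs i) (ct' i) cx s0 t0 ex).
exact/nesym/antipode_neq.
Qed.

Lemma tE_next i : tE i = mobius (antipode (i + 1)) (sE i).
Proof.
have [s0 _] := sE_side i; have [c c0] := antipode_lor (cs i) (eP1 Q i).
rewrite s0 oppr0 => /eqP; rewrite mulf_eq0 gt_eqF //= => /eqP t0.
have ca := antipode_circle (i + 1) (cs i).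
by case: (side_endpoints ca t0) => // E; case: (antipode_neq (cs i) E).
Qed.

Lemma sE_sides i : [/\ lor (e i) (hlift (sE i)) = 0, lor (e (i + 1)) (hlift (sE i)) < 0,
  lor (e (i + 2)) (hlift (sE i)) < 0 & 0 < lor (e (i + 3)) (hlift (sE i))] /\
  [/\ lor (e i) (hlift (tE i)) = 0, 0 < lor (e (i + 1)) (hlift (tE i)),
  lor (e (i + 2)) (hlift (tE i)) < 0 & lor (e (i + 3)) (hlift (tE i)) < 0].
Proof.
have [s0 s1] := sE_side i.
have opp j x (cx : circle x) := @opposite _ _ _ Q j (hlift x) (hlift_causal x).
have s2 : lor (e (i + 2)) (hlift (sE i)) < 0 by apply: opp => //; rewrite s0.
have t0 : lor (e i) (hlift (tE i)) = 0.
  have [c c0] := antipode_lor (cs i) (eP0 Q i).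
  by rewrite s0 oppr0 => /eqP; rewrite mulf_eq0 gt_eqF //= => /eqP.
have t2 : lor (e (i + 2)) (hlift (tE i)) < 0 by apply: opp => //; rewrite t0.
have t1 : 0 < lor (e (i + 1)) (hlift (tE i)).
  have [c c0 E] := antipode_lor (cs i) (eP0 Q (i + 1)).
  by rewrite tE_next -(pmulr_rgt0 _ c0) E oppr_gt0.
have t3 : lor (e (i + 3)) (hlift (tE i)) < 0.
  by have := opp (i + 1) _ (ct' i) (ltW t1); rewrite Z4A.
split; split => //.
have e3 : lor (e (i + 3)) (P i) = 0 by have := eP1 Q (i + 3); rewrite Z4A.
have [c c0 E] := antipode_lor (cs i) e3.
by rewrite -oppr_lt0 -E pmulr_rlt0.
Qed.

(** Turns the sign of [e i] at a point of the circle into its cyclic position relative to the two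
    ends of the side line. *)
Lemma side_det i : exists2 k, 0 < k & forall u,
  det3 (hlift (sE i)) u (hlift (tE i)) = k * lor (e i) u.
Proof.
have [[s0 s1 s2 s3] _] := sE_sides i.
have [p [q [r sEq]]] := basis Q i (hlift (sE i)).
have r0 : r = 0.
  move: s0; rewrite sEq !lorDr !lorZr (eP0 Q) (eP1 Q) !mulr0 !add0r => /eqP.
  by rewrite mulf_eq0 (negPf (ltr0_neq0 (eP2 Q i))) orbF => /eqP.
have q0 : q < 0.
  move: s3; rewrite sEq r0 scale0r addr0 !lorDr !lorZr.
  have := eP2 Q (i + 3); have := eP1 Q (i + 3); rewrite !Z4A => -> h.
  by rewrite mulr0 add0r nmulr_lgt0.
have [k k0 eE] := quad_normal Q i.
have T1 := quad_timelike Q i; have [_ l2] := T1.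
have l1 := timelike_lor T1 (hlift_causal (sE i)).
pose c := 2 * lor (P i) (hlift (sE i)) / lor (P i) (P i).
have c0 : 0 < c by rewrite /c -mulrA mulr_gt0 // nmulr_lgt0 // invr_lt0.
have d0 : 0 < sqn (den (antipode i) (sE i)).
  by rewrite sqn_gt0 den_neq0 //; exact: circle_closed.
have tEq : sqn (den (antipode i) (sE i)) *: hlift (tE i) = - hlift (sE i) + c *: P i.
  by rewrite -hlift_mobius // ?lact_half_turn //; exact: circle_closed.
exists (c * - q / k / sqn (den (antipode i) (sE i))).
  by rewrite !divr_gt0 // mulr_gt0 // oppr_gt0.
move=> u; apply: (mulfI (lt0r_neq0 d0)).
have -> : sqn (den (antipode i) (sE i)) * det3 (hlift (sE i)) u (hlift (tE i)) =
   det3 (hlift (sE i)) u (sqn (den (antipode i) (sE i)) *: hlift (tE i)).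
  by rewrite /det3 lorZr.
rewrite tEq eE sEq r0 scale0r addr0 lorZl.
have -> : det3 (p *: P i + q *: P (i + 1)) u (- (p *: P i + q *: P (i + 1)) + c *: P i) =
   c * q * lor (cross (P i) (P (i + 1))) u.
  by rewrite /det3 /cross /lor !coE; ring.
by field; rewrite !lt0r_neq0.
Qed.

Lemma side_gt0 i x : circle x -> 0 < lor (e i) (hlift x) <-> ccw (sE i) x (tE i).
Proof.
move=> cx; have [k k0 E] := side_det i; rewrite ccw_det ?E ?pmulr_rgt0 //; exact: ct'.
Qed.
Lemma side_lt0 i x : circle x -> lor (e i) (hlift x) < 0 <-> ccw (sE i) (tE i) x.
Proof.
move=> cx; have [k k0 E] := side_det i.
have H : det3 (hlift (sE i)) (hlift (tE i)) (hlift x) =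
    - det3 (hlift (sE i)) (hlift x) (hlift (tE i)).
  by rewrite /det3 /cross /lor !coE; ring.
by rewrite ccw_det ?H ?E ?oppr_gt0 ?pmulr_rlt0 //; exact: ct'.
Qed.

Lemma label_one i : a i 1%N = sE (i + 3).
Proof. by rewrite /sE Z4A. Qed.

Lemma sE_ends i : ends i (sE i).
Proof.
split=> //; exists (e i); have [[s0 _ _ _] _] := sE_sides i.
by split => //; [exact: root_e|exact: (eP0 Q)].
Qed.
Lemma tE_ends i : ends i (tE i).
Proof. exact/antipode_ends/sE_ends. Qed.

Lemma corner_points i : [/\ sE i <> sE (i + 3), tE i <> sE (i + 3) & tE (i + 3) <> sE (i + 3)].
Proof.
have [[_ _ _ h1] [_ _ _ h2]] := sE_sides i; have [[h3 _ _ _] _] := sE_sides (i + 3).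
split=> E; [move: h1|move: h2|exact: (antipode_neq (cs (i + 3)) E)];
  by rewrite E h3 ltxx.
Qed.

Lemma tE_prev i : tE (i + 3) = mobius (antipode i) (sE (i + 3)).
Proof. by have := tE_next (i + 3); rewrite Z4A. Qed.

Lemma sE_prev_ends i : ends i (sE (i + 3)).
Proof. by rewrite -label_one; exact: label1_ends. Qed.
Lemma tE_prev_ends i : ends i (tE (i + 3)).
Proof. rewrite tE_prev; exact/antipode_ends/sE_prev_ends. Qed.

(** [sE k], [tE k] and [tE (k + 3)] are distinct labels different from the first, so there are at
    least four. *)
Lemma n_ge2 k : (2 <= n k)%N.
Proof.
have [h1 h2 h4] := corner_points k.
have h3 : tE k <> sE k := @antipode_neq k _ (cs k).
have [[_ _ _ g1] [_ _ _ g2]] := sE_sides k; have [_ [g3 _ _ _]] := sE_sides (k + 3).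
have [l1 [n1 E1]] := (endsP k _).1 (sE_ends k); have [l2 [n2 E2]] := (endsP k _).1 (tE_ends k).
have [l3 [n3 E3]] := (endsP k _).1 (tE_prev_ends k).
have E0 := label_one k.
have d1 : l1 <> 1%N by move=> E; apply: h1; rewrite E1 E E0.
have d2 : l2 <> 1%N by move=> E; apply: h2; rewrite E2 E E0.
have d3 : l3 <> 1%N by move=> E; apply: h4; rewrite E3 E E0.
have d4 : l1 <> l2 by move=> E; apply: h3; rewrite E1 E2 E.
have d5 : l1 <> l3 by move=> E; move: g1; rewrite E1 E -E3 g3 ltxx.
have d6 : l2 <> l3 by move=> E; move: g2; rewrite E2 E -E3 g3 ltxx.
lia.
Qed.

Lemma label_order k (p q r : nat) : (1 <= p)%N -> (p < q)%N -> (q < r)%N ->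
  (r <= 2 * n k)%N -> ccw (a k p) (a k q) (a k r).
Proof. by have [_ _ H _] := ha k; exact: H. Qed.

Lemma label_half k : a k (n k).+1 = tE (k + 3).
Proof.
rewrite tE_prev -label_one; apply/esym.
have J l : (1 <= l <= 2 * n k)%N -> circle (a k l) by move=> /label_ends/ends_circle.
apply: (@antipode_index _ (n k) (a k) (mobius (antipode k))).
- exact: n_ge2.
- exact: (@label_order k).
- by move=> l /label_ends/antipode_ends/endsP[l' [? ?]]; exists l'.
- by move=> l /J; exact: antipodeK.
- by move=> x y z; exact: ccw_mobius.
- by apply: antipode_neq; apply: J; have := n_gt0 k; lia.
Qed.

(** A later label would be the end of a mirror through [v k] in the sector of the quadrilateral at
    this vertex, against [root_vertex]. *)
Lemma label_last k : a k (2 * n k)%N = tE k.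
Proof.
have [l [ln lE]] := (endsP k _).1 (tE_ends k).
have [h1 h2 h3] := corner_points k; have n2 := n_ge2 k.
have l1 : l <> 1%N by move=> E; apply: h2; rewrite lE E label_one.
have [E|l2] := pselect (l = 2 * n k)%N; first by rewrite lE E.
exfalso.
have : ccw (sE (k + 3)) (tE k) (a k (2 * n k)%N).
  by rewrite -label_one lE; apply: label_order; lia.
have [cx [m [rm mk mx]]] : ends k (a k (2 * n k)%N) by apply: label_ends; lia.
move: (a k _) cx mx => x cx mx H.
have [_ [t0 t1 t2 t3]] := sE_sides k; have [[s0 s1 s2 s3] _] := sE_sides (k + 3).
rewrite !Z4A in s1.
apply: (root_vertex Q rm mk mx).
  apply/side_lt0 => //; move/side_lt0: s1 => /(_ (cs _)) H1.
  exact/ccw_rot/ccw_rot/(ccw_trans (ccw_rot H) (ccw_rot H1)).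
apply/side_lt0 => //; move/side_lt0: t3 => /(_ (ct' _)) H1.
exact: ccw_trans H1 H.
Qed.

(** The half turn about [v k] carries the arc between the last label and the first, which is free of
    labels, to the arc between [sE k] and label [n k + 1]. *)
Lemma label_mid k : a k (n k) = sE k.
Proof.
have n2 := n_ge2 k.
have [l [ln lE]] := (endsP k _).1 (sE_ends k).
have [[s0 s1 s2 s3] _] := sE_sides k.
have H : ccw (a k 1%N) (a k l) (a k (n k).+1).
  by rewrite label_one -lE label_half; apply/side_gt0.
have [d1 d2 _] := ccw_neq H.
have l1 : l <> 1%N by move=> E; apply: d1; rewrite E.
have l2 : l <> (n k).+1 by move=> E; apply: d2; rewrite E.
have l3 : (l < (n k).+1)%N.
  rewrite ltnNge; apply/negP => h; apply: (ccw_asym H); apply: label_order; lia.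
have [E|l4] := pselect (l = n k); first by rewrite lE E.
exfalso; have H1 : ccw (a k l) (a k (n k)) (a k (n k).+1) by apply: label_order; lia.
have := ccw_mobius (sJ k) H1.
have cl (j : nat) : (1 <= j <= 2 * n k)%N -> circle (a k j) by move=> /label_ends/ends_circle.
have -> : mobius (antipode k) (a k l) = a k (2 * n k)%N by rewrite label_last -lE.
have -> : mobius (antipode k) (a k (n k).+1) = a k 1%N.
  by rewrite label_half tE_prev antipodeK // label_one.
have [j [jn ->]] : exists j : nat, (1 <= j <= 2 * n k)%N /\ mobius (antipode k) (a k (n k)) = a k j.
  by apply/endsP/antipode_ends/label_ends; lia.
move=> H2; have [d3 d4 _] := ccw_neq H2.
have j1 : j <> 1%N by move=> E; apply: d4; rewrite E.
have j2 : j <> (2 * n k)%N by move=> E; apply: d3; rewrite E.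
apply: (ccw_asym (ccw_rot (ccw_rot H2))); apply: label_order; lia.
Qed.

(** Indexed by the rotation used on it, so it is the arc of index [k + 1] in [bowen_series]. *)
Definition branch k : set C := circle_arc (sE k) (sE (k + 1)).

Lemma branchE k : circle_arc (a (k + 1) 1%N) (a (k + 1) (n (k + 1))) = branch k.
Proof. by rewrite label_mid. Qed.

Lemma branchP k x : branch k x <-> [/\ circle x, 0 < lor (e k) (hlift x) \/ x = sE k &
  lor (e (k + 1)) (hlift x) < 0].
Proof.
have [[s0 s1 s2 s3] _] := sE_sides k; have [[z0 z1 z2 z3] _] := sE_sides (k + 1).
rewrite !Z4A in z1 z2 z3.
have N : sE k <> sE (k + 1) by move=> E; move: s1; rewrite E z0 ltxx.
have A : ccw (sE k) (sE (k + 1)) (tE k) by apply/side_gt0.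
have B : ccw (sE (k + 1)) (tE (k + 1)) (sE k) by apply/side_lt0.
split=> [/circle_arcP[_ _ _ [->|H]]|[cx [h|->] h1]].
- by split => //; right.
- have [_ cx _] := ccw_circle H; split => //.
    by left; apply/side_gt0 => //; apply: ccw_trans H A.
  by apply/side_lt0 => //; apply: ccw_trans B (ccw_rot (ccw_rot H)).
- apply/circle_arcP; split => //; right.
  have xs : x <> sE k by move=> E; move: h; rewrite E s0 ltxx.
  have xz : x <> sE (k + 1) by move=> E; move: h1; rewrite E z0 ltxx.
  have [//|H] := ccw_total (cs k) cx (cs (k + 1)) (nesym xs) xz N.
  exfalso; move/side_gt0: h => /(_ cx) h; move/side_lt0: h1 => /(_ cx) h1.
  have [_ [_ t1 _ _]] := sE_sides k; move/side_gt0: t1 => /(_ (ct' k)) t1.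
  exact: ccw_asym h1 (ccw_trans (ccw_trans' H h) t1).
- by apply/circle_arcP; split => //; left.
Qed.

Lemma branch_ge0 k x : branch k x -> 0 <= lor (e k) (hlift x).
Proof.
by move=> /branchP[_ [/ltW//|->] _]; have [[-> _ _ _] _] := sE_sides k.
Qed.

Lemma branch_disjoint j k x : branch j x -> branch k x -> j = k.
Proof.
have N i : branch i x -> branch (i + 1) x -> False.
  move=> /branchP[_ _ h] /branch_ge0; rewrite leNgt.
  by rewrite h.
move=> bj bk; have kE : k = j + (k - j) by rewrite addrC subrK.
move: bk; rewrite kE; case: (Z4P (k - j)) => ->; first by rewrite addr0.
- by move/(N _ bj).
- move=> /branch_ge0 h; have := opposite Q (hlift_causal x) (branch_ge0 bj).
  by rewrite ltNge h.
- by move=> bk; exfalso; apply: (N (j + 3)) => //; rewrite Z4A.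
Qed.

(** [x] is beyond some side [k]. If it is also beyond or on side [k + 1], that one is taken instead,
    and [opposite] shows that it is inside side [k + 2]. *)
Lemma branch_cover x : circle x -> exists k, branch k x.
Proof.
move=> cx; have [k hk] := circle_exterior Q (hlift_causal x) (hlift_null cx).
have opp := opposite Q (hlift_causal x).
have zero i : lor (e i) (hlift x) = 0 -> lor (e (i + 1)) (hlift x) <= 0 -> x = sE i.
  move=> h0 h1; case: (side_endpoints cx h0) => // xt; move: h1.
  by have [_ [_ t1 _ _]] := sE_sides i; rewrite xt leNgt t1.
have zero' i : lor (e i) (hlift x) = 0 -> 0 <= lor (e (i + 3)) (hlift x) -> x = sE i.
  move=> h0 h1; case: (side_endpoints cx h0) => // xt; move: h1.
  by have [_ [_ _ _ t3]] := sE_sides i; rewrite xt leNgt t3.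
have B i : 0 <= lor (e i) (hlift x) -> lor (e (i + 1)) (hlift x) < 0 -> branch i x.
  move=> h0 h1; apply/branchP; split => //; move: h0; rewrite le_eqVlt => /orP[/eqP h0|]; last by left.
  by right; apply: zero => //; exact: ltW.
have [h1|h1] := ltP (lor (e (k + 1)) (hlift x)) 0; first by exists k; exact: B.
by exists (k + 1); apply: B => //; have := opp k hk; rewrite Z4A.
Qed.

Lemma bowen_seriesE k x : branch k x -> bowen_series T n a x = mobius (T k) x.
Proof.
move=> bx; rewrite /bowen_series; case: pickP => [i|/(_ (k + 1))].
  rewrite inE => H; have : branch (i - 1) x by rewrite -branchE subrK.
  by move/(branch_disjoint bx) => <-.
by move/negbT; rewrite notin_setE => H; exfalso; apply: H; rewrite label_mid.
Qed.

Lemma deformation_arcE i : deformation_arc n a i = circle_arc (sE i) (tE (i + 3)).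
Proof. by rewrite /deformation_arc label_mid label_half. Qed.

Lemma deformation_sides i x : circle_arc (sE i) (tE (i + 3)) x ->
  (0 < lor (e i) (hlift x) \/ x = sE i) /\ 0 < lor (e (i + 3)) (hlift x).
Proof.
have [[s0 s1 s2 s3] [t0 t1 t2 t3]] := sE_sides i.
have [[z0 z1 z2 z3] [y0 y1 y2 y3]] := sE_sides (i + 3).
rewrite !Z4A in z1 z2 z3 y1 y2 y3.
move=> /circle_arcP[_ _ _ [->|H]]; first by split => //; right.
have [_ cx _] := ccw_circle H.
split.
  left; apply/side_gt0 => //; move/side_gt0: y1 => /(_ (ct' _)) h.
  exact: ccw_trans H h.
apply/side_gt0 => //; move/side_gt0: s3 => /(_ (cs _)) h.
exact/ccw_rot/(ccw_trans (ccw_rot (ccw_rot h)) (ccw_rot (ccw_rot H))).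
Qed.

(** * Trace and multiplier at a fixed point *)

Lemma SU11_tr (g : 'M[C]_2) : SU11 g -> \tr g = (2 * complex.Re (g 0 0))%:C%C.
Proof.
move=> [_ g11 _]; rewrite /mxtrace !big_ord_recl big_ord0 addr0.
rewrite (_ : lift ord0 (ord0 : 'I_1) = 1 :> 'I_2); last exact: val_inj.
by rewrite g11; apply: complexP; rewrite !ReImE; ring.
Qed.

Lemma hyperbolicP (g : 'M[C]_2) : hyperbolic g <->
  SU11 g /\ 1 < complex.Re (g 0 0) ^+ 2.
Proof.
have E : SU11 g -> (2 < `|\tr g|) = (1 < complex.Re (g 0 0) ^+ 2).
  move=> sg; rewrite SU11_tr // norm_sqn (_ : 2 = 2%:C%C :> C); last by rewrite rmorph_nat.
  rewrite ltcR; set s := sqn _; have s0 : 0 <= s := sqn_ge0 _.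
  have -> : (2 < Num.sqrt s) = (2 ^+ 2 < Num.sqrt s ^+ 2).
    by rewrite ltr_pXn2r ?nnegrE ?sqrtr_ge0 ?ler0n.
  rewrite sqr_sqrtr // /s.
  by rewrite /sqn ReR ImR; apply/idP/idP; lra.
by split=> -[sg H]; split => //; [rewrite -E|rewrite E].
Qed.

Lemma den_quadratic (g : 'M[C]_2) x : SU11 g -> circle x -> mobius g x = x ->
  den g x * den g x = (2 * complex.Re (g 0 0))%:C%C * den g x - 1.
Proof.
move=> sg cx gx; have := mobius_den sg (circle_closed cx); rewrite gx => numE.
have [g10 g11 dg] := sg; rewrite det_mx2 in dg.
have -> : (2 * complex.Re (g 0 0))%:C%C = g 0 0 + g 1 1.
  by rewrite g11; apply: complexP; rewrite !ReImE; ring.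
transitivity (g 1 0 * (x * den g x) + g 1 1 * den g x); first by rewrite /den; ring.
by rewrite numE -dg /num /den; ring.
Qed.

(** [den g x] is an eigenvalue of [g], and the derivative at [x] has modulus [1 / sqn (den g x)]. A
    non-real eigenvalue has modulus 1, so this one is real, and the trace, its sum with its inverse,
    exceeds 2 in absolute value. *)
Lemma hyperbolic_fix (g : 'M[C]_2) x : SU11 g -> circle x -> mobius g x = x ->
  sqn (den g x) < 1 -> hyperbolic g.
Proof.
move=> sg cx gx lt1; apply/hyperbolicP; split => //.
have E := den_quadratic sg cx gx; move: lt1 E; move: (den g x) => l lt1 E.
set r := complex.Re (g 0 0) in E *.
have := congr1 (@complex.Im R) E; have := congr1 (@complex.Re R) E; rewrite !ReImE => h1 h2.
rewrite /sqn in lt1.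
have v0 : complex.Im l = 0.
  apply: contrapT => /eqP v0.
  have h3 : complex.Re l = r by apply: (mulIf v0); lra.
  by move: lt1; rewrite h3 in h1 *; lra.
rewrite v0 in h1 lt1; move: h1 lt1; set u := complex.Re l => h1 lt1.
have u0 : u != 0 by apply/eqP => u0; move: h1; rewrite u0; lra.
have u2 : 0 < u ^+ 2 by rewrite exprn_even_gt0.
have h4 : (2 * u * r) ^+ 2 = (u ^+ 2 + 1) ^+ 2 by congr (_ ^+ 2); lra.
rewrite -(ltr_pM2l u2) mulr1.
have : 0 < (1 - u ^+ 2) ^+ 2 by rewrite exprn_gt0 //; lra.
lra.
Qed.

(** * Dynamics of the deformed map *)
Section Deformation.
Variables (i0 : 'Z_4) (alpha : C).
Hypothesis halpha : deformation_arc n a i0 alpha.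

Let F := deformed_map T n a i0 alpha.
Let o := center P.
(* The visual metric of the circle seen from [o] is [|dx| / height x], up to a constant. *)
Let height x : R := - lor o (hlift x).

Definition early : set C := circle_arc (sE i0) alpha.
(** [i0 + 3] is the index [i0 - 1] of the rotation prolonged up to [alpha]. *)
Definition deformed_branch k x : Prop := if pselect (early x) then k = i0 + 3 else branch k x.

Lemma alpha_circle : circle alpha.
Proof. by move: halpha; rewrite deformation_arcE => /circle_arc_circle. Qed.

Lemma early_deformation x : early x -> circle_arc (sE i0) (tE (i0 + 3)) x.
Proof.
move=> /circle_arcP[_ _ sa Hx]; move: halpha; rewrite deformation_arcE.
move=> /circle_arcP[c1 c2 c3 [/esym//|H]]; apply/circle_arcP; split => //.
by case: Hx => [->|Hx]; [left|right; exact: ccw_trans Hx H].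
Qed.

Lemma deformed_branch_ex x : circle x -> exists k, deformed_branch k x.
Proof.
move=> cx; rewrite /deformed_branch; case: pselect => h; first by exists (i0 + 3).
exact: branch_cover.
Qed.

Lemma deformedE k x : deformed_branch k x -> F x = mobius (T k) x.
Proof.
rewrite /deformed_branch /F /deformed_map label_mid -/early; case: pselect => h.
  by move=> ->; rewrite mem_set // (_ : i0 - 1 = i0 + 3) // Z4D.
by move=> bk; rewrite memNset // (bowen_seriesE bk).
Qed.

Lemma deformed_branch_side k x : circle x -> deformed_branch k x ->
  0 < lor (e k) (hlift x) \/ x = sE k.
Proof.
move=> cx; rewrite /deformed_branch; case: pselect => h; last by case/branchP.
by move=> ->; left; have [] := deformation_sides (early_deformation h).
Qed.

Lemma side_ge0 k x : 0 < lor (e k) (hlift x) \/ x = sE k -> 0 <= lor (e k) (hlift x).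
Proof. by case=> [/ltW//|->]; have [[-> _ _ _] _] := sE_sides k. Qed.

Lemma height_gt0 x : 0 < height x.
Proof. by rewrite oppr_gt0; apply: timelike_lor (center_timelike Q) (hlift_causal x). Qed.

(** Divided by [height x], this is the inverse of the derivative of [T k] in the visual metric. As
    [e k] is negative at [o], the derivative exceeds 1 beyond side [k] and equals 1 at the ends of
    its line. *)
Lemma height_T k x : circle x ->
  sqn (den (T k) x) * height (mobius (T k) x) =
  height x + 2 * lor (e k) o * lor (e k) (hlift x).
Proof.
move=> cx; have sT := rotation_SU11 hT k; have dx := circle_closed cx.
have -> : sqn (den (T k) x) * height (mobius (T k) x) = - lor o (lact (T k) (hlift x)).
  by rewrite /height hlift_mobius // lorZr mulrN.
rewrite (lact_T Q dv hT).
have oE : o = sg o by rewrite /o (center_sg Q).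
rewrite {1}oE lor_sg /refl lorDr lorNr lorZr (lorC o (e k)) /height; ring.
Qed.

Lemma T_sE k : mobius (T k) (sE k) = tE (3 - k).
Proof.
have sT := rotation_SU11 hT k; have dx := circle_closed (cs k).
have cT := mobius_circle sT (cs k).
have d0 : 0 < sqn (den (T k) (sE k)) by rewrite sqn_gt0 den_neq0.
have E j : sqn (den (T k) (sE k)) * lor (e (3 - j)) (hlift (mobius (T k) (sE k))) =
    lor (e j) (refl (@lor R) e k (hlift (sE k))).
  by rewrite -lorZr -hlift_mobius // (lact_T Q dv hT) -(quad_sge Q) lor_sg.
have [[s0 s1 s2 s3] _] := sE_sides k.
have r : refl (@lor R) e k (hlift (sE k)) = hlift (sE k).
  by rewrite /refl s0 mulr0 scale0r subr0.
have E0 : lor (e (3 - k)) (hlift (mobius (T k) (sE k))) = 0.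
  by have /eqP := E k; rewrite r s0 mulf_eq0 gt_eqF //= => /eqP.
case: (side_endpoints cT E0) => // sk; exfalso.
have := E (k + 3); rewrite r sk => h.
have : 0 < lor (e (3 - (k + 3))) (hlift (sE (3 - k))) by rewrite -(pmulr_rgt0 _ d0) h.
have [[_ h1 _ _] _] := sE_sides (3 - k).
have -> : 3 - (k + 3) = 3 - k + 1.
  by rewrite opprD addrCA subrr addr0 addrAC Z4D add0r.
by rewrite ltNge (ltW h1).
Qed.

Lemma tE_neq_sE j k : tE j <> sE k.
Proof.
have [_ [t0 t1 t2 t3]] := sE_sides j; have [[s0 s1 _ _] _] := sE_sides k.
move=> E; have kE : k = j + (k - j) by rewrite addrC subrK.
move: s0 s1; rewrite -E kE; case: (Z4P (k - j)) => ->.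
- by rewrite addr0 => _; rewrite ltNge (ltW t1).
- by move=> h; move: t1; rewrite h ltxx.
- by move=> h; move: t2; rewrite h ltxx.
- by move=> h; move: t3; rewrite h ltxx.
Qed.

Lemma deformed_circle x : circle x -> circle (F x).
Proof.
move=> cx; have [k hk] := deformed_branch_ex cx; rewrite (deformedE hk).
exact: mobius_circle (rotation_SU11 hT k) cx.
Qed.

Lemma iter_circle (m : nat) x : circle x -> circle (iter m F x).
Proof. by elim: m => //= m IH cx; apply/deformed_circle/IH. Qed.

Lemma center_neg k : lor (e k) o < 0. Proof. exact: center_interior. Qed.

Lemma step_le k x : circle x -> deformed_branch k x ->
  sqn (den (T k) x) * height (F x) <= height x.
Proof.
move=> cx hk; rewrite (deformedE hk) height_T // gerDl.
have := side_ge0 (deformed_branch_side cx hk); have := center_neg k; nra.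
Qed.

(** The only point where a branch may fail to expand strictly is [sE k]; its image is some [tE],
    which is no [sE], so the next step expands. *)
Lemma step2_lt k x : circle x -> deformed_branch k x ->
  sqn (den (T k) x) * height (F x) < height x \/
  forall k', deformed_branch k' (F x) -> 0 < lor (e k') (hlift (F x)).
Proof.
move=> cx hk; case: (deformed_branch_side cx hk) => [h|xs].
  left; rewrite (deformedE hk) height_T // gtrDl.
  by rewrite nmulr_rlt0 // pmulr_rlt0 // center_neg.
right=> k' hk'; have FE : F x = tE (3 - k) by rewrite (deformedE hk) xs T_sE.
by case: (deformed_branch_side (deformed_circle cx) hk') => // E; case: (@tE_neq_sE (3 - k) k'); rewrite -FE.
Qed.

Lemma iter_group (m : nat) x : circle x -> exists g, [/\ generated_group T g,
  iter m F x = mobius g x & sqn (den g x) * height (iter m F x) <= height x].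
Proof.
move=> cx; elim: m => [|m [g [gT gE gH]]].
  exists 1; split; [exact: generated_1|by rewrite mobius1|].
  by rewrite /den !mx21E mul0r add0r /sqn !ReImE expr1n expr0n addr0 mul1r.
have cm := iter_circle m cx; have [k hk] := deformed_branch_ex cm.
have sg' := group_SU11 hT gT; have sT := rotation_SU11 hT k; have dx := circle_closed cx.
exists (T k * g); split.
- by apply: generated_M => //; exact: generated_gen.
- by rewrite iterS (deformedE hk) mobiusM // -gE.
- rewrite denM // -gE sqnM iterS mulrAC.
  apply: le_trans gH; rewrite mulrC ler_wpM2l ?sqn_ge0 //.
  exact: step_le.
Qed.

Lemma iter_group_lt x : circle x -> exists g, [/\ generated_group T g,
  iter 2 F x = mobius g x & sqn (den g x) * height (iter 2 F x) < height x].
Proof.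
move=> cx; have cF := deformed_circle cx.
have [k hk] := deformed_branch_ex cx; have [k' hk'] := deformed_branch_ex cF.
have sT := rotation_SU11 hT k; have dx := circle_closed cx.
have sT' := rotation_SU11 hT k'.
exists (T k' * T k); split.
- by apply: generated_M; exact: generated_gen.
- by rewrite /= (deformedE hk') mobiusM // -(deformedE hk).
rewrite denM // -(deformedE hk) sqnM /= mulrAC.
have d0 : 0 < sqn (den (T k) x) by rewrite sqn_gt0 den_neq0.
have le1 := step_le cx hk; have le2 := step_le cF hk'.
case: (step2_lt cx hk) => [lt|/(_ k' hk') h].
  by apply: le_lt_trans lt; rewrite mulrC ler_wpM2l ?sqn_ge0.
apply: lt_le_trans le1; rewrite mulrC ltr_pM2l //.
rewrite (deformedE hk') height_T // gtrDl.
by rewrite nmulr_rlt0 // pmulr_rlt0 // center_neg.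
Qed.

Lemma periodic_hyperbolic (m : nat) x : circle x -> (0 < m)%N -> iter m F x = x ->
  exists g, [/\ generated_group T g, hyperbolic g & mobius g x = x].
Proof.
move=> cx m0 mx.
(* Doubling the period leaves room for the two steps that strict expansion takes, even if
   [m = 1]. *)
have m2x : iter (m + m) F x = x by rewrite iterD mx mx.
have [g1 [g1T g1E g1H]] := iter_group_lt cx.
have c2 := iter_circle 2 cx.
have [g2 [g2T g2E g2H]] := iter_group (m + m - 2) c2.
have E : iter (m + m - 2) F (iter 2 F x) = x by rewrite -iterD subnK // ; lia.
rewrite E in g2E g2H.
have s1 := group_SU11 hT g1T; have s2 := group_SU11 hT g2T; have dx := circle_closed cx.
have gT : generated_group T (g2 * g1) by exact: generated_M.
exists (g2 * g1); have gx : mobius (g2 * g1) x = x by rewrite mobiusM // -g1E -g2E.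
split => //; apply: (hyperbolic_fix (SU11_M s2 s1) cx gx).
rewrite denM // sqnM -g1E -(ltr_pM2r (height_gt0 x)) mul1r mulrAC.
have lt : sqn (den g1 x) * (sqn (den g2 (iter 2 F x)) * height x) <=
    sqn (den g1 x) * height (iter 2 F x) by rewrite ler_wpM2l ?sqn_ge0.
by rewrite mulrC; exact: le_lt_trans lt g1H.
Qed.

Lemma conj_hyperbolic (h g : 'M[C]_2) x : generated_group T h -> generated_group T g ->
  hyperbolic g -> circle x -> mobius g (mobius h x) = mobius h x ->
  hyperbolic_fixed_point T x.
Proof.
move=> hT' gT /hyperbolicP[sg gh] cx gx; have sh := group_SU11 hT hT'.
have sV := SU11_V sh; have dx := circle_closed cx.
have sM := SU11_M (SU11_M sV sg) sh.
exists (h^-1 * g * h); split.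
- by do 2?apply: generated_M => //; exact: generated_V.
- apply/hyperbolicP; split => //.
  have tr : \tr (h^-1 * g * h) = \tr g.
    by rewrite mxtrace_mulC -[_ *m _]/(_ * _) mulrA SU11_mulV // mul1r.
  move: tr; rewrite !SU11_tr // => /complexI E.
  have -> : complex.Re ((h^-1 * g * h) 0 0) = complex.Re (g 0 0) by lra.
  exact: gh.
have sVg := SU11_M sV sg; have dhx := mobius_closed sh dx.
by rewrite mobiusM // mobiusM // gx mobiusK.
Qed.

Lemma label_circle x : label_set n a x -> circle x.
Proof. by move=> /label_setP[k /ends_circle]. Qed.

Lemma T_circle k x : circle x -> circle (mobius (T k) x).
Proof. exact: mobius_circle (rotation_SU11 hT k). Qed.

Lemma deformed_label_circle x : deformed_label_set T n a i0 alpha x -> circle x.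
Proof.
case=> [[/label_circle//|]|] [m _ <-]; apply: iter_circle; first exact: alpha_circle.
exact/T_circle/alpha_circle.
Qed.

Lemma markov_hyperbolic :
  is_markov F (arcs_of (deformed_label_set T n a i0 alpha)) -> hyperbolic_fixed_point T alpha.
Proof.
move=> [fin part _]; have Wfin := partition_finite deformed_label_circle fin part.
have ca := alpha_circle.
have [p [q [pq E]]] : exists p q, (p < q)%N /\ iter p F alpha = iter q F alpha.
  apply: contrapT => N.
  have inj : injective (fun m : nat => iter m F alpha).
    move=> p q E; apply: contrapT => /eqP; rewrite neq_ltn => /orP[h|h]; apply: N.
      by exists p, q.
    by exists q, p.
  have : finite_set ((fun m : nat => iter m F alpha) @` [set: nat]).
    by apply: sub_finite_set Wfin => _ [m _ <-]; left; right; exists m.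
  have inj' : {in [set: nat] &, injective (fun m : nat => iter m F alpha)} by move=> p q _ _ /inj.
  by rewrite (eq_finite_set (inj_card_eq inj')) => /infinite_nat.
have cp := iter_circle p ca.
have [g [gT gH gx]] : exists g, [/\ generated_group T g, hyperbolic g &
    mobius g (iter p F alpha) = iter p F alpha].
  apply: (@periodic_hyperbolic (q - p)) => //; first by rewrite subn_gt0.
  by rewrite -iterD subnK ?E // ltnW.
have [h [hT' hE _]] := iter_group p ca.
by apply: (conj_hyperbolic hT' gT gH ca); rewrite -hE.
Qed.

(* Pigeonhole: two close elements [g] and [h] of the set give an element [g * h^-1] that moves
   the center by little, hence [g = h]. *)
Lemma group_bounded_finite (B : R) :
  finite_set [set g : 'M[C]_2 | generated_group T g /\ sqn (g 0 1) <= B].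
Proof.
set G := [set g | _]; pose K := 2 + `|B|.
have K2 : 2 <= K by rewrite /K lerDl.
pose phi (g : 'M[C]_2) : R * R * R * R :=
  (complex.Re (g 0 0), complex.Im (g 0 0), complex.Re (g 0 1), complex.Im (g 0 1)).
have inj : {in G &, injective phi}.
  move=> g h /set_mem[gT _] /set_mem[hT' _] [E1 E2 E3 E4].
  rewrite (su_eta (group_SU11 hT gT)) (su_eta (group_SU11 hT hT')).
  by rewrite (complexP E1 E2) (complexP E3 E4).
rewrite -(eq_finite_set (inj_card_eq inj)).
have bnd g : G g -> [/\ `|(phi g).1.1.1| <= K, `|(phi g).1.1.2| <= K,
    `|(phi g).1.2| <= K & `|(phi g).2| <= K].
  move=> [gT gB]; have d := SU11_sqn (group_SU11 hT gT).
  have BB := ler_norm B; have B0 := normr_ge0 B.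
  have S (t : R) : t ^+ 2 <= 1 + `|B| -> `|t| <= K.
    move=> ht; rewrite -(@ler_pXn2r _ 2) ?nnegrE ?normr_ge0 //; last by rewrite /K; lra.
    rewrite real_normK ?num_real //; apply: le_trans ht _; rewrite /K; nra.
  have p1 := sqr_ge0 (complex.Re (g 0 0)); have p2 := sqr_ge0 (complex.Im (g 0 0)).
  have p3 := sqr_ge0 (complex.Re (g 0 1)); have p4 := sqr_ge0 (complex.Im (g 0 1)).
  by split; apply: S; rewrite /phi /=; move: d gB; rewrite /sqn; lra.
have [eta eta0 near1] : exists2 r, 0 < r & forall (j : 'Z_4) (g : 'M[C]_2),
    `|complex.Re (g 0 0) - 1| <= r -> `|complex.Im (g 0 0)| <= r ->
    `|complex.Re (g 0 1)| <= r -> `|complex.Im (g 0 1)| <= r ->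
    lor (e j) (lact g o) < 0.
  apply: Z4_min => [k r s H s0 sr g h1 h2 h3 h4|k].
    by apply: H; [apply: le_trans h1 sr|apply: le_trans h2 sr|
      apply: le_trans h3 sr|apply: le_trans h4 sr].
  exact: lact_near1 (center_neg k).
(* A coordinate of [g * h^-1 - 1] is a sum of four products of a difference below [r] and a number
   bounded by [K]; the bound [1 / 2] rules out [g = - h]. *)
pose r := Num.min (1 / 2) (eta / (4 * K)).
have r0 : 0 < r by rewrite lt_min; apply/andP; split; apply: divr_gt0; lra.
have rh : r <= 1 / 2 by rewrite ge_min lexx.
have rK : 4 * (r * K) <= eta.
  have K4 : 0 < 4 * K by lra.
  have : r <= eta / (4 * K) by rewrite ge_min lexx orbT.
  by rewrite ler_pdivlMr //; lra.
apply: (@grid_finite _ _ K r) => // [_ [g Gg <-]|_ _ [g Gg <-] [h Gh <-]]; first exact: bnd.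
rewrite /phi /= => d1 d2 d3 d4.
have [gT _] := Gg; have [hT' _] := Gh.
have sg' := group_SU11 hT gT; have sh := group_SU11 hT hT'.
have [b1 b2 b3 b4] := bnd h Gh; rewrite /phi /= in b1 b2 b3 b4.
have kT : generated_group T (g * h^-1).
  by apply: generated_M => //; exact: generated_V.
have Pr (s t : R) : `|s| < r -> `|t| <= K -> - (r * K) <= s * t <= r * K.
  by move=> hs ht; rewrite -ler_norml normrM; apply: ler_pM => //; exact: ltW.
have : interior e (lact (g * h^-1) o).
  have dh := SU11_sqn sh.
  move=> j; apply: near1; rewrite !mulmx2E SU11_inv // /su !mx2E !ReImE;
    apply: le_trans rK; rewrite ler_norml.
  - have /andP[? ?] := Pr _ _ d1 b1; have /andP[? ?] := Pr _ _ d2 b2.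
    have /andP[? ?] := Pr _ _ d3 b3; have /andP[? ?] := Pr _ _ d4 b4.
    by move: dh; rewrite /sqn; lra.
  - have /andP[? ?] := Pr _ _ d2 b1; have /andP[? ?] := Pr _ _ d1 b2.
    have /andP[? ?] := Pr _ _ d4 b3; have /andP[? ?] := Pr _ _ d3 b4.
    lra.
  - have /andP[? ?] := Pr _ _ d1 b3; have /andP[? ?] := Pr _ _ d2 b4.
    have /andP[? ?] := Pr _ _ d3 b1; have /andP[? ?] := Pr _ _ d4 b2.
    lra.
  - have /andP[? ?] := Pr _ _ d1 b4; have /andP[? ?] := Pr _ _ d2 b3.
    have /andP[? ?] := Pr _ _ d4 b1; have /andP[? ?] := Pr _ _ d3 b2.
    lra.
move=> /(lact_center_id Q dv hT kT)[] E.
  suff -> : g = h by [].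
  by rewrite -[g]mulr1 -(SU11_mulVr sh) mulrA E mul1r.
exfalso; have gE : g = - h by rewrite -[g]mulr1 -(SU11_mulVr sh) mulrA E mulN1r.
have dh := SU11_sqn sh; move: d1 d2; rewrite gE !mxE !ReImE => d1 d2.
have S (t : R) : `|- t - t| < r -> t ^+ 2 <= 1 / 16.
  rewrite ltr_norml => /andP[h1 h2]; nra.
by have := S _ d1; have := S _ d2; have := sqn_ge0 (h 0 1); move: dh; rewrite /sqn; lra.
Qed.

Lemma tE_near l : exists2 r, 0 < r & forall x, circle x -> sqn (x - tE l) <= r ->
  [/\ r <= lor (e (l + 1)) (hlift x), lor (e (l + 2)) (hlift x) < 0,
      lor (e (l + 3)) (hlift x) < 0 & ~ early x].
Proof.
have [_ [_ t1 t2 t3]] := sE_sides l; have ca := alpha_circle.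
have neg u : lor u (hlift (tE l)) < 0 -> exists2 r, 0 < r & forall x, circle x ->
    sqn (x - tE l) <= r -> lor u (hlift x) < 0.
  move=> uN; have eta0 : 0 < - lor u (hlift (tE l)) / 2 by lra.
  have [r r0 H] := lor_near u (ct' l) eta0; exists r => // x hx /(H x hx).
  by rewrite ler_norml => /andP[_]; lra.
have eta0 : 0 < lor (e (l + 1)) (hlift (tE l)) / 2 by lra.
have [r1 r10 H1] := lor_near (e (l + 1)) (ct' l) eta0.
have [r2 r20 H2] := neg _ t2; have [r3 r30 H3] := neg _ t3.
(* Only [tE (i0 + 3)] needs care: it closes the half-open deformation arc, and [early] stops at
   [alpha], strictly before it. *)
have [r4 r40 H4] : exists2 r, 0 < r & forall x, circle x -> sqn (x - tE l) <= r -> l = i0 + 3 ->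
    ~ early x.
  case: (pselect (l = i0 + 3)) => [lE|nl]; last by exists 1.
  have [ea|nea] := pselect (alpha = sE i0).
    by exists 1 => // x _ _ _ /circle_arcP[_ _ + _]; rewrite ea.
  have /neg[r r0 H] : lor (cross (hlift alpha) (hlift (sE i0))) (hlift (tE l)) < 0.
    move: halpha; rewrite deformation_arcE -lE => /circle_arcP[_ _ _ [//|]].
    rewrite ccw_det // => d0; rewrite -/(det3 (hlift alpha) (hlift (sE i0)) (hlift (tE l))).
    by rewrite det3C oppr_lt0.
  exists r => // x hx /(H x hx) xN _ /circle_arcP[_ _ _ [xs|]].
    by move: xN; rewrite xs cross_r ltxx.
  by rewrite ccw_det // -det3_rot; rewrite /det3 ltNge (ltW xN).
(* Serves both as a radius and as a lower bound for [e (l + 1)]. *)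
pose r := Num.min (lor (e (l + 1)) (hlift (tE l)) / 2)
  (Num.min (Num.min r1 r2) (Num.min r3 r4)).
exists r; first by rewrite !lt_min eta0 r10 r20 r30 r40.
move=> x hx; rewrite !le_min => /andP[_ /andP[/andP[x1 x2] /andP[x3 x4]]].
have := H1 x hx x1; rewrite ler_norml => /andP[n1 _].
have n2 := H2 x hx x2; have n3 := H3 x hx x3.
split => //; first by apply: le_trans (_ : r <= lor (e (l + 1)) (hlift (tE l)) / 2) _; [rewrite ge_min lexx|lra].
have [/(H4 x hx x4)//|nl] := pselect (l = i0 + 3).
move=> /early_deformation/deformation_sides[/side_ge0 a0 a3].
have iE : i0 = l + (i0 - l) by rewrite addrC subrK.
move: a0 a3 nl; rewrite iE; case: (Z4P (i0 - l)) => ->; rewrite ?addr0 ?Z4A.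
- by rewrite ltNge (ltW n3).
- by [].
- by rewrite leNgt n2.
- by rewrite leNgt n3.
Qed.

Lemma deformed_branch_tE l : exists2 r, 0 < r & forall k x, circle x -> deformed_branch k x ->
  sqn (x - tE l) <= r -> k = l + 1.
Proof.
have [r r0 H] := tE_near l; exists r => // k x hx hk /(H x hx)[h1 h2 h3 ne].
move: hk; rewrite /deformed_branch; case: pselect => // _ /branchP[_ /side_ge0 k0 k1].
have kE : k = l + (k - l) by rewrite addrC subrK.
rewrite kE in k0 k1 *; move: k0 k1; case: (Z4P (k - l)) => ->; rewrite ?addr0 ?Z4A //.
- by move=> _; rewrite ltNge (le_trans (ltW r0) h1).
- by rewrite leNgt h2.
- by rewrite leNgt h3.
Qed.

Lemma tE_far k : exists2 r, 0 < r & forall x, circle x -> deformed_branch k x -> r <= sqn (x - tE k).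
Proof.
have [r r0 H] := deformed_branch_tE k; exists r => // x hx hk.
rewrite leNgt; apply/negP => /ltW /(H k x hx hk) /esym/eqP.
by rewrite -[X in _ == X]addr0 (inj_eq (addrI k)).
Qed.

(** The line of side [k] separates the points, so [lor (e k) (hlift x)] is bounded by its variation
    from [y] to [x], and [x] is near an end of the line; [tE_far] rules out [tE k]. *)
Lemma narrow_sE k (rho : R) : 0 < rho -> exists2 r, 0 < r & forall x y, circle x -> circle y ->
  deformed_branch k x -> lor (e k) (hlift y) < 0 -> sqn (x - y) <= r ->
  sqn (x - sE k) <= rho /\ sqn (y - sE k) <= rho.
Proof.
move=> rho0; have [c c0 far] := tE_far k; have [kap kap0 det] := side_det k.
pose K := 4 * (cx (e k) ^+ 2 + cy (e k) ^+ 2).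
pose w := sqn (sE k - tE k).
have w0 : 0 < w by rewrite /w sqn_gt0 subr_eq0; apply/eqP => /esym/tE_neq_sE.
have K0 : 0 <= K by rewrite /K; have := sqr_ge0 (cx (e k)); have := sqr_ge0 (cy (e k)); lra.
pose B := kap ^+ 2 * K + 1.
have B0 : 0 < B by rewrite ltr_wpDl // mulr_ge0 // sqr_ge0.
(* By [det3_circle], [16 * c * w * sqn (x - sE k)] is at most [B * sqn (x - y)]. The second term
   makes [sqn (x - sE k)] at most [rho / 4], and the first carries the bound over to [y]. *)
exists (Num.min (rho / 4) (16 * c * w * rho / (4 * B))).
  by rewrite lt_min !divr_gt0 // ?mulr_gt0 //; lra.
move=> x y hx hy hk yN; rewrite le_min => /andP[s1]; rewrite ler_pdivlMr; last by lra.
move=> s2; have x0 := side_ge0 (deformed_branch_side hx hk).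
have Lip := lor_lipschitz (e k) hx hy; rewrite -/K in Lip.
have fx := far x hx hk.
have := det3_circle (cs k) hx (ct' k); rewrite det (sqnB (sE k)) -/w => E.
have s0 := sqn_ge0 (x - y); have q0 := sqn_ge0 (x - sE k).
have le : 16 * (c * w) * sqn (x - sE k) <= B * sqn (x - y).
  apply: (@le_trans _ _ (kap ^+ 2 * (K * sqn (x - y)))); last by rewrite mulrA ler_wpM2r // /B; lra.
  apply: (@le_trans _ _ (kap ^+ 2 * (lor (e k) (hlift x)) ^+ 2)).
    by rewrite -exprMn E; have := ler_wpM2r (ltW w0) (ler_wpM2r q0 fx); lra.
  rewrite ler_wpM2l ?sqr_ge0 //; apply: le_trans Lip.
  by rewrite ler_pXn2r ?nnegrE //; lra.
have h : sqn (x - sE k) <= rho / 4.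
  have cw : 0 < 16 * (c * w) by rewrite !mulr_gt0.
  by rewrite -(ler_pM2l cw); lra.
split; first by lra.
by apply: le_trans (sqn_triangle _ x _) _; rewrite (sqnB y); lra.
Qed.

(** * The distance from the center to a moving geodesic *)

Let N k x : R := height x + 2 * lor (e k) o * lor (e k) (hlift x).
(* Up to a constant, the inverse square of [cosh d], where [d] is the distance from [o] to the
   geodesic joining [x] to [y]. *)
Let gap x y : R := sqn (x - y) / (height x * height y).

Lemma N_gt0 k x : circle x -> 0 < N k x.
Proof.
move=> hx; rewrite /N -height_T // mulr_gt0 ?height_gt0 // sqn_gt0 den_neq0 //.
  exact: rotation_SU11 hT k.
exact: circle_closed.
Qed.

(** The factors [sqn (den (T k) _)] relating [N k] to the heights of the images cancel against those
    of [mobius_sub]. *)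
Lemma gap_T k x y : circle x -> circle y ->
  gap (mobius (T k) x) (mobius (T k) y) = sqn (x - y) / (N k x * N k y).
Proof.
move=> hx hy; have sT := rotation_SU11 hT k.
have dx := circle_closed hx; have dy := circle_closed hy.
have d1 := den_neq0 sT dx; have d2 := den_neq0 sT dy; rewrite -!sqn_eq0 in d1 d2.
have h1 := height_gt0 (mobius (T k) x); have h2 := height_gt0 (mobius (T k) y).
have := mobius_sub sT dx dy; rewrite /gap /N -!height_T // => <-.
move: (sqn (den _ x)) d1 (sqn (den _ y)) d2 => p p0 q q0.
move: (height _) h1 (height _) h2 (sqn _) => h h0 h' h0' s.
by field; rewrite p0 q0 !gt_eqF.
Qed.

Lemma gap_ge0 x y : 0 <= gap x y.
Proof. by rewrite /gap divr_ge0 ?sqn_ge0 // mulr_ge0 // ltW // height_gt0. Qed.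

Lemma gap_T_ge k x y : circle x -> circle y -> deformed_branch k x -> 0 <= lor (e k) (hlift y) ->
  gap x y <= gap (mobius (T k) x) (mobius (T k) y).
Proof.
move=> hx hy hk y0; rewrite gap_T // /gap.
have x0 := side_ge0 (deformed_branch_side hx hk).
rewrite ler_wpM2l ?sqn_ge0 // lef_pV2 ?posrE ?mulr_gt0 ?height_gt0 ?N_gt0 //.
have oN := center_neg k.
have le z : 0 <= lor (e k) (hlift z) -> N k z <= height z.
  by move=> z0; rewrite /N gerDl; nra.
by apply: ler_pM; rewrite ?le // ltW // N_gt0.
Qed.

(** Compactness: heights lie between [m] and [M], and [T k] is bi-Lipschitz, so one step loses at
    most a bounded factor. *)
Lemma gap_step : exists2 c, 0 < c & forall k x y, circle x -> circle y ->
  c * gap x y <= gap (mobius (T k) x) (mobius (T k) y).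
Proof.
have [m [M [m0 M0 H]]] := timelike_bounds (center_timelike Q).
apply: Z4_min => [k r s h s0 sr x y hx hy|k].
  by apply: le_trans (h x y hx hy); rewrite ler_wpM2r // gap_ge0.
have sT := rotation_SU11 hT k; have [K K0 L] := mobius_lipschitz sT.
exists (m ^+ 2 / (K * M ^+ 2)); first by rewrite divr_gt0 ?mulr_gt0 ?exprn_gt0.
move=> x y hx hy; have [_ Lxy] := L x y hx hy.
have hTx := mobius_circle sT hx; have hTy := mobius_circle sT hy.
rewrite /gap ler_pdivlMr ?mulr_gt0 ?height_gt0 //.
have /andP[a1 _] := H x hx; have /andP[a2 _] := H y hy.
have /andP[_ b1] := H _ hTx; have /andP[_ b2] := H _ hTy.
have a0 : m ^+ 2 <= height x * height y by rewrite expr2; apply: ler_pM => //; exact: ltW.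
have b0 : height (mobius (T k) x) * height (mobius (T k) y) <= M ^+ 2.
  by rewrite expr2; apply: ler_pM => //; rewrite ltW // height_gt0.
have hh : 0 < height x * height y by rewrite mulr_gt0 ?height_gt0.
move: Lxy a0 b0 hh; move: (sqn_ge0 (x - y)) (height x * height y).
move: (sqn (x - y)) => s s0 h.
have h'0 : 0 < height (mobius (T k) x) * height (mobius (T k) y) by rewrite mulr_gt0 ?height_gt0.
move: (height (mobius (T k) x) * _) h'0 (sqn (_ - _)) => h' h'0 s' Lxy a0 b0 hh.
have M2 : 0 < M ^+ 2 by rewrite exprn_gt0.
rewrite (_ : _ * h' = (m ^+ 2 / h) * (h' / M ^+ 2) * (s / K)); last first.
  by field; rewrite !gt_eqF.
have s'K : s / K <= s' by rewrite ler_pdivrMr // mulrC.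
apply: le_trans s'K; rewrite ler_piMl ?divr_ge0 // ?(ltW K0) //.
rewrite -[1]mulr1; apply: ler_pM.
- by rewrite divr_ge0 ?sqr_ge0 // ltW.
- by rewrite divr_ge0 // ltW.
- by rewrite ler_pdivrMr // mul1r.
- by rewrite ler_pdivrMr // mul1r.
Qed.

(* If the side [k] separates two close points [x] and [y], then both are close to [sE k]. The
   map sends them close to [tE (3 - k)], where the next branch expands by a definite factor,
   while the loss in the first step is negligible. *)
Lemma gap_step2 : exists2 r, 0 < r & forall k k' x y, circle x -> circle y ->
  deformed_branch k x -> deformed_branch k' (mobius (T k) x) -> lor (e k) (hlift y) < 0 ->
  sqn (x - y) <= r ->
  gap x y <= gap (mobius (T k' * T k) x) (mobius (T k' * T k) y).
Proof.
have [m [M [m0 M0 H]]] := timelike_bounds (center_timelike Q).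
apply: Z4_min => [k r s h s0 sr k' x y hx hy hk hk' yN xy|k].
  by apply: h hk hk' yN (le_trans xy sr).
have sT := rotation_SU11 hT k; have [K K0 L] := mobius_lipschitz sT.
set l := 3 - k; have [r1 r10 H1] := deformed_branch_tE l.
have [eta eta0 H2] := tE_near l.
pose rho := Num.min r1 eta / K.
have rho0 : 0 < rho by rewrite divr_gt0 // lt_min r10 eta0.
have [r2 r20 H3] := narrow_sE k rho0.
have oN := center_neg k; have oN' := center_neg (l + 1).
(* Chosen to balance the two steps: [N k y] exceeds [height y] by at most [- 2 * lor (e k) o * q],
   and with heights between [m] and [M] the gain [- 2 * lor (e (l + 1)) o * eta] of the next step
   makes up for it. *)
pose q := lor (e (l + 1)) o * eta * m / (lor (e k) o * M).
have q0 : 0 < q.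
  rewrite /q -mulrNN -invrN -mulNr -!mulNr divr_gt0 // ?mulr_gt0 // ?oppr_gt0 //.
pose D := 4 * (cx (e k) ^+ 2 + cy (e k) ^+ 2) + 1.
have D0 : 0 < D by rewrite /D; have := sqr_ge0 (cx (e k)); have := sqr_ge0 (cy (e k)); lra.
(* By the Lipschitz bound, the second term gives [- lor (e k) (hlift y) <= q]. *)
exists (Num.min r2 (q ^+ 2 / D)); first by rewrite lt_min r20 divr_gt0 ?exprn_gt0.
move=> k' x y hx hy hk hk' yN; rewrite le_min => /andP[xy1]; rewrite ler_pdivlMr // => xy2.
have [xs ys] := H3 x y hx hy hk yN xy1.
have near z : circle z -> sqn (z - sE k) <= rho ->
    sqn (mobius (T k) z - tE l) <= r1 /\ sqn (mobius (T k) z - tE l) <= eta.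
  move=> hz; rewrite /rho ler_pdivlMr // => zs; have [Lz _] := L z (sE k) hz (cs k).
  move: zs; rewrite -T_sE mulrC => zs.
  by have := le_trans Lz zs; rewrite le_min => /andP.
have hTx := mobius_circle sT hx; have hTy := mobius_circle sT hy.
have k'E := H1 k' _ hTx hk' (near x hx xs).1.
have [yeta _ _ _] := H2 _ hTy (near y hy ys).2.
have sT' := rotation_SU11 hT k'; have dx := circle_closed hx; have dy := circle_closed hy.
rewrite !mobiusM // gap_T //.
have x0 := side_ge0 (deformed_branch_side hx hk).
have x'0 := side_ge0 (deformed_branch_side hTx hk').
have Ey : - lor (e k) (hlift y) <= q.
  rewrite -(@ler_pXn2r _ 2) ?nnegrE ?(ltW q0) //; last by lra.
  apply: le_trans xy2; apply: le_trans (_ : (lor (e k) (hlift x) - lor (e k) (hlift y)) ^+ 2 <= _).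
    have y0 : 0 <= - lor (e k) (hlift y) by rewrite oppr_ge0 ltW.
    have xy0 : - lor (e k) (hlift y) <= lor (e k) (hlift x) - lor (e k) (hlift y).
      by rewrite lerDr.
    by rewrite ler_pXn2r ?nnegrE // (le_trans y0).
  apply: le_trans (lor_lipschitz (e k) hx hy) _.
  by rewrite mulrC ler_wpM2l ?sqn_ge0 // /D; lra.
have /andP[hyM _] := H y hy; have /andP[_ hy'M] := H _ hTy.
have Nx : N k x <= height x by rewrite /N gerDl; nra.
have Nx' : N k' (mobius (T k) x) <= height (mobius (T k) x).
  by rewrite /N gerDl k'E; rewrite k'E in x'0; nra.
have Ny : N k y * N k' (mobius (T k) y) <= height y * height (mobius (T k) y).
  have h1 : N k y <= height y - 2 * lor (e k) o * q.
    by rewrite /N lerD2l; have := ler_wnM2l (ltW oN) Ey; lra.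
  have h2 : N k' (mobius (T k) y) <= height (mobius (T k) y) + 2 * lor (e (l + 1)) o * eta.
    by rewrite /N lerD2l k'E; have := ler_wnM2l (ltW oN') yeta; lra.
  apply: le_trans (ler_pM (ltW (N_gt0 _ hy)) (ltW (N_gt0 _ hTy)) h1 h2) _.
  have qE : lor (e k) o * q * M = lor (e (l + 1)) o * eta * m.
    by rewrite /q; field; rewrite (gt_eqF M0) lt_eqF.
  have hM : 0 <= M - height (mobius (T k) y) by rewrite subr_ge0.
  have hm : 0 <= height y - m by rewrite subr_ge0.
  have o1 : 0 <= - lor (e k) o * q by apply: mulr_ge0; [rewrite oppr_ge0 ltW|exact: ltW].
  have o2 : 0 <= - lor (e (l + 1)) o * eta.
    by apply: mulr_ge0; [rewrite oppr_ge0 ltW|exact: ltW].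
  have p1 := mulr_ge0 o1 hM; have p2 := mulr_ge0 o2 hm; have p3 := mulr_ge0 o1 o2.
  lra.
have E := gap_T k hx hy; rewrite {1}/gap in E.
have h1 := height_gt0 x; have h2 := height_gt0 y.
have h1' := height_gt0 (mobius (T k) x); have h2' := height_gt0 (mobius (T k) y).
have n1 := N_gt0 k hx; have n2 := N_gt0 k hy.
have n1' := N_gt0 k' hTx; have n2' := N_gt0 k' hTy.
have -> : sqn (mobius (T k) x - mobius (T k) y) = sqn (x - y) / (N k x * N k y) *
    (height (mobius (T k) x) * height (mobius (T k) y)).
  by rewrite -E divfK // mulf_neq0 ?gt_eqF.
have s0 := sqn_ge0 (x - y).
have key : N k x * N k y * (N k' (mobius (T k) x) * N k' (mobius (T k) y)) <=
    height (mobius (T k) x) * height (mobius (T k) y) * (height x * height y).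
  have := ler_pM (ltW (mulr_gt0 n1 n1')) (ltW (mulr_gt0 n2 n2'))
    (ler_pM (ltW n1) (ltW n1') Nx Nx') Ny; lra.
have B0 := mulr_gt0 n1 n2; have B0' := mulr_gt0 n1' n2'.
have A0 := mulr_gt0 h1 h2.
rewrite /gap -(mulrA (sqn _)) -(mulrA (sqn _)) ler_wpM2l // -mulrA mulrCA -invfM.
by rewrite ler_pdivlMr ?mulr_gt0 // mulrC ler_pdivrMr.
Qed.

Lemma orbit_gap x y : circle x -> circle y -> x <> y -> exists2 c, 0 < c & forall m : nat,
  exists h, [/\ generated_group T h, iter m F x = mobius h x &
    c <= sqn (mobius h x - mobius h y)].
Proof.
move=> hx hy xy; have [b [B [b0 B0 hB]]] := timelike_bounds (center_timelike Q).
have [c c0 H1] := gap_step; have [r r0 H2] := gap_step2.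
have g0 : 0 < gap x y.
  rewrite /gap divr_gt0 ?mulr_gt0 ?height_gt0 //.
  by rewrite sqn_gt0 subr_eq0; apply/eqP.
(* The smaller of the initial gap and of what one step leaves of the gap between two points farther
   apart than [r]. *)
pose mu := Num.min (gap x y) (c * (r / B ^+ 2)).
have B20 : 0 < B ^+ 2 by rewrite exprn_gt0.
have mu0 : 0 < mu by rewrite lt_min g0 mulr_gt0 ?divr_gt0.
have cirT h z : generated_group T h -> circle z -> circle (mobius h z).
  by move=> /sG; exact: mobius_circle.
(* The invariant: the gap is at least [mu], or the orbit is halfway through a pair of steps governed
   by [gap_step2], with at most the factor [c] lost. *)
have claim (m : nat) : exists h, [/\ generated_group T h, iter m F x = mobius h x &
   mu <= gap (mobius h x) (mobius h y) \/
   c * mu <= gap (mobius h x) (mobius h y) /\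
   forall k, deformed_branch k (mobius h x) ->
     mu <= gap (mobius (T k * h) x) (mobius (T k * h) y)].
  elim: m => [|m [h [hG hE hgap]]].
    exists 1; split; [exact: generated_1|by rewrite mobius1|left].
    by rewrite !mobius1 ge_min lexx.
  have hhx := cirT h x hG hx; have hhy := cirT h y hG hy.
  have [k hk] := deformed_branch_ex hhx; exists (T k * h).
  have sk := rotation_SU11 hT k; have sh := sG hG.
  have dx := circle_closed hx; have dy := circle_closed hy.
  split; first by apply: generated_M => //; exact: generated_gen.
    by rewrite iterS hE (deformedE hk) mobiusM.
  case: hgap => [hgap|[_ /(_ k hk)]]; last by left.
  rewrite !mobiusM //; case: (lerP 0 (lor (e k) (hlift (mobius h y)))) => hey.
    by left; apply: le_trans hgap (gap_T_ge _ _ hk hey).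
  case: (lerP (sqn (mobius h x - mobius h y)) r) => hr; last first.
    left; apply: le_trans (H1 k _ _ hhx hhy).
    apply: (@le_trans _ _ (c * (r / B ^+ 2))); first by rewrite ge_min lexx orbT.
    rewrite ler_pM2l // /gap; apply: ler_pM; rewrite ?invr_ge0 ?(ltW r0) ?(ltW hr) ?(ltW B20) //.
    rewrite lef_pV2 ?posrE ?mulr_gt0 ?height_gt0 // expr2.
    have /andP[_ h1] := hB _ hhx; have /andP[_ h2] := hB _ hhy.
    by apply: ler_pM => //; exact/ltW/height_gt0.
  right; split; first by apply: le_trans (H1 k _ _ hhx hhy); rewrite ler_pM2l.
  have d1 := circle_closed hhx; have d2 := circle_closed hhy.
  move=> k' hk'; have sk' := rotation_SU11 hT k'; have sM := SU11_M sk' sk.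
  rewrite mulrA (mobiusM sM sh dx) (mobiusM sM sh dy).
  by apply: le_trans hgap _; exact: H2.
pose mu' := Num.min mu (c * mu).
have mu'0 : 0 < mu' by rewrite lt_min mu0 mulr_gt0.
exists (mu' * b ^+ 2); first by rewrite mulr_gt0 ?exprn_gt0.
move=> m; have [h [hG hE hgap]] := claim m; exists h; split => //.
have : mu' <= gap (mobius h x) (mobius h y).
  by case: hgap => [hg|[hg _]]; rewrite ge_min hg ?orbT.
have /andP[h1 _] := hB _ (cirT h x hG hx); have /andP[h2 _] := hB _ (cirT h y hG hy).
rewrite /gap ler_pdivlMr ?mulr_gt0 ?height_gt0 //; apply: le_trans.
by rewrite ler_pM2l // expr2; apply: ler_pM => //; exact: ltW.
Qed.

(** * Finiteness of the orbit of a hyperbolic fixed point *)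

Lemma den_conj (g h : 'M[C]_2) z : SU11 g -> SU11 h -> closed_disk z -> mobius g z = z ->
  den (h * g * h^-1) (mobius h z) = den g z.
Proof.
move=> sg sh dz gz; have sV := SU11_V sh; have dhz := mobius_closed sh dz.
have E : den h^-1 (mobius h z) * den h z = 1.
  by rewrite -denM // SU11_mulVr // /den !mx21E mul0r add0r.
rewrite denM // mobiusK // denM // gz -[RHS]mul1r -E; ring.
Qed.

(** The fixed points are the roots of [g 1 0 * X ^+ 2 + (g 1 1 - g 0 0) * X - g 0 1], so their
    product gives the second one. It is on the circle because [g 0 1] and [g 1 0] have the same
    modulus; a double root would make the square of the trace 4. *)
Lemma second_fixed_point (g : 'M[C]_2) x : hyperbolic g -> circle x -> mobius g x = x ->
  exists y, [/\ circle y, x <> y, mobius g y = y & g 1 0 != 0].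
Proof.
move=> /hyperbolicP[sg hg] hx gx; have [g10 g11 dg] := sg; rewrite det_mx2 in dg.
have d := SU11_sqn sg; have dx := circle_closed hx.
have c0 : g 1 0 != 0.
  apply/eqP => c0; have b0 : g 0 1 = 0 by rewrite -[g 0 1]conjCK -g10 c0 rmorph0.
  move: d hg; rewrite b0 /sqn !ReImE; have := sqr_ge0 (complex.Im (g 0 0)); lra.
have x0 : x != 0.
  by apply/eqP => x0; move/circleE: hx; rewrite x0 /sqn !ReImE; lra.
have yE : g 1 0 * x * (- g 0 1 / (g 1 0 * x)) = - g 0 1.
  by rewrite mulrCA divff ?mulr1 // mulf_neq0.
move: (- g 0 1 / _) yE => y yE.
have hy : circle y.
  apply/circleE; have := congr1 (@sqn R) yE; have /circleE x1 := hx.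
  rewrite !sqnM x1 mulr1 sqnN g10 sqnJ -[RHS]mulr1; apply: mulfI.
  by rewrite -sqnJ -g10 sqn_eq0.
have xE : g 1 0 * x ^+ 2 + (g 1 1 - g 0 0) * x = g 0 1.
  have := mobius_den sg dx; rewrite gx /den /num => E.
  by apply: (addrI (g 0 0 * x)); rewrite -E; ring.
have trE : g 0 0 + g 1 1 = (2 * complex.Re (g 0 0))%:C%C.
  by rewrite g11; apply: complexP; rewrite !ReImE; ring.
exists y; split => //.
- move=> xy; rewrite -xy in yE.
  have tr2 : (g 0 0 + g 1 1) ^+ 2 = 4.
    have D0 : 2 * (g 1 0 * x) = g 0 0 - g 1 1.
      apply: (mulIf x0).
      transitivity (g 1 0 * x ^+ 2 + (g 1 1 - g 0 0) * x + g 1 0 * x * x +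
        (g 0 0 - g 1 1) * x); first by ring.
      by rewrite xE yE subrr add0r.
    have <- : 4 * (g 0 0 * g 1 1 - g 0 1 * g 1 0) = 4 by rewrite dg mulr1.
    have : (2 * (g 1 0 * x)) ^+ 2 = (g 0 0 - g 1 1) ^+ 2 by rewrite D0.
    have -> : (2 * (g 1 0 * x)) ^+ 2 = 4 * g 1 0 * (g 1 0 * x * x) by ring.
    rewrite yE => E; transitivity ((g 0 0 - g 1 1) ^+ 2 + 4 * (g 0 0 * g 1 1)); first by ring.
    by rewrite -E; ring.
  move: tr2; rewrite trE (_ : 4 = 4%:C%C :> C); last by rewrite rmorph_nat.
  by rewrite -rmorphXn => /complexI; move: hg; lra.
- have gy : y * den g y = num g y.
    have bE : g 0 1 * y = - g 0 1 * x + (g 1 1 - g 0 0) * x * y.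
      by rewrite -{1}xE -yE; ring.
    apply: (mulIf x0); transitivity (g 1 0 * x * y * y + g 1 1 * x * y).
      by rewrite /den; ring.
    by rewrite yE mulNr bE /num; ring.
  by rewrite /mobius -/(num g y) -/(den g y) -gy mulfK // den_neq0 //; exact: circle_closed.
Qed.

(** The iterate is recovered from the conjugate [M = h * g * h^-1]: the eigenvalue [den g x] is
    invariant under conjugation, so [M 1 0 * mobius h x + M 1 1 = den g x]. Subtracting the relation
    for [y] bounds [M 1 0], as the image points stay apart. *)
Lemma hyperbolic_orbit_finite x : hyperbolic_fixed_point T x -> circle x ->
  finite_set [set iter m F x | m in [set: nat]].
Proof.
move=> [g [gT gh gx]] hx; have [y [hy xy gy c0]] := second_fixed_point gh hx gx.
have [c cp H] := orbit_gap hx hy xy; have sg := sG gT.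
have dx := circle_closed hx; have dy := circle_closed hy.
pose B := sqn (den g x - den g y) / c.
pose f (M : 'M[C]_2) := (den g x - M 1 1) / M 1 0.
apply: sub_finite_set (finite_image f (group_bounded_finite B)) => _ [m _ <-].
have [h [hT' hE hgap]] := H m; have sh := sG hT'; rewrite hE.
have MT : generated_group T (h * g * h^-1).
  by do 2?apply: generated_M => //; exact: generated_V.
have := den_conj sg sh dx gx; have := den_conj sg sh dy gy.
move: (h * g * h^-1) MT => M MT; rewrite /den => Ey Ex.
have E : M 1 0 * (mobius h x - mobius h y) = g 1 0 * (x - y).
  transitivity (M 1 0 * mobius h x + M 1 1 - (M 1 0 * mobius h y + M 1 1)); first by ring.
  by rewrite Ex Ey; ring.
have M0 : M 1 0 != 0.
  apply/eqP => M0; move: E; rewrite M0 mul0r => /esym/eqP.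
  by rewrite mulf_eq0 (negPf c0) subr_eq0 => /eqP.
exists M; last by rewrite /f /den -Ex addrK mulrAC divff ?mul1r.
split => //; have [M10 _ _] := sG MT.
rewrite -sqnJ -M10 /B ler_pdivlMr // /den opprD addrACA subrr addr0 -mulrBr -E sqnM.
by rewrite ler_wpM2l ?sqn_ge0.
Qed.

(** * Invariance of the endpoints and the Markov property *)

Lemma T_ends k l x : ends l x -> l = k \/ l = k + 1 -> ends (- l) (mobius (T k) x).
Proof.
move=> [hx [m [rm mk mx]]] lk; have sT := rotation_SU11 hT k.
have gT := generated_gen T k.
split; first exact: mobius_circle.
exists (lact (T k) m); split; first exact: (root_lact Q dv hT gT rm).
  have [v1 v2] := T_vertex Q dv hT k.
  have -> : P (- l) = hlift (mobius (T k) (v l)) by case: lk => ->; rewrite ?v1 ?v2.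
  by apply/lor_mobius => //; exact: disk_closed.
by apply/lor_mobius => //; exact: circle_closed.
Qed.

(** A label on which [T k] is used ends a mirror through [v k] or [v (k + 1)], the ends of the side
    that [T k] pairs: by [root_corner] on the early arc, by [root_sector] elsewhere. *)
Lemma deformed_label x : label_set n a x -> label_set n a (F x).
Proof.
move=> /label_setP[l lx]; have hx := ends_circle lx.
have ca := hlift_causal x.
have [k hk] := deformed_branch_ex hx; rewrite (deformedE hk); apply/label_setP.
suff [l' [lx' lk]] : exists l', ends l' x /\ (l' = k \/ l' = k + 1).
  by exists (- l'); exact: T_ends.
case: lx => _ [m [rm mk mx]].
have [ex|nex] := pselect (early x).
  have kE : k = i0 + 3 by move: hk; rewrite /deformed_branch; case: pselect.
  have [i0x i3x] := deformation_sides (early_deformation ex).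
  exists i0; split; last by right; rewrite kE Z4A.
  case: i0x => [i0x|->]; last exact: sE_ends.
  split => //; exists m; split => //.
  by rewrite -(root_corner Q ca rm mk mx i0x i3x).
have bx : branch k x by move: hk; rewrite /deformed_branch; case: pselect.
have k0 := branch_ge0 bx; have [_ _ k1] := (branchP k x).1 bx.
have [m' [l' [rm' mx' ml' lk]]] := root_sector Q ca rm mk mx k0 k1.
by exists l'; split => //; split => //; exists m'.
Qed.

Let W := deformed_label_set T n a i0 alpha.

Lemma label_W x : label_set n a x -> W x. Proof. by left; left. Qed.

Lemma sE_W k : W (sE k).
Proof. by apply/label_W/label_setP; exists k; exact: sE_ends. Qed.

Lemma alpha_W : W alpha.
Proof. by left; right; exists 0%N. Qed.

Lemma deformed_W x : W x -> W (F x).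
Proof.
case=> [[/deformed_label/label_W//|]|] [m _ <-].
  by left; right; exists m.+1.
by right; exists m.+1.
Qed.

Lemma T_alpha_W : W (mobius (T (i0 + 3)) alpha).
Proof. by right; exists 0%N => //=; congr (mobius (T _) _); rewrite Z4D. Qed.

Lemma T_sE_next_W k : W (mobius (T k) (sE (k + 1))).
Proof.
apply/label_W/label_setP; exists (- (k + 1)).
by apply: T_ends; [exact: sE_ends|right].
Qed.

(** Used for the right end of an arc, which the arc does not contain and which may already belong to
    the next branch. *)
Lemma arc_end x y X Y : W Y -> circle y -> x <> y ->
  (forall w, W w -> circle_arc x y w -> w = x) -> circle_arc X Y x ->
  y = Y \/ ccw X y Y /\ (X = x \/ ccw X x y).
Proof.
move=> WY hy xy clean /circle_arcP[hX hY XY Xx].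
have [->|yY] := pselect (y = Y); [by left|right].
have hx : circle x by case: Xx => [->|[]].
have xY : x <> Y by case: Xx => [->|/ccw_neq[]].
have xyY : ccw x y Y.
  case: (ccw_total hx hy hY xy yY xY) => // xYy.
  by case: xY; apply/esym/clean => //; apply/circle_arcP; split => //; right.
case: Xx => [<-|XxY]; first by split => //; left.
have xYX := ccw_rot XxY.
split; last by right; exact/ccw_rot/ccw_rot/(ccw_trans xyY xYX).
exact/ccw_rot/ccw_rot/(ccw_trans' xyY xYX).
Qed.

Lemma early_branch x : early x -> branch i0 x.
Proof.
move=> ex; have hx := circle_arc_circle ex.
have [h0 h3] := deformation_sides (early_deformation ex).
apply/branchP; split => //.
by have := opposite Q (hlift_causal x) (ltW h3); rewrite Z4A.
Qed.

(** An arc lies in one branch because the ends of the branches belong to [W]. If its right end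
    starts the next branch, it is [alpha] or [sE (k + 1)], and its image under the rotation of the
    arc is in [W] nevertheless. For [alpha] this is the role of the second orbit in the definition
    of [W]. *)
Lemma arc_deformed_branch x y : W x -> W y -> x <> y ->
  (forall w, W w -> circle_arc x y w -> w = x) ->
  exists k, [/\ forall z, circle_arc x y z -> deformed_branch k z,
    W (mobius (T k) x) & W (mobius (T k) y)].
Proof.
move=> Wx Wy xy clean; have Wc := deformed_label_circle.
have hx : circle x := Wc x Wx; have hy : circle y := Wc y Wy.
have Ix : circle_arc x y x by apply/circle_arcP; split => //; left.
have [ex|nex] := pselect (early x).
  have sub : circle_arc x y `<=` early.
    exact: (arc_sub Wc Wx Wy (sE_W i0) alpha_W clean Ix ex).
  have late z : early z -> deformed_branch (i0 + 3) z by rewrite /deformed_branch; case: pselect.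
  exists (i0 + 3); split; first by move=> z /sub/late.
    by rewrite -(deformedE (late _ ex)); exact: deformed_W.
  case: (arc_end alpha_W hy xy clean ex) => [->|[eY _]]; first exact: T_alpha_W.
  have ey : early y.
    by move/circle_arcP: ex => [? ? ? _]; apply/circle_arcP; split => //; right.
  by rewrite -(deformedE (late _ ey)); exact: deformed_W.
have [k bx] := branch_cover hx.
have sub : circle_arc x y `<=` branch k.
  exact: (arc_sub Wc Wx Wy (sE_W k) (sE_W (k + 1)) clean Ix bx).
have ne z : circle_arc x y z -> ~ early z.
  move=> Iz ez; apply: nex.
  exact: (arc_sub Wc Wx Wy (sE_W i0) alpha_W clean Iz ez).
have late z : ~ early z -> branch k z -> deformed_branch k z.
  by rewrite /deformed_branch; case: pselect.
exists k; split; first by move=> z Iz; apply: late; [exact: ne|exact: sub].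
  by rewrite -(deformedE (late _ nex bx)); exact: deformed_W.
case: (arc_end (sE_W (k + 1)) hy xy clean bx) => [->|[bY Xxy]]; first exact: T_sE_next_W.
have by' : branch k y.
  by move/circle_arcP: bx => [? ? ? _]; apply/circle_arcP; split => //; right.
(* [early] is an initial part of the branch [i0], so [y] in it would put [x] there too. *)
have ney : ~ early y.
  move=> ey; have kE := branch_disjoint by' (early_branch ey); rewrite kE in Xxy.
  move/circle_arcP: ey => [h1 h2 h3 yE]; apply: nex; apply/circle_arcP; split => //.
  case: Xxy => [->|Xxy]; [by left|right].
  case: yE => [yE|yE]; last exact: ccw_trans Xxy yE.
  by have [_ _ []] := ccw_neq Xxy; rewrite yE.
by rewrite -(deformedE (late _ ney by')); exact: deformed_W.
Qed.

(** The image of an arc is an arc with ends in [W], so by [arc_sub] it contains every arc that it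
    meets. *)
Lemma finite_markov : finite_set W -> is_markov F (arcs_of W).
Proof.
move=> Wfin; have Wc := deformed_label_circle.
have W2 : exists w1 w2, [/\ W w1, W w2 & w1 <> w2].
  exists (sE i0), (tE i0); split; [exact: sE_W| |exact/nesym/tE_neq_sE].
  by apply/label_W/label_setP; exists i0; exact: tE_ends.
have [fin part] := arcs_of_partition Wc Wfin W2; split => //.
move=> I J [x [y [Wx Wy xy -> clean]]] [x' [y' [Wx' Wy' xy' -> clean']]].
have [k [late WTx WTy]] := arc_deformed_branch Wx Wy xy clean.
have -> : F @` circle_arc x y = mobius (T k) @` circle_arc x y.
  by apply: eq_imagel => z /late/deformedE.
rewrite mobius_arc; [|exact: rotation_SU11 hT k|exact: Wc|exact: Wc].
by move=> [z [zI zJ]]; exact: (arc_sub Wc Wx' Wy' WTx WTy clean' zJ zI).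
Qed.

Lemma label_set_finite : finite_set (label_set n a).
Proof.
pose B := (\max_i n i)%N.
pose S := (fun p : 'Z_4 * nat => a p.1 p.2) @` (setT `*` `I_((2 * B).+1)).
apply: (@sub_finite_set _ _ S); last by apply/finite_image/finite_setX => //; exact: finite_finset.
move=> _ [i [k [/andP[_ kn] ->]]]; exists (i, k) => //; split => //=.
have := leq_bigmax (F := n) i; rewrite -/B; lia.
Qed.

Lemma hyperbolic_markov : hyperbolic_fixed_point T alpha -> is_markov F (arcs_of W).
Proof.
move=> ah; apply: finite_markov; rewrite !finite_setU; do 2?split.
- exact: label_set_finite.
- exact: hyperbolic_orbit_finite ah alpha_circle.
(* The second orbit starts at an image of [alpha] under the group, again a hyperbolic fixed point by
   conjugation. *)
have sT := rotation_SU11 hT (i0 - 1); have hx := mobius_circle sT alpha_circle.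
apply: hyperbolic_orbit_finite => //; have [g [gT gh ga]] := ah.
have gV := generated_V (generated_gen T (i0 - 1)).
apply: (conj_hyperbolic gV gT gh hx).
by rewrite mobiusK //; exact/circle_closed/alpha_circle.
Qed.

End Deformation.

End Labels.

Theorem theorem3 (R : realType) (m1 m2 m3 : nat)
    (v : 'Z_4 -> R[i]) (T : 'Z_4 -> 'M[R[i]]_2)
    (n : 'Z_4 -> nat) (a : 'Z_4 -> nat -> R[i])
    (hm : admissible m1 m2 m3)
    (hv : bowen_series_domain m1 m2 m3 v)
    (hT : side_rotations v T)
    (ha : vertex_labels v T n a)
    (i : 'Z_4) (alpha : R[i]) (halpha : deformation_arc n a i alpha) :
  is_markov (deformed_map T n a i alpha)
         (arcs_of (deformed_label_set T n a i alpha)) <->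
  hyperbolic_fixed_point T alpha.
Proof.
have Q := domain_quadrilateral hm hv; have [dv _ _ _] := hv.
split; first exact: (markov_hyperbolic Q dv hT ha halpha).
exact: (hyperbolic_markov Q dv hT ha halpha).
Qed.
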